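(* Let $L$ be a locally compact group, $M$ a compact open subgroup, and $\sigma$ an irreducible (continuous unitary) representation of $M$ on $V_\sigma$ (so $V_\sigma$ is finite-dimensional). Let $A=C^*(L)\otimes\mathcal{B}(V_\sigma)$, let $$p_\sigma=\int_M\lambda(k)\otimes\sigma(k)\,dk\in A,$$ and let $\psi_\sigma$ be the idempotent in $C^*(M)$ given by $\psi_\sigma(k)=d(\sigma)\operatorname{Tr}(\sigma(k))$, $k\in M$, regarded as a projection in $M(C^*(L))$. Then the generalised Hecke $C^*$-algebra $p_\sigma Ap_\sigma$ is Morita-Rieffel equivalent to the ideal $\overline{C^*(L)\psi_\sigma C^*(L)}$ in $C^*(L)$.
   Context: $dk$ is normalised Haar measure on $M$ and Haar measure on $L$ is normalised so that $M$ has measure $1$. $\lambda(k)$ is the unitary in the multiplier algebra $M(C^*(L))$ corresponding to $k\in M$; $d(\sigma)=\dim V_\sigma$; $\operatorname{Tr}$ is the unnormalised trace on $\mathcal{B}(V_\sigma)$. The element of $M(C^*(L))$ corresponding to $\psi_\sigma$ is $\int_M\psi_\sigma(k)\lambda(k)\,dk$. $\overline{C^*(L)\psi_\sigma C^*(L)}$ denotes the closed linear span of products $a\psi_\sigma b$. The algebra $p_\sigma Ap_\sigma$ is the closure in $A$ of the generalised Hecke algebra $\mathcal{H}_\sigma(L,M)=\{f\in C_c(L,\mathcal{B}(V_\sigma))\mid f(mxn)=\sigma(m)f(x)\sigma(n)\ \forall m,n\in M,x\in L\}$. Morita-Rieffel equivalence of $C^*$-algebras means existence of an imprimitivity bimodule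 (with full inner products) in the sense of Rieffel. *)

(* Defs.v *)
From HB Require Import structures.
From mathcomp Require Import all_boot all_order all_algebra.
From mathcomp Require Import all_classical all_reals all_analysis.
From mathcomp Require Import complex.
Set Implicit Arguments.
Unset Strict Implicit.
Unset Printing Implicit Defensive.
Import Order.TTheory GRing.Theory Num.Theory numFieldNormedType.Exports.
Local Open Scope classical_set_scope.
Local Open Scope ring_scope.
Local Open Scope complex_scope.

(* MathComp rings are unital, so the product of a possibly non-unital
   C*-algebra is a separate operation [cmul].  The norm of a normed module
   over R[i] takes its (real) values in R[i]. *)
HB.mixin Record isCstarAlgebra (R : realType) A
    & CompleteNormedModule R[i] A := {
  cmul : A -> A -> A;
  star : A -> A;
  cmulA : associative cmul;
  cmul_linearl : forall b, linear (cmul ^~ b);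
  cmul_linearr : forall a, linear (cmul a);
  cmul_norm : forall a b, `|cmul a b| <= `|a| * `|b|;
  starD : {morph star : a b / a + b};
  starZ : forall (z : R[i]) a, star (z *: a) = z^* *: star a;
  starK : involutive star;
  starM : forall a b, star (cmul a b) = cmul (star b) (star a);
  cstar_identity : forall a, `|cmul (star a) a| = `|a| ^+ 2
}.

#[short(type="cstarAlgType")]
HB.structure Definition CstarAlgebra (R : realType) :=
  {A of isCstarAlgebra R A & CompleteNormedModule R[i] A}.

Notation "a ** b" := (cmul a b) (at level 40, left associativity) : ring_scope.

Definition lspan (R : realType) (A : lmodType R[i]) (S : set A) : set A :=
  [set x | exists (n : nat) (z : 'I_n -> R[i]) (s : 'I_n -> A),
     (forall i, S (s i)) /\ x = \sum_(i < n) z i *: s i].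

Definition closed_span (R : realType) (A : cstarAlgType R) (S : set A) :
  set A := closure (lspan S).

Record cstar_subalgebra (R : realType) (A : cstarAlgType R) (S : set A) :
    Prop := {
  csub_closed : closed S;
  csub0 : S 0;
  csub_linear : forall (z : R[i]) a b, S a -> S b -> S (z *: a + b);
  csubM : forall a b, S a -> S b -> S (a ** b);
  csub_star : forall a, S a -> S (star a)
}.

Definition corner (R : realType) (A : cstarAlgType R) (p : A) : set A :=
  [set p ** a ** p | a in [set: A]].

(* The elements of M(A) are the double centralisers of A.  Linearity and
   boundedness of both maps follow from [mult_compat] (Busby). *)
Record multiplier (R : realType) (A : cstarAlgType R) := Multiplier {
  mult_l : A -> A;
  mult_r : A -> A;
  mult_compat : forall a b, a ** mult_l b = mult_r a ** b
}.

Definition mult_of (R : realType) (A : cstarAlgType R) (p : A) :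
  multiplier A :=
  @Multiplier R A (fun a => p ** a) (fun a => a ** p)
    (fun a b => cmulA a p b).

(* Each of the C*-algebras involved is given as a C*-subalgebra S of an
   ambient C*-algebra A (a C*-algebra itself being the case S = setT), so the
   action [act] only matters on S, and positivity of the inner product means
   being of the form c^* c with c in S.  Convergence in the norm
   |<x, x>|^(1/2) is expressed with |<x, x>|. *)
Definition ip_complete (R : realType) (A : cstarAlgType R) (X : lmodType R[i])
    (ip : X -> X -> A) : Prop :=
  forall u : nat -> X,
    (forall e : R[i], 0 < e -> exists N : nat, forall m n : nat,
        (N <= m)%N -> (N <= n)%N -> `|ip (u m - u n) (u m - u n)| < e) ->
    exists x : X, forall e : R[i], 0 < e -> exists N : nat, forall n : nat,
        (N <= n)%N -> `|ip (u n - x) (u n - x)| < e.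

Record full_left_hilbert_module (R : realType) (A : cstarAlgType R)
    (S : set A) (X : lmodType R[i]) (act : A -> X -> X) (ip : X -> X -> A) :
    Prop := {
  lact_linear : forall a, S a -> linear (act a);
  lact_linear_alg : forall (z : R[i]) a b x, S a -> S b ->
    act (z *: a + b) x = z *: act a x + act b x;
  lactM : forall a b x, S a -> S b -> act (a ** b) x = act a (act b x);
  lip_in : forall x y, S (ip x y);
  lip_linear : forall y, linear (ip ^~ y);
  lip_act : forall a x y, S a -> ip (act a x) y = a ** ip x y;
  lip_star : forall x y, star (ip x y) = ip y x;
  lip_pos : forall x, exists2 c, S c & ip x x = star c ** c;
  lip_def : forall x, ip x x = 0 -> x = 0;
  lip_complete : ip_complete ip;
  lip_full : closed_span [set a | exists x y, a = ip x y] = S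
}.

Record full_right_hilbert_module (R : realType) (B : cstarAlgType R)
    (S : set B) (X : lmodType R[i]) (act : X -> B -> X) (ip : X -> X -> B) :
    Prop := {
  ract_linear : forall b, S b -> linear (act ^~ b);
  ract_linear_alg : forall (z : R[i]) a b x, S a -> S b ->
    act x (z *: a + b) = z *: act x a + act x b;
  ractM : forall a b x, S a -> S b -> act x (a ** b) = act (act x a) b;
  rip_in : forall x y, S (ip x y);
  rip_linear : forall x, linear (ip x);
  rip_act : forall b x y, S b -> ip x (act y b) = ip x y ** b;
  rip_star : forall x y, star (ip x y) = ip y x;
  rip_pos : forall x, exists2 c, S c & ip x x = star c ** c;
  rip_def : forall x, ip x x = 0 -> x = 0;
  rip_complete : ip_complete ip;
  rip_full : closed_span [set b | exists x y, b = ip x y] = S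
}.

Record imprimitivity_bimodule (R : realType) (A B : cstarAlgType R)
    (S : set A) (T : set B) (X : lmodType R[i])
    (lact : A -> X -> X) (ract : X -> B -> X)
    (lip : X -> X -> A) (rip : X -> X -> B) : Prop := {
  imp_left : full_left_hilbert_module S lact lip;
  imp_right : full_right_hilbert_module T ract rip;
  imp_bimodule : forall a x b, S a -> T b ->
    ract (lact a x) b = lact a (ract x b);
  imp_lact_adj : forall a x y, S a -> rip (lact a x) y = rip x (lact (star a) y);
  imp_ract_adj : forall b x y, T b -> lip (ract x b) y = lip x (ract y (star b));
  imp_compat : forall x y z, lact (lip x y) z = ract x (rip y z)
}.

Definition morita_rieffel (R : realType) (A B : cstarAlgType R)
    (S : set A) (T : set B) : Prop :=
  [/\ cstar_subalgebra S, cstar_subalgebra T &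
    exists (X : lmodType R[i]) (lact : A -> X -> X) (ract : X -> B -> X)
           (lip : X -> X -> A) (rip : X -> X -> B),
      imprimitivity_bimodule S T lact ract lip rip].

HB.mixin Record isTopologicalGroup L & PointedTopological L & Group L := {
  mulg_continuous : continuous ((fun xy => xy.1 * xy.2)%g : L * L -> L);
  invg_continuous : continuous ((fun x => x^-1)%g : L -> L)
}.

(* A chosen point is required by the library to put a Borel sigma-algebra
   on L; it plays no role. *)
#[short(type="topologicalGroupType")]
HB.structure Definition TopologicalGroup :=
  {L of isTopologicalGroup L & PointedTopological L & Group L}.

Definition locally_compact_group (L : topologicalGroupType) : Prop :=
  hausdorff_space L /\ locally_compact [set: L].

Record is_subgroup (L : topologicalGroupType) (M : set L) : Prop := {
  subgroup1 : M 1%g;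
  subgroupM : forall x y, M x -> M y -> M (x * y)%g;
  subgroupV : forall x, M x -> M (x^-1)%g
}.

Notation borel L := (g_sigma_algebraType (@open L)).

Record is_left_haar (R : realType) (L : topologicalGroupType)
    (mu : {measure set (borel L) -> \bar R}) : Prop := {
  haar_left_inv : forall (x : L) (E : set L),
    (@open L).-sigma.-measurable E -> mu [set (x * y)%g | y in E] = mu E;
  haar_compact : forall K : set L, compact K -> (mu K < +oo)%E;
  haar_open : forall U : set L, open U -> U !=set0 -> (0 < mu U)%E;
  haar_outer : forall E : set L, (@open L).-sigma.-measurable E ->
    mu E = ereal_inf [set mu U | U in [set U : set L | open U /\ E `<=` U]];
  haar_inner : forall U : set L, open U ->
    mu U = ereal_sup [set mu K | K in [set K : set L | compact K /\ K `<=` U]]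
}.

Definition is_modular_function (R : realType) (L : topologicalGroupType)
    (mu : {measure set (borel L) -> \bar R}) (Delta : L -> R) : Prop :=
  (forall x, 0 < Delta x) /\
  forall (x : L) (E : set L), (@open L).-sigma.-measurable E ->
    mu [set (y * x)%g | y in E] = ((Delta x)%:E * mu E)%E.

Definition cintegral (R : realType) (L : topologicalGroupType)
    (mu : {measure set (borel L) -> \bar R}) (D : set L) (f : L -> R[i]) :
    R[i] :=
  (Rintegral mu D (fun x => complex.Re (f x)))
    +i* (Rintegral mu D (fun x => complex.Im (f x))).

(* An inner product is linear in its first argument. *)
Definition inner_complete (R : realType) (H : lmodType R[i])
    (dot : {dot H for Num.conj}) : Prop :=
  forall u : nat -> H,
    (forall e : R[i], 0 < e -> exists N : nat, forall m n : nat,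
        (N <= m)%N -> (N <= n)%N -> dot (u m - u n) (u m - u n) < e) ->
    exists x : H, forall e : R[i], 0 < e -> exists N : nat, forall n : nat,
        (N <= n)%N -> dot (u n - x) (u n - x) < e.

(* A strongly continuous unitary representation of the subgroup G of L; the
   values of pi outside G are irrelevant. *)
Record unitary_rep (R : realType) (L : topologicalGroupType) (G : set L)
    (H : lmodType R[i]) (dot : {dot H for Num.conj}) (pi : L -> H -> H) :
    Prop := {
  rep_linear : forall k, G k -> linear (pi k);
  rep_dot : forall k v w, G k -> dot (pi k v) (pi k w) = dot v w;
  rep1 : forall v, pi 1%g v = v;
  repM : forall k h v, G k -> G h -> pi (k * h)%g v = pi k (pi h v);
  rep_continuous : forall v k0, G k0 ->
    (fun k => dot (pi k v - pi k0 v) (pi k v - pi k0 v) : R[i]^o)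
      @ within G (nbhs k0) --> (0 : R[i]^o)
}.

Definition irreducible_rep (R : realType) (L : topologicalGroupType)
    (G : set L) (V : vectType R[i]) (sigma : L -> 'End(V)) : Prop :=
  (0 < \dim {:V})%N /\
  forall W : {vspace V},
    (forall k, G k -> (sigma k @: W <= W)%VS) -> W = 0%VS \/ W = {:V}%VS.

Definition lfun_trace (R : realType) (V : vectType R[i]) (T : 'End(V)) : R[i] :=
  \tr (passmx.mxof (vbasis {:V}) (vbasis {:V}) T).

Definition is_adjoint (R : realType) (V : vectType R[i])
    (dot : {dot V for Num.conj}) (S T : 'End(V)) : Prop :=
  forall v w, dot (S v) w = dot v (T w).

Definition Cc (R : realType) (L : topologicalGroupType) : set (L -> R[i]) :=
  [set f | continuous (f : L -> R[i]^o) /\ compact (closure [set x | f x != 0])].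
Arguments Cc : clear implicits.

Definition convolution (R : realType) (L : topologicalGroupType)
    (mu : {measure set (borel L) -> \bar R}) (f g : L -> R[i]) : L -> R[i] :=
  fun x => cintegral mu [set: L] (fun y => f y * g (y^-1 * x)%g).

Definition Cc_star (R : realType) (L : topologicalGroupType) (Delta : L -> R)
    (f : L -> R[i]) : L -> R[i] :=
  fun x => (Delta (x^-1)%g)%:C * (f (x^-1)%g)^*.

(* T = pi(f) = int_L f(x) pi(x) dx, in the weak sense *)
Definition integrated_form (R : realType) (L : topologicalGroupType)
    (mu : {measure set (borel L) -> \bar R}) (H : lmodType R[i])
    (dot : {dot H for Num.conj}) (pi : L -> H -> H) (f : L -> R[i])
    (T : H -> H) : Prop :=
  forall v w,
    dot (T v) w = cintegral mu [set: L] (fun x => f x * dot (pi x v) w).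

(* The supremum of the operator norms |pi(f)| over all unitary
   representations pi of L on Hilbert spaces. *)
Definition universal_norm (R : realType) (L : topologicalGroupType)
    (mu : {measure set (borel L) -> \bar R}) (f : L -> R[i]) : R :=
  sup [set r : R | 0 <= r /\
    exists (H : lmodType R[i]) (dot : {dot H for Num.conj})
           (pi : L -> H -> H) (T : H -> H) (v : H),
      [/\ inner_complete dot, unitary_rep [set: L] dot pi,
          integrated_form mu dot pi f T, dot v v <= 1
        & r%:C ^+ 2 = dot (T v) (T v)]].

(* [B], with the embedding [j], is a completion C*(L) of the convolution
   *-algebra C_c(L) in the universal norm.  Only the values of [j] on C_c(L)
   are meaningful. *)
Record is_group_cstar (R : realType) (L : topologicalGroupType)
    (mu : {measure set (borel L) -> \bar R}) (Delta : L -> R)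
    (B : cstarAlgType R) (j : (L -> R[i]) -> B) : Prop := {
  gcs_linear : forall (z : R[i]) f g, Cc R L f -> Cc R L g ->
    j (fun x => z * f x + g x) = z *: j f + j g;
  gcs_mul : forall f g, Cc R L f -> Cc R L g ->
    j (convolution mu f g) = j f ** j g;
  gcs_star : forall f, Cc R L f -> j (Cc_star Delta f) = star (j f);
  gcs_norm : forall f, Cc R L f -> `|j f| = (universal_norm mu f)%:C;
  gcs_dense : closure (j @` Cc R L) = [set: B]
}.

(* lambda : L -> M(C*(L)); a multiplier is determined by its left part, and
   that one by its values on the image of C_c(L). *)
Definition is_lambda (R : realType) (L : topologicalGroupType)
    (B : cstarAlgType R) (j : (L -> R[i]) -> B) (lambda : L -> multiplier B) :
    Prop :=
  forall k f, Cc R L f ->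
    mult_l (lambda k) (j f) = j (fun x => f (k^-1 * x)%g).

(* P = int_D F(k) dk in the multiplier algebra M(A), strictly: for each a in A,
   P a is the vector-valued integral int_D F(k) a dk, the latter being
   characterised by continuous linear functionals. *)
Definition is_strict_integral (R : realType) (L : topologicalGroupType)
    (mu : {measure set (borel L) -> \bar R}) (D : set L)
    (A : cstarAlgType R) (F : L -> multiplier A) (P : multiplier A) : Prop :=
  forall (a : A) (phi : {scalar A}), continuous (phi : A -> R[i]^o) ->
    phi (mult_l P a) = cintegral mu D (fun k => phi (mult_l (F k) a)).

(* A, with t b T = b (x) T, is a C*-algebra tensor product of B and B(V), V a
   finite-dimensional Hilbert space; 'End(V) is B(V).  [tensor_inj] says that
   t is injective on the algebraic tensor product. *)
Record is_cstar_tensor (R : realType) (B : cstarAlgType R) (V : vectType R[i])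
    (dot : {dot V for Num.conj}) (A : cstarAlgType R)
    (t : B -> 'End(V) -> A) : Prop := {
  tensor_linearl : forall T, linear (t ^~ T);
  tensor_linearr : forall b, linear (t b);
  tensorM : forall b c S T, t b S ** t c T = t (b ** c) (S \o T)%VF;
  tensor_star : forall b S T, is_adjoint dot S T ->
    star (t b S) = t (star b) T;
  tensor_inj : forall n (b : 'I_n -> B) (T : n.-tuple 'End(V)), free T ->
    \sum_(i < n) t (b i) (tnth T i) = 0 -> forall i, b i = 0;
  tensor_dense : closed_span [set a | exists b T, a = t b T] = [set: A]
}.

Definition is_multiplier_tensor (R : realType) (B : cstarAlgType R)
    (V : vectType R[i]) (A : cstarAlgType R) (t : B -> 'End(V) -> A)
    (m : multiplier B) (S : 'End(V)) (Y : multiplier A) : Prop :=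
  forall b T, mult_l Y (t b T) = t (mult_l m b) (S \o T)%VF.

Definition psi_fun (R : realType) (L : topologicalGroupType)
    (V : vectType R[i]) (sigma : L -> 'End(V)) (k : L) : R[i] :=
  (\dim {:V})%:R * lfun_trace (sigma k).

Lemma mult_scale_compat (R : realType) (A : cstarAlgType R) (z : R[i])
    (m : multiplier A) (a b : A) :
  a ** (z *: mult_l m b) = (z *: mult_r m a) ** b.
Proof.
have h1 := cmul_linearr a z (mult_l m b) 0.
have h2 := cmul_linearl b z (mult_r m a) 0.
have e1 : a ** 0 = 0.
  by have := cmul_linearr a (-1) 0 0; rewrite scaler0 addr0 scaleN1r addNr.
have e2 : 0 ** b = 0.
  by have /= := cmul_linearl b (-1) 0 0; rewrite scaler0 addr0 scaleN1r addNr.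
by move: h1 h2; rewrite /= !addr0 e1 e2 !addr0 => -> ->; rewrite mult_compat.
Qed.

Definition mult_scale (R : realType) (A : cstarAlgType R) (z : R[i])
    (m : multiplier A) : multiplier A :=
  Multiplier (mult_scale_compat z m).

(* Main.v *)
Require Import Defs.
From HB Require Import structures.
From mathcomp Require Import all_boot all_order all_algebra.
From mathcomp Require Import all_classical all_reals all_analysis.
From mathcomp Require Import complex ring lra.
Import Order.TTheory GRing.Theory Num.Theory numFieldNormedType.Exports.
Set Implicit Arguments.
Unset Strict Implicit.
Unset Printing Implicit Defensive.
Local Open Scope classical_set_scope.
Local Open Scope ring_scope.
Local Open Scope complex_scope.

(** Identify [A] with the matrix algebra M_n(B) through an orthonormal basis of
    V and let [E] be a diagonal matrix unit.  Invariance of Haar measure on M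
    makes [p] a projection fixed by all [lambda(k) (x) sigma(k)].  The bimodule
    is [X = p A E], with [x y^*] in [p A p] and [x^* y] in [E A E = B] as inner
    products.  The left one is full since [p a p] is a sum of products of
    entries of [p] and [a].  The right one spans the ideal generated by the
    entries of [p]; [psi] is a multiple of the trace of [p] and, conversely, as
    [p] absorbs [lambda(k) (x) sigma(k)], the partial trace of
    [(1 (x) sigma(k^-1)) p] is [lambda(k) psi] up to a scalar, so that Burnside's
    theorem (the sigma(k) span B(V)) puts every entry of [p] in the ideal of
    [psi].  Completeness of X for both norms and positivity of the inner
    products rest on three facts on C*-algebras: injective *-morphisms are
    isometric, [a^* a] is positive, and positive elements have square roots. *)

(** The algebras need not have a unit, and this shapes everything. Elements such as [1 - h], square
    roots and unitaries are multipliers, so a self-adjoint multiplier is handled as a map [T] with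
    [star (T a) ** b = star a ** T b]; entries of matrices are reached in the form [a ** b_ik ** c];
    and [p = p p] serves to factor elements of the corner. Spectra are replaced by two devices. The
    root of [1 - X] comes from iterating [g := (X + g^2) / 2], which is compared with the scalar
    case [X = 1] and respects every bounded intertwiner. Norm bounds come from commuting
    self-adjoint [x], [y] with [x^2 + y^2 = e^2]: [x + iy] is [e] times a unitary, whence
    [|x| <= e]. The Haar integrals are given weakly and through left multiplication only, so
    functionals separating points are needed, and [star p = p] is not read off the integrand but
    deduced from [star p ** p = star p]. Finally, the norm of [A] is only known to be a C*-norm;
    isometry of injective morphisms identifies it on each copy of [B]. *)

(* Decides identities of abelian groups. *)
Lemma abel_start (V : zmodType) (x y : V) : 0 + x - y = 0 -> x = y.
Proof. by rewrite add0r => /eqP; rewrite subr_eq0 => /eqP. Qed.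

Ltac abel_drop n :=
  first [ rewrite (addrK n) | rewrite (addrAC _ n); abel_drop n ].
Ltac abel_cancel :=
  match goal with |- _ - ?n = _ => abel_drop n end.
Ltac abel :=
  apply: abel_start; rewrite ?(opprD, opprK, addrA, oppr0, addr0);
  repeat match goal with
  | |- context [?a - ?y + ?b] =>
      lazymatch b with
      | - _ => fail
      | _ => rewrite (addrAC a (- y) b)
      end
  end;
  repeat abel_cancel; try reflexivity.

Section LinearFunctions.
Variables (K : pzRingType) (U W : lmodType K) (f : U -> W).
Hypothesis fL : linear f.

Lemma lfD a b : f (a + b) = f a + f b.
Proof. by have := fL 1 a b; rewrite !scale1r. Qed.

Lemma lf0 : f 0 = 0.
Proof. by apply: (addrI (f 0)); rewrite -lfD !addr0. Qed.

Lemma lfZ z a : f (z *: a) = z *: f a.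
Proof. by have := fL z a 0; rewrite lf0 !addr0. Qed.

Lemma lfN a : f (- a) = - f a.
Proof. by rewrite -scaleN1r lfZ scaleN1r. Qed.

Lemma lfB a b : f (a - b) = f a - f b.
Proof. by rewrite lfD lfN. Qed.

Lemma lf_sum I (r : seq I) (P : pred I) (F : I -> U) :
  f (\sum_(i <- r | P i) F i) = \sum_(i <- r | P i) f (F i).
Proof. by apply: (big_morph f lfD lf0). Qed.

End LinearFunctions.

(** * Real-valued norms and metric closure in a C*-algebra *)

Section CstarBasics.
Variables (R : realType) (A : cstarAlgType R).
Implicit Types (a b c : A).

Lemma cmulDl a b c : (a + b) ** c = a ** c + b ** c.
Proof. exact: (lfD (@cmul_linearl _ _ c)). Qed.
Lemma cmulDr a b c : a ** (b + c) = a ** b + a ** c.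
Proof. exact: (lfD (@cmul_linearr _ _ a)). Qed.
Lemma cmulBl a b c : (a - b) ** c = a ** c - b ** c.
Proof. exact: (lfB (@cmul_linearl _ _ c)). Qed.
Lemma cmulBr a b c : a ** (b - c) = a ** b - a ** c.
Proof. exact: (lfB (@cmul_linearr _ _ a)). Qed.
Lemma cmulNl a b : (- a) ** b = - (a ** b).
Proof. exact: (lfN (@cmul_linearl _ _ b)). Qed.
Lemma cmulNr a b : a ** (- b) = - (a ** b).
Proof. exact: (lfN (@cmul_linearr _ _ a)). Qed.
Lemma cmulZl z a b : (z *: a) ** b = z *: (a ** b).
Proof. exact: (lfZ (@cmul_linearl _ _ b)). Qed.
Lemma cmulZr z a b : a ** (z *: b) = z *: (a ** b).
Proof. exact: (lfZ (@cmul_linearr _ _ a)). Qed.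
Lemma cmul0l a : 0 ** a = 0.
Proof. exact: (lf0 (@cmul_linearl _ _ a)). Qed.
Lemma cmul0r a : a ** 0 = 0.
Proof. exact: (lf0 (@cmul_linearr _ _ a)). Qed.
Lemma cmul_suml I (r : seq I) (P : pred I) (F : I -> A) b :
  (\sum_(i <- r | P i) F i) ** b = \sum_(i <- r | P i) F i ** b.
Proof. exact: (lf_sum (@cmul_linearl _ _ b)). Qed.
Lemma cmul_sumr I (r : seq I) (P : pred I) (F : I -> A) b :
  b ** (\sum_(i <- r | P i) F i) = \sum_(i <- r | P i) b ** F i.
Proof. exact: (lf_sum (@cmul_linearr _ _ b)). Qed.

Lemma star0 : star (0 : A) = 0.
Proof. by apply: (addrI (star 0)); rewrite -starD !addr0. Qed.
Lemma starN a : star (- a) = - star a.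
Proof. by apply: (addrI (star a)); rewrite -starD !subrr star0. Qed.
Lemma starB a b : star (a - b) = star a - star b.
Proof. by rewrite starD starN. Qed.
Lemma star_sum I (r : seq I) (P : pred I) (F : I -> A) :
  star (\sum_(i <- r | P i) F i) = \sum_(i <- r | P i) star (F i).
Proof. by apply: (big_morph _ (@starD _ _) star0). Qed.

Lemma starZr (r : R) a : star (r%:C *: a) = r%:C *: star a.
Proof. by rewrite starZ; congr (_ *: _); exact: conjc_real. Qed.

Lemma star_i a : star ('i%C *: a) = - ('i%C *: star a).
Proof.
rewrite starZ -scaleNr; congr (_ *: _).
by change (conjc ('i%C : R[i]) = - 'i%C); apply/eqP;
  rewrite eq_complex /= oppr0 !eqxx.
Qed.

Definition nrm a : R := complex.Re `|a|.

Lemma nrmE a : `|a| = (nrm a)%:C.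
Proof. by rewrite /nrm RRe_real // normr_real. Qed.

Lemma nrm_ge0 a : 0 <= nrm a.
Proof. by rewrite -ler0c -nrmE. Qed.

Lemma nrm0 : nrm 0 = 0.
Proof. by rewrite /nrm normr0. Qed.

Lemma nrm_eq0 a : nrm a = 0 -> a = 0.
Proof. by move=> a0; apply/eqP; rewrite -normr_eq0 nrmE a0. Qed.

Lemma nrm_gt0 a : a != 0 -> 0 < nrm a.
Proof.
move=> a0; rewrite lt_neqAle nrm_ge0 andbT eq_sym.
by apply: contra_neqN a0 => /eqP /nrm_eq0.
Qed.

Lemma nrmD a b : nrm (a + b) <= nrm a + nrm b.
Proof. by rewrite -lecR rmorphD /= -!nrmE ler_normD. Qed.

Lemma nrm_sum I (r : seq I) (P : pred I) (F : I -> A) :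
  nrm (\sum_(i <- r | P i) F i) <= \sum_(i <- r | P i) nrm (F i).
Proof.
elim/big_ind2: _ => [|x1 x2 y1 y2 h1 h2|//]; first by rewrite nrm0.
by apply: le_trans (nrmD _ _) _; exact: lerD.
Qed.

Lemma nrmN a : nrm (- a) = nrm a.
Proof. by rewrite /nrm normrN. Qed.

Lemma nrmB a b : nrm (a - b) <= nrm a + nrm b.
Proof. by rewrite (le_trans (nrmD _ _)) // nrmN. Qed.

Lemma nrm_dist a b : nrm (a - b) = nrm (b - a).
Proof. by rewrite -nrmN opprB. Qed.

Lemma nrmZ z a : nrm (z *: a) = complex.Re `|z| * nrm a.
Proof.
by apply: complexI; rewrite rmorphM /= -!nrmE normrZ; congr (_ * _).
Qed.

Lemma nrmZr (r : R) a : 0 <= r -> nrm (r%:C *: a) = r * nrm a.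
Proof. by move=> r0; rewrite nrmZ ger0_norm // ler0c. Qed.

Lemma nrmM a b : nrm (a ** b) <= nrm a * nrm b.
Proof. by rewrite -lecR rmorphM /= -!nrmE cmul_norm. Qed.

Lemma nrm_cstar a : nrm (star a ** a) = nrm a ^+ 2.
Proof. by apply: complexI; rewrite rmorphXn /= -!nrmE cstar_identity. Qed.

Lemma nrm_star a : nrm (star a) = nrm a.
Proof.
suff H b : nrm b <= nrm (star b).
  by apply/eqP; rewrite eq_le H andbT -{2}(starK a) H.
have [->|b0] := eqVneq b 0; first by rewrite nrm0 nrm_ge0.
by have := nrmM (star b) b; rewrite nrm_cstar expr2 ler_pM2r // nrm_gt0.
Qed.

(** The C*-identity at [b := a] replaces the missing unit when elements are compared through their
    products. *)
Lemma cmul_inj0 a : (forall b, star b ** a = 0) -> a = 0.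
Proof.
move=> /(_ a) h; apply: nrm_eq0; apply/eqP.
by rewrite -sqrf_eq0 -nrm_cstar h nrm0.
Qed.

Lemma nrm_le_cmul a (k : R) : 0 <= k -> (forall b, nrm (a ** b) <= k * nrm b) ->
  nrm a <= k.
Proof.
move=> k0 /(_ (star a)); rewrite nrm_star.
have -> : nrm (a ** star a) = nrm a ^+ 2 by rewrite -{1}[a]starK nrm_cstar nrm_star.
have := nrm_ge0 a; rewrite le_eqVlt => /orP[/eqP <-//|a0].
by rewrite expr2 ler_pM2r.
Qed.

Lemma cmul_inj0r a : (forall b, a ** b = 0) -> a = 0.
Proof.
move=> a0; apply/nrm_eq0/eqP; rewrite eq_le nrm_ge0 andbT.
by apply: nrm_le_cmul => // b; rewrite a0 nrm0 mul0r.
Qed.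

Lemma nrm_complete (u : nat -> A) :
  (forall e : R, 0 < e -> exists N : nat, forall m n : nat,
      (N <= m)%N -> (N <= n)%N -> nrm (u m - u n) < e) ->
  exists l, forall e : R, 0 < e -> exists N : nat, forall n : nat,
      (N <= n)%N -> nrm (u n - l) < e.
Proof.
move=> H.
have cu : cauchy (u @ \oo).
  apply: cauchy_exP => e e0.
  have eE : (complex.Re e)%:C = e by rewrite RRe_real // gtr0_real.
  have [N HN] := H _ (ltac:(by rewrite -ltcR eE) : 0 < complex.Re e).
  exists (u N); exists N => // n /= Nn.
  by rewrite /= -ball_normE /= nrmE -eE ltcR HN.
have /cvg_ex[l ul] : cvg (u @ \oo) by exact: cauchy_cvg.
exists l => e e0.
have : (0 : R[i]) < e%:C by rewrite ltcR.
move/cvgrPdist_lt : ul => /[apply] -[N _ HN]; exists N => n Nn.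
by have := HN n Nn; rewrite nrmE ltcR nrm_dist.
Qed.

Lemma closureP (S : set A) a :
  closure S a <-> forall e : R, 0 < e -> exists2 s, S s & nrm (a - s) < e.
Proof.
split=> [aS e e0|H].
  have /aS [s [Ss]] : nbhs a (ball a (e%:C)) by apply: nbhsx_ballx; rewrite ltcR.
  by rewrite -ball_normE /= nrmE ltcR => ?; exists s.
move=> U /nbhs_ballP[e /= e0 aU].
have eE : (complex.Re e)%:C = e by rewrite RRe_real // gtr0_real.
have [s Ss as_] := H _ (ltac:(by rewrite -ltcR eE) : 0 < complex.Re e).
exists s; split => //; apply: aU.
by rewrite -ball_normE /= nrmE -eE ltcR.
Qed.

Lemma closedP (S : set A) a : closed S ->
  (forall e : R, 0 < e -> exists2 s, S s & nrm (a - s) < e) -> S a.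
Proof. by move=> clS /closureP; exact: clS. Qed.

End CstarBasics.

Lemma eq0_le_eps (R : realType) (x C : R) :
  (forall e, 0 < e -> x <= e * C) -> x <= 0.
Proof.
move=> H; rewrite leNgt; apply/negP => x0.
have := H (x / 2 / (`|C| + 1)).
have C0 : 0 < `|C| + 1 by rewrite ltr_wpDl.
have /[swap]/[apply] : 0 < x / 2 / (`|C| + 1) by rewrite !divr_gt0.
set e := x / 2 / _ => h.
have e0 : 0 < e by rewrite !divr_gt0.
have eE : e * (`|C| + 1) = x / 2 by rewrite divfK // gt_eqF.
have : e * C <= e * `|C| by rewrite ler_pM2l // ler_norm.
nra.
Qed.

(** * Square roots of multipliers *)

Section SelfAdjointMaps.
Variables (R : realType) (A : cstarAlgType R).
Implicit Types (S T X : A -> A) (a b c : A).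

(* A self-adjoint element of M(A), as a map A -> A. *)
Definition sa T := forall a b, star (T a) ** b = star a ** T b.

Definition bd (r : R) T := forall a, nrm (T a) <= r * nrm a.

(** The adjoint relation determines [T a] by its products with all [c], and these depend linearly on
    [a]. *)
Lemma sa_linear T : sa T -> linear T.
Proof.
move=> sT z a b; apply/eqP; rewrite -subr_eq0; apply/eqP/cmul_inj0 => c.
by rewrite cmulBr cmulDr cmulZr -!sT cmulDr cmulZr subrr.
Qed.

Lemma saM T a b : sa T -> T (a ** b) = T a ** b.
Proof.
move=> sT; apply/eqP; rewrite -subr_eq0; apply/eqP/cmul_inj0 => c.
by rewrite cmulBr cmulA -!sT cmulA subrr.
Qed.

Lemma sa_id : sa id.
Proof. by []. Qed.

Lemma sa_comp S T : sa S -> sa T -> (forall a, S (T a) = T (S a)) ->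
  sa (S \o T).
Proof. by move=> sS sT ST a b; rewrite /= sS sT ST. Qed.

Lemma sa_sq T : sa T -> sa (T \o T).
Proof. by move=> sT; apply: sa_comp. Qed.

Lemma saD S T : sa S -> sa T -> sa (fun a => S a + T a).
Proof. by move=> sS sT a b; rewrite starD cmulDl sS sT cmulDr. Qed.

Lemma saN T : sa T -> sa (fun a => - T a).
Proof. by move=> sT a b; rewrite starN cmulNl sT cmulNr. Qed.

Lemma saB S T : sa S -> sa T -> sa (fun a => S a - T a).
Proof. by move=> sS sT; exact: (saD sS (saN sT)). Qed.

Lemma saZ (r : R) T : sa T -> sa (fun a => r%:C *: T a).
Proof.
by move=> sT a b; rewrite starZr cmulZl sT cmulZr.
Qed.

Lemma sa_mul h : star h = h -> sa (cmul h).
Proof. by move=> hh a b; rewrite starM hh cmulA. Qed.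

Lemma bd_mul h : bd (nrm h) (cmul h).
Proof. by move=> a; exact: nrmM. Qed.

Lemma bd_comp r s S T : 0 <= r -> bd r S -> bd s T -> bd (r * s) (S \o T).
Proof.
by move=> r0 bS bT a; rewrite (le_trans (bS _)) // -mulrA ler_wpM2l.
Qed.

Lemma bdW r s T : r <= s -> bd r T -> bd s T.
Proof.
by move=> rs bT a; rewrite (le_trans (bT _)) // ler_wpM2r // nrm_ge0.
Qed.

Lemma bdD r s S T : bd r S -> bd s T -> bd (r + s) (fun a => S a + T a).
Proof.
by move=> bS bT a; rewrite (le_trans (nrmD _ _)) // mulrDl lerD.
Qed.

Lemma bdB r s S T : bd r S -> bd s T -> bd (r + s) (fun a => S a - T a).
Proof.
by move=> bS bT a; rewrite (le_trans (nrmB _ _)) // mulrDl lerD.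
Qed.

Lemma bdZ (t r : R) T : 0 <= t -> bd r T -> bd (t * r) (fun a => t%:C *: T a).
Proof. by move=> t0 bT a; rewrite nrmZr // -mulrA ler_wpM2l. Qed.

Lemma bd_id : bd 1 id.
Proof. by move=> a; rewrite mul1r. Qed.

Lemma bd1_comp S T : bd 1 S -> bd 1 T -> bd 1 (S \o T).
Proof. by move=> bS bT; rewrite -[1]mulr1; apply: bd_comp. Qed.

Lemma bd_sq T : bd 1 T -> bd 1 (T \o T).
Proof. by move=> bT; exact: bd1_comp. Qed.

(* The value of [sqrt_approx X n] at the scalar X = 1. *)
Fixpoint gam (n : nat) : R :=
  if n is m.+1 then (1 + gam m ^+ 2) / 2 else 0.

(* The fixed point of g = (X + g^2) / 2 reached from 0 is 1 - sqrt (1 - X). *)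
Fixpoint sqrt_approx X (n : nat) (a : A) : A :=
  if n is m.+1 then (2^-1)%:C *: (X a + sqrt_approx X m (sqrt_approx X m a))
  else 0.

(** For [v = 1 - gam n] the recursion reads [v - v^2 / 2], which increases on [[0, 1]], and
    [2 / p - 2 / p^2 <= 2 / (p + 1)] propagates the bound. The slow rate reflects the branch point
    of the root at [X = 1]. *)
Lemma gam_bound n : 0 <= gam n /\ 1 - gam n <= 2 / n.+2%:R.
Proof.
elim: n => [|n [g0 g1]] /=; first by split=> //; rewrite subr0 divff.
have n0 : 0 <= n%:R :> R by exact: ler0n.
split; first nra.
have e3 : 0 < n.+3%:R :> R by exact: ltr0n.
have e2 : 0 < n.+2%:R :> R by exact: ltr0n.
have E3 : n.+3%:R = n.+2%:R + 1 :> R by rewrite -natr1.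
have : 2 <= n.+2%:R :> R by rewrite ler_nat.
move: e2 e3 E3 g1; set p : R := n.+2%:R; set q : R := n.+3%:R => e2 e3 qE g1 p2.
set u := 2 / p in g1.
have uE : u * p = 2 by rewrite divfK // gt_eqF.
have u1 : u <= 1 by rewrite ler_pdivrMr // mul1r.
rewrite ler_pdivlMr // qE.
have u0 : 0 <= u by rewrite divr_ge0 // ltW.
have h : 1 - (1 + gam n ^+ 2) / 2 <= u - u ^+ 2 / 2 by nra.
apply: (le_trans (ler_wpM2r _ h)); first by lra.
have -> : (u - u ^+ 2 / 2) * (p + 1) = u * p + u - u * (u * p) / 2 - u ^+ 2 / 2.
  by field.
by rewrite uE; nra.
Qed.

Lemma gam_ge0 n : 0 <= gam n. Proof. by case: (gam_bound n). Qed.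

Lemma gam_le1 n : gam n <= 1.
Proof.
elim: n => [|n IH] /=; first exact: ler01.
have := gam_ge0 n; nra.
Qed.

Lemma gam_leS n : gam n <= gam n.+1.
Proof. by have := sqr_ge0 (1 - gam n); rewrite /=; nra. Qed.


Lemma gam_le m n : (m <= n)%N -> gam m <= gam n.
Proof.
elim: n => [|n IH]; first by rewrite leqn0 => /eqP ->.
rewrite leq_eqVlt => /orP[/eqP -> //|mn].
by rewrite (le_trans (IH mn)) // gam_leS.
Qed.

Lemma gam_cvg (e : R) : 0 < e -> exists n, 1 - gam n < e.
Proof.
move=> e0; exists (Num.truncn (2 / e)); case: (gam_bound (Num.truncn (2 / e))).
move=> _ /le_lt_trans; apply.
rewrite ltr_pdivrMr ?ltr0n // mulrC -ltr_pdivrMr //.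
by rewrite (lt_trans (truncnS_gt _)) // ltr_nat.
Qed.

Lemma gam_limit (x C : R) : (forall n, x <= (1 - gam n) * C) -> x <= 0.
Proof.
move=> H; apply: (@eq0_le_eps _ _ `|C|) => e /gam_cvg[n ne].
apply: le_trans (H n) _.
have g0 : 0 <= 1 - gam n by rewrite subr_ge0 gam_le1.
rewrite (le_trans (ler_wpM2l g0 (ler_norm C))) // ler_wpM2r //.
exact: ltW.
Qed.

End SelfAdjointMaps.

Section SqrtApproxIntertwine.
Variables (R : realType) (A A' : cstarAlgType R).

(** The approximants are polynomials in [X]. With [F] a multiplier this gives commutation, with [F]
    a morphism it gives naturality of square roots. *)
Lemma sqrt_approx_intertwine (X : A -> A) (X' : A' -> A') (F : A -> A') :
  linear F -> (forall a, F (X a) = X' (F a)) ->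
  forall n a, F (sqrt_approx X n a) = sqrt_approx X' n (F a).
Proof.
move=> Fl FX; elim=> [|n IH] a /=; first exact: lf0.
by rewrite (lfZ Fl) (lfD Fl) FX !IH.
Qed.

End SqrtApproxIntertwine.

Section SqrtApprox.
Variables (R : realType) (A : cstarAlgType R) (X : A -> A).
Hypotheses (sX : sa X) (bX : bd 1 X).

Lemma sqrt_approx_sa n : sa (sqrt_approx X n).
Proof.
elim: n => [|n IH] /=; first by move=> a b; rewrite star0 cmul0l cmul0r.
exact: (saZ _ (saD sX (sa_sq IH))).
Qed.

Lemma sqrt_approx_linear n : linear (sqrt_approx X n).
Proof. exact/sa_linear/sqrt_approx_sa. Qed.

Lemma sqrt_approxC m n a :
  sqrt_approx X m (sqrt_approx X n a) = sqrt_approx X n (sqrt_approx X m a).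
Proof.
apply: (sqrt_approx_intertwine (F := sqrt_approx X m)).
  exact: sqrt_approx_linear.
move=> {}a; apply/esym/(sqrt_approx_intertwine (F := X)) => //.
exact: sa_linear.
Qed.

(** As a polynomial in the contraction [X], the approximant has nonnegative coefficients; its value
    at [1] therefore bounds it. *)
Lemma sqrt_approx_bd n : bd (gam R n) (sqrt_approx X n).
Proof.
elim: n => [|n IH] /=; first by move=> a; rewrite nrm0 mul0r.
rewrite mulrC; apply: bdZ; first by rewrite invr_ge0.
apply: bdD => //; rewrite expr2; apply: bd_comp => //; exact: gam_ge0.
Qed.

(** The approximants commute, so the increment factors as [(G_(n+1) - G_n) (G_(n+1) + G_n) / 2]. The
    numbers [gam] satisfy the same identity, and the resulting bounds telescope. *)
Lemma sqrt_approx_step n :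
  bd (gam R n.+1 - gam R n) (fun a => sqrt_approx X n.+1 a - sqrt_approx X n a).
Proof.
elim: n => [|n IH].
  by move=> a /=; have := sqrt_approx_bd 1 a; rewrite /= !subr0.
set G := sqrt_approx X; move=> a.
have -> : G n.+2 a - G n.+1 a =
    (2^-1)%:C *: ((fun b => G n.+1 b - G n b) (G n.+1 a + G n a)).
  have GS m b : G m.+1 b = (2^-1)%:C *: (X b + G m (G m b)) by [].
  have Glin m : linear (G m) by exact: sqrt_approx_linear.
  rewrite (GS n.+1) [X in _ - X](GS n) -scalerBr; congr (_ *: _).
  rewrite !(lfD (Glin _)) opprD addrACA subrr add0r.
  have -> : G n.+1 (G n a) = G n (G n.+1 a) by exact: sqrt_approxC.
  by rewrite opprD addrA addrK.
have b1 := IH (G n.+1 a + G n a).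
have b2 := bdD (sqrt_approx_bd n.+1) (sqrt_approx_bd n) a.
rewrite nrmZr ?invr_ge0 //.
have d0 : 0 <= gam R n.+1 - gam R n by rewrite subr_ge0 gam_leS.
have := le_trans b1 (ler_wpM2l d0 b2); rewrite /= -/G.
set x := nrm _; set y := nrm a; move: d0 (gam_ge0 R n) => /=.
set g := gam R n => d0 g0 h.
by rewrite mulrC ler_pdivrMr //; apply: le_trans h _; lra.
Qed.

Lemma sqrt_approx_dist m n a : (n <= m)%N ->
  nrm (sqrt_approx X m a - sqrt_approx X n a) <= (gam R m - gam R n) * nrm a.
Proof.
elim: m => [|m IH]; first by rewrite leqn0 => /eqP ->; rewrite !subrr nrm0 mul0r.
rewrite leq_eqVlt => /orP[/eqP ->|nm]; first by rewrite !subrr nrm0 mul0r.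
rewrite -(subrK (sqrt_approx X m a) (sqrt_approx X m.+1 a)) -addrA.
apply: le_trans (nrmD _ _) _.
apply: le_trans (lerD (sqrt_approx_step m a) (IH nm)) _.
by rewrite -mulrDl addrA subrK.
Qed.

(** The limit is selected by its distance to each approximant, which is all that is used about it.
    The default [0] is not reached when [X] is a self-adjoint contraction. *)
Definition one_sub_sqrt (a : A) : A :=
  xget 0 [set l | forall n,
    nrm (l - sqrt_approx X n a) <= (1 - gam R n) * nrm a].

Local Notation G := one_sub_sqrt.

Lemma one_sub_sqrt_approx n a :
  nrm (G a - sqrt_approx X n a) <= (1 - gam R n) * nrm a.
Proof.
move: n; rewrite /one_sub_sqrt; case: xgetP => // H.
have Cau e : 0 < e -> exists N, forall m n, (N <= m)%N -> (N <= n)%N ->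
    nrm (sqrt_approx X m a - sqrt_approx X n a) < e.
  move=> e0; have e1 : 0 < e / (nrm a + 1).
    by rewrite divr_gt0 // ltr_wpDl // nrm_ge0.
  have [N HN] := gam_cvg e1; exists N => m n.
  wlog nm : m n / (n <= m)%N.
    move=> W; case: (leqP n m) => [nm|/ltnW mn] Nm Nn; first exact: W.
    by rewrite nrm_dist; exact: W.
  move=> _ Nn; apply: le_lt_trans (sqrt_approx_dist _ nm) _.
  have a0 := nrm_ge0 a.
  have d1 : gam R m - gam R n <= 1 - gam R N.
    by rewrite lerD ?gam_le1 // lerN2 gam_le.
  rewrite (le_lt_trans (ler_wpM2r a0 d1)) //.
  rewrite (le_lt_trans (ler_wpM2l _ (_ : nrm a <= nrm a + 1))) ?lerDl //.
    by rewrite subr_ge0 gam_le1.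
  by rewrite -ltr_pdivlMr // ltr_wpDl.
have [l Hl] := nrm_complete Cau.
case: (H l) => n; rewrite -subr_le0; apply: (@eq0_le_eps _ _ 1) => e e0.
have [N HN] := Hl _ e0; rewrite mulr1 lerBlDl.
have := HN (maxn N n) (leq_maxl _ _).
have := sqrt_approx_dist a (leq_maxr N n).
set u := sqrt_approx X (maxn N n) a => h1 h2.
rewrite -(subrK u l) -addrA.
apply: le_trans (nrmD _ _) _; rewrite [leRHS]addrC.
apply: lerD; first by rewrite nrm_dist ltW.
apply: (le_trans h1); apply: ler_wpM2r (nrm_ge0 _) _ _ _.
by rewrite lerD // gam_le1.
Qed.

Lemma one_sub_sqrt_bd : bd 1 G.
Proof.
move=> a; rewrite -subr_le0; apply: (@gam_limit _ _ (nrm a)) => n.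
have h1 := one_sub_sqrt_approx n a.
have h2 := sqrt_approx_bd n a; have g1 := gam_le1 R n.
have := nrmD (G a - sqrt_approx X n a) (sqrt_approx X n a).
rewrite subrK mul1r; have := nrm_ge0 a; nra.
Qed.

Lemma one_sub_sqrt_sa : sa G.
Proof.
move=> a b; apply/eqP; rewrite -subr_eq0; apply/eqP/nrm_eq0/eqP.
rewrite eq_le nrm_ge0 andbT; apply: (@gam_limit _ _ (2 * nrm a * nrm b)) => n.
have -> : star (G a) ** b - star a ** G b =
    star (G a - sqrt_approx X n a) ** b - star a ** (G b - sqrt_approx X n b).
  by rewrite starB cmulBl cmulBr sqrt_approx_sa opprB addrA subrK.
apply: le_trans (nrmB _ _) _; apply: le_trans (lerD (nrmM _ _) (nrmM _ _)) _.
rewrite !nrm_star.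
have h1 := ler_wpM2r (nrm_ge0 b) (one_sub_sqrt_approx n a).
have h2 := ler_wpM2l (nrm_ge0 a) (one_sub_sqrt_approx n b).
lra.
Qed.

End SqrtApprox.

Section SqrtIntertwine.
Variables (R : realType) (A A' : cstarAlgType R).

Lemma one_sub_sqrt_intertwine (X : A -> A) (X' : A' -> A') (F : A -> A') C :
  sa X -> bd 1 X -> sa X' -> bd 1 X' -> 
  linear F -> (forall a, nrm (F a) <= C * nrm a) ->
  (forall a, F (X a) = X' (F a)) ->
  forall a, F (one_sub_sqrt X a) = one_sub_sqrt X' (F a).
Proof.
move=> sX bX sX' bX' Fl FC FX a.
apply/eqP; rewrite -subr_eq0; apply/eqP/nrm_eq0/eqP.
rewrite eq_le nrm_ge0 andbT.
apply: (@gam_limit _ _ (`|C| * nrm a + nrm (F a))) => n.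
rewrite -(subrK (F (sqrt_approx X n a)) (F _)) -(lfB Fl) -addrA.
apply: le_trans (nrmD _ _) _; rewrite mulrDr lerD //.
  apply: le_trans (FC _) _.
  apply: (le_trans (ler_wpM2r (nrm_ge0 _) (ler_norm C))).
  by rewrite mulrCA ler_wpM2l // one_sub_sqrt_approx.
rewrite (sqrt_approx_intertwine Fl FX) nrm_dist.
exact: one_sub_sqrt_approx.
Qed.

End SqrtIntertwine.

Section SqrtEquation.
Variables (R : realType) (A : cstarAlgType R) (X : A -> A).
Hypotheses (sX : sa X) (bX : bd 1 X).
Local Notation G := (one_sub_sqrt X).

Lemma one_sub_sqrt_comm (T : A -> A) C : linear T -> bd C T ->
  (forall a, T (X a) = X (T a)) -> forall a, T (G a) = G (T a).
Proof. by move=> *; apply: (one_sub_sqrt_intertwine (C := C)). Qed.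

(** The limit of [2 g_(n+1) = X + g_n^2]. It says that [1 - G] squares to [1 - X]. *)
Lemma one_sub_sqrt_eq a : G a + G a = X a + G (G a).
Proof.
apply/eqP; rewrite -subr_eq0; apply/eqP/nrm_eq0/eqP.
(* The factor 4 counts [G - g_(n+1)] twice, [G - g_n] at [G a], and [G - g_n] under [g_n]; each is
   at most [(1 - gam n) * nrm a]. *)
rewrite eq_le nrm_ge0 andbT; apply: (@gam_limit _ _ (4 * nrm a)) => n.
pose g := sqrt_approx X.
have eg : g n.+1 a + g n.+1 a = X a + g n (g n a).
  rewrite /g /= -scalerDl -rmorphD /=.
  by rewrite (_ : 2^-1 + 2^-1 = 1 :> R) ?scale1r //; field.
have -> : G a + G a - (X a + G (G a)) =
    (G a - g n.+1 a) + (G a - g n.+1 a) -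
    ((G (G a) - g n (G a)) + g n (G a - g n a)).
  have gL : linear (g n) by exact: sqrt_approx_linear.
  rewrite (lfB gL) [X in _ = _ - X]addrA subrK.
  rewrite [X in _ = X - _]addrACA -opprD eg -[RHS]addrA; congr (_ + _).
  by rewrite -opprD; congr (- _); rewrite -addrA [_ + (_ - _)]addrC subrK.
have h1 := one_sub_sqrt_approx sX bX n.+1 a.
have h2 := one_sub_sqrt_approx sX bX n (G a).
have h3 := sqrt_approx_bd bX n (G a - g n a).
have h4 := one_sub_sqrt_approx sX bX n a.
have h5 := one_sub_sqrt_bd sX bX a.
have g1 := gam_le1 R n; have g0 := gam_ge0 R n; have gS := gam_leS R n.
have a0 := nrm_ge0 a.
apply: le_trans (nrmB _ _) _.
apply: le_trans (lerD (nrmD _ _) (nrmD _ _)) _.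
have : (1 - gam R n.+1) * nrm a <= (1 - gam R n) * nrm a.
  by rewrite ler_wpM2r // lerD2l lerN2.
have : (1 - gam R n) * nrm (G a) <= (1 - gam R n) * nrm a.
  by rewrite ler_wpM2l ?subr_ge0 // -[leRHS]mul1r.
have : gam R n * nrm (G a - g n a) <= 1 * nrm (G a - g n a).
  by rewrite ler_wpM2r // nrm_ge0.
move: h1 h2 h3 h4; rewrite -/g; lra.
Qed.

End SqrtEquation.

Definition star_morphism (R : realType) (A A' : cstarAlgType R)
    (f : A -> A') : Prop :=
  [/\ linear f, forall a b, f (a ** b) = f a ** f b &
      forall a, f (star a) = star (f a)].

Lemma star_morphism_id (R : realType) (A : cstarAlgType R) :
  star_morphism (@id A).
Proof. by split. Qed.

Section UnitaryTrick.
Variables (R : realType) (A A' : cstarAlgType R) (f : A -> A').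
Hypothesis fM : star_morphism f.
Variables (x y : A -> A) (e : R).
Hypotheses (sx : sa x) (sy : sa y) (xy : forall a, x (y a) = y (x a)).
Hypothesis e0 : 0 <= e.
Hypothesis xxyy : forall a, x (x a) + y (y a) = (e ^+ 2)%:C *: a.

(* [x + iy] and [x - iy] are [e] times a unitary. *)
Lemma unitary_bound a : nrm (f (x a)) <= e * nrm (f a).
Proof.
have [fL fMM fS] := fM.
(* [s] stands for [i] and for [-i]. Self-adjointness and commutation cancel the cross terms in the
   product with the adjoint. The bound is proved under [f] because [f] is not extended to
   multipliers. *)
have key (s : R[i]) : (forall b : A, star (s *: b) = - (s *: star b)) ->
    s * s = -1 -> nrm (f (x a + s *: y a)) = e * nrm (f a).
  move=> sS ss; apply/eqP.
  rewrite -(eqrXn2 (n := 2)) ?mulr_ge0 ?nrm_ge0 // exprMn -!nrm_cstar.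
  rewrite -!fS -!fMM -nrmZr ?sqr_ge0 // -(lfZ fL); apply/eqP; congr (nrm (f _)).
  rewrite starD sS cmulDr !cmulDl !cmulNl !cmulZr !cmulZl scalerA ss.
  rewrite scaleN1r opprK !sx !sy xy -[RHS]cmulZr -xxyy cmulDr.
  abel.
have k1 : nrm (f (x a + 'i%C *: y a)) = e * nrm (f a).
  by apply: key; [exact: star_i | rewrite -expr2 sqr_i].
have k2 : nrm (f (x a + - 'i%C *: y a)) = e * nrm (f a).
  apply: key; last by rewrite mulrNN -expr2 sqr_i.
  by move=> b; rewrite !scaleNr starN star_i.
have := nrmD (f (x a + 'i%C *: y a)) (f (x a + - 'i%C *: y a)).
rewrite k1 k2 -(lfD fL) addrACA scaleNr subrr addr0.
have -> : x a + x a = (2 : R)%:C *: x a.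
  by rewrite -mulr2n -scaler_nat; congr (_ *: _); rewrite rmorph_nat.
by rewrite (lfZ fL) nrmZr //; lra.
Qed.

End UnitaryTrick.

Section OperatorSqrt.
Variables (R : realType) (A : cstarAlgType R).

(** [D = sqrt (1 - T^2)] commutes with [T] and [D^2 + T^2 = 1], so [D] is a contraction by the
    unitary bound, and then so is [1 - T^2 = D^2]. This is what makes squares positive in the sense
    of [pos]. *)
Lemma bd_one_sub_sq (T : A -> A) : sa T -> bd 1 T ->
  bd 1 (fun a => a - one_sub_sqrt (T \o T) a) /\
  bd 1 (fun a => a - T (T a)).
Proof.
move=> sT bT; pose G := one_sub_sqrt (T \o T); pose D a := a - G a.
have sTT := sa_sq sT; have bTT := bd_sq bT.
have sD : sa D by apply: saB => //; exact: one_sub_sqrt_sa.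
have GL : linear G by exact/sa_linear/one_sub_sqrt_sa.
have bD : bd 1 D.
  move=> a; apply: (unitary_bound (star_morphism_id A) sD sT) => [b||b].
  - rewrite /D (lfB (sa_linear sT)); congr (_ - _); apply/esym.
    by apply: (@one_sub_sqrt_comm _ _ _ sTT bTT T 1) => //; exact: sa_linear.
  - exact: ler01.
  rewrite expr1n scale1r /D (lfB GL) opprB addrA.
  apply: (@eq_trans _ _ (b - (G b + G b) + G (G b) + T (T b))); first abel.
  rewrite (one_sub_sqrt_eq sTT bTT) /= -/G; abel.
split=> // a.
have -> : a - T (T a) = D (D a).
  rewrite /D (lfB GL) opprB.
  apply: (@eq_trans _ _ (a - (G a + G a) + G (G a))); last abel.
  rewrite (one_sub_sqrt_eq sTT bTT) /= -/G; abel.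
exact: (bd_sq bD).
Qed.

Definition op_sqrt (T : A -> A) (a : A) : A :=
  a - one_sub_sqrt (fun b => b - T b) a.

(* [0 <= T <= 2] *)
Definition pos (T : A -> A) := sa T /\ bd 1 (fun a => a - T a).

Lemma sa_one_sub (T : A -> A) : sa T -> sa (fun a => a - T a).
Proof. by move=> sT; exact: (saB (@sa_id _ _) sT). Qed.

Section OpSqrtTheory.
Variable T : A -> A.
Hypothesis pT : pos T.
Let sT : sa T := pT.1.
Let sX : sa (fun a => a - T a) := sa_one_sub sT.
Let bX : bd 1 (fun a => a - T a) := pT.2.

Lemma op_sqrt_sa : sa (op_sqrt T).
Proof. by apply: sa_one_sub; exact: one_sub_sqrt_sa. Qed.

Lemma op_sqrt_pos : pos (op_sqrt T).
Proof.
split; first exact: op_sqrt_sa.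
by move=> a; rewrite /op_sqrt opprB addrC subrK; exact: one_sub_sqrt_bd.
Qed.

Lemma op_sqrtK a : op_sqrt T (op_sqrt T a) = T a.
Proof.
rewrite /op_sqrt; set G := one_sub_sqrt _.
have GL : linear G by exact/sa_linear/one_sub_sqrt_sa.
rewrite (lfB GL).
apply: (@eq_trans _ _ (a - (G a + G a) + G (G a))); first abel.
rewrite (one_sub_sqrt_eq sX bX) /= -/G; abel.
Qed.

End OpSqrtTheory.

End OperatorSqrt.

Lemma op_sqrt_intertwine (R : realType) (A A' : cstarAlgType R)
    (T : A -> A) (T' : A' -> A') (F : A -> A') C :
  pos T -> pos T' -> linear F -> (forall a, nrm (F a) <= C * nrm a) ->
  (forall a, F (T a) = T' (F a)) ->
  forall a, F (op_sqrt T a) = op_sqrt T' (F a).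
Proof.
move=> [sT bT] [sT' bT'] Fl FC FT a; rewrite /op_sqrt (lfB Fl).
congr (_ - _); apply: (one_sub_sqrt_intertwine (C := C)) => //.
- exact: sa_one_sub.
- exact: sa_one_sub.
by move=> b; rewrite (lfB Fl) FT.
Qed.

Section OperatorSqrtUnique.
Variables (R : realType) (A : cstarAlgType R).

Lemma pos_bd (T : A -> A) : pos T -> bd 2 T.
Proof.
move=> [_ bT] a; have -> : T a = a - (a - T a) by abel.
apply: le_trans (nrmB _ _) _; have := bT a; rewrite mul1r; lra.
Qed.

(** Uniqueness of the positive root. For [P = sqrt (T^2)] and [D = P - T], commutation gives
    [(P + T) D = 0]. With [q], [r] the roots of [P], [T], the squares of [q D] and [r D] add up to
    [(P + T) D^2 = 0], and the unitary bound with [e = 0] yields [q D = 0]. Hence [P D = T D = 0],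
    so [D^2 = 0] and [D = 0]. *)
Lemma op_sqrt_sq (T : A -> A) : sa T -> bd 1 T -> pos (T \o T) ->
  pos T -> forall a, op_sqrt (T \o T) a = T a.
Proof.
move=> sT bT pTT pT.
have TL := sa_linear sT.
pose P := op_sqrt (T \o T); have pP : pos P by exact: op_sqrt_pos.
have sP := pP.1; have PL := sa_linear sP.
have TP a : T (P a) = P (T a).
  by apply: (op_sqrt_intertwine (C := 1)) => //.
pose D a := P a - T a; have sD : sa D by exact: saB.
have DL := sa_linear sD.
pose q := op_sqrt P; pose r := op_sqrt T.
have sq_ : sa q by exact: op_sqrt_sa.
have sr : sa r by exact: op_sqrt_sa.
have qL := sa_linear sq_; have rL := sa_linear sr.
have bD : bd (2 + 2) D by apply: bdB; exact: pos_bd.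
have bP := pos_bd pP.
have b2T : bd 2 T by exact: pos_bd.
have DP a : D (P a) = P (D a).
  by rewrite [RHS](lfB PL (P a) (T a)) -TP.
have DT a : D (T a) = T (D a).
  by rewrite [RHS](lfB TL (P a) (T a)) TP.
have Dq a : D (q a) = q (D a) by apply: (op_sqrt_intertwine (C := 2 + 2)).
have Dr a : D (r a) = r (D a) by apply: (op_sqrt_intertwine (C := 2 + 2)).
have Tq a : T (q a) = q (T a) by apply: (op_sqrt_intertwine (C := 2)).
have bq : bd 2 q by apply: pos_bd; exact: op_sqrt_pos.
have qr a : q (r a) = r (q a).
  by apply: (op_sqrt_intertwine (C := 2)) => // b; rewrite Tq.
have sqD : sa (q \o D) by apply: sa_comp => // a; rewrite Dq.
have srD : sa (r \o D) by apply: sa_comp => // a; rewrite Dr.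
have sum a : P (D a) + T (D a) = 0.
  rewrite [X in X + _](lfB PL (P a) (T a)) [X in _ + X](lfB TL (P a) (T a)).
  rewrite TP [P (P a)](op_sqrtK pTT) /=; abel.
have qrD a : (q \o D) ((r \o D) a) = (r \o D) ((q \o D) a).
  by rewrite /= !Dr !Dq qr.
have z a : nrm (q (D a)) <= 0.
  have := unitary_bound (star_morphism_id A) sqD srD qrD (lexx 0) _ a.
  rewrite mul0r; apply=> b; rewrite expr0n scale0r /= Dq Dr.
  rewrite [q (q _)](op_sqrtK pP) [r (r _)](op_sqrtK pT) -DP -DT -(lfD DL).
  by rewrite sum (lf0 DL).
have qD0 a : q (D a) = 0.
  by apply: nrm_eq0; apply/eqP; rewrite eq_le nrm_ge0 z.
have PD0 a : P (D a) = 0.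
  by rewrite -[LHS](op_sqrtK pP) -/q qD0 (lf0 qL).
have TD0 a : T (D a) = 0 by have := sum a; rewrite PD0 add0r.
move=> a; apply/eqP; rewrite -subr_eq0 -/P -/(D a); apply/eqP/nrm_eq0/eqP.
have DD : D (D a) = 0 by rewrite -[LHS]/(P (D a) - T (D a)) PD0 TD0 subrr.
by rewrite -sqrf_eq0 -nrm_cstar sD DD cmul0r nrm0.
Qed.

End OperatorSqrtUnique.

(** * Injective *-morphisms are isometric *)

Section StarMorphisms.
Variables (R : realType).

Lemma pos_comp_self (A : cstarAlgType R) (T : A -> A) :
  sa T -> bd 1 T -> pos (T \o T).
Proof.
by move=> sT bT; split; [exact: sa_sq | have [] := bd_one_sub_sq sT bT].
Qed.

Lemma pos_one_sub_sq (A : cstarAlgType R) (T : A -> A) :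
  sa T -> bd 1 T -> pos (fun a => a - T (T a)).
Proof.
move=> sT bT; split; first exact: (sa_one_sub (sa_sq sT)).
by move=> a; rewrite opprB addrC subrK; exact: (bd_sq bT).
Qed.

Lemma nrm_unit (A : cstarAlgType R) (a : A) :
  a != 0 -> nrm ((nrm a)^-1%:C *: a) = 1.
Proof.
by move=> a0; rewrite nrmZr ?invr_ge0 ?nrm_ge0 // mulVf // gt_eqF // nrm_gt0.
Qed.

Variables (A B : cstarAlgType R) (f : B -> A).
Hypothesis fM : star_morphism f.
Let fL : linear f. Proof. by case: fM. Qed.
Let fMM a b : f (a ** b) = f a ** f b. Proof. by case: fM. Qed.
Let fS a : f (star a) = star (f a). Proof. by case: fM. Qed.

(** For [|a| = 1] and [h = star a ** a], the multipliers [h] and [sqrt (1 - h^2)] form a unitary.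
    Evaluating the bound under [f] at [h] itself gives [|f h|^2 <= |f h|], hence
    [|f a|^2 = |f h| <= 1]. *)
Lemma star_morphism_le b : nrm (f b) <= nrm b.
Proof.
have [->|b0] := eqVneq b 0; first by rewrite (lf0 fL) !nrm0.
suff H : nrm (f ((nrm b)^-1%:C *: b)) <= 1.
  move: H; rewrite (lfZ fL) nrmZr ?invr_ge0 ?nrm_ge0 //.
  by rewrite mulrC ler_pdivrMr ?nrm_gt0 // mul1r.
move: (nrm_unit b0); set a := _ *: b => a1.
pose h := star a ** a.
have h1 : nrm h = 1 by rewrite nrm_cstar a1 expr1n.
have hS : star h = h by rewrite starM starK.
have sh : sa (cmul h) by exact: sa_mul.
have bh : bd 1 (cmul h) by rewrite -h1; exact: bd_mul.
have p := pos_one_sub_sq sh bh.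
have := unitary_bound fM sh (op_sqrt_sa p) _ (@ler01 _) _ h.
have fh : nrm (f (h ** h)) = nrm (f h) ^+ 2.
  by rewrite fMM -{1}hS fS nrm_cstar.
have fa : nrm (f h) = nrm (f a) ^+ 2 by rewrite fMM fS nrm_cstar.
rewrite fh mul1r => H.
have {H} : nrm (f h) ^+ 2 <= nrm (f h).
  apply: H => b'.
    apply: (op_sqrt_intertwine (C := nrm h)) => //.
    - exact: cmul_linearr.
    - exact: bd_mul.
    by move=> c; rewrite cmulBr.
  by rewrite (op_sqrtK p) expr1n scale1r; abel.
move=> H; have h0 := nrm_ge0 (f h).
have {H} : nrm (f h) <= 1 by nra.
by rewrite fa expr_le1 // nrm_ge0.
Qed.

Hypothesis f_inj : forall b, f b = 0 -> b = 0.

(** If [|f b| < |b|], scale to [a], put [h = star a ** a] and [e = |f h| < |h|]. In the target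
    [e^2 - (f h)^2] is positive; injectivity pulls this back to positivity of [e^2 - h^2], and with
    its root [q] the relation [h^2 + q^2 = e^2] forces [|h| <= e]. *)
Lemma star_morphism_isometry b : nrm (f b) = nrm b.
Proof.
apply/eqP; rewrite eq_le star_morphism_le /= leNgt; apply/negP => fb.
have b0 : b != 0 by apply: contraTneq fb => ->; rewrite (lf0 fL) !nrm0 ltxx.
(* With norm [1/2], both [|h|^2] and [e^2] are at most [1/16], so that [y] and [z] below are
   contractions. *)
pose a := (2 * nrm b)^-1%:C *: b.
have r0 : 0 <= (2 * nrm b)^-1 by rewrite invr_ge0 mulr_ge0 ?nrm_ge0.
have na : nrm a = 2^-1.
  by rewrite nrmZr // invfM -mulrA mulVf ?mulr1 // gt_eqF // nrm_gt0.
have fa : nrm (f a) < 2^-1.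
  rewrite -na (lfZ fL) !nrmZr // ltr_pM2l // invr_gt0.
  by rewrite mulr_gt0 // nrm_gt0.
pose h := star a ** a; pose e := nrm (f h).
have hS : star h = h by rewrite starM starK.
have h1 : nrm h = 4^-1 by rewrite nrm_cstar na; field.
have fe : e = nrm (f a) ^+ 2 by rewrite /e fMM fS nrm_cstar.
have e0 : 0 <= e by exact: nrm_ge0.
have e4 : e < 4^-1.
  rewrite fe (_ : 4^-1 = 2^-1 ^+ 2 :> R); last by field.
  by rewrite ltrXn2r // nrm_ge0.
have bhh (C : cstarAlgType R) (k : C) : bd (nrm k ^+ 2) (cmul k \o cmul k).
  by rewrite expr2; apply: bd_comp; [exact: nrm_ge0| |]; exact: bd_mul.
pose y (c : B) := h ** (h ** c) - (e ^+ 2)%:C *: c.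
have sy : sa y.
  apply: saB; last exact: (saZ _ (@sa_id _ _)).
  exact: (sa_sq (sa_mul hS)).
have be (C : cstarAlgType R) : bd (e ^+ 2) (fun c : C => (e ^+ 2)%:C *: c).
  by move=> c; rewrite nrmZr // sqr_ge0.
have by1 : bd 1 y.
  apply: (@bdW _ _ (nrm h ^+ 2 + e ^+ 2)); last by apply: bdB.
  by rewrite h1; nra.
have yL := sa_linear sy.
pose x := f h; have xS : star x = x by rewrite -fS hS.
pose z (c : A) := (e ^+ 2)%:C *: c - x ** (x ** c).
have sz : sa z.
  apply: saB; first exact: (saZ _ (@sa_id _ _)).
  exact: (sa_sq (sa_mul xS)).
have bz : bd 1 z.
  apply: (@bdW _ _ (e ^+ 2 + nrm x ^+ 2)); last by apply: bdB.
  by rewrite -/e; nra.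
have zL := sa_linear sz.
have pz : pos z.
  split=> // c.
  have -> : c - z c = x ** (x ** c) + (1 - e ^+ 2)%:C *: c.
    by rewrite rmorphB /= scalerBl scale1r /z; abel.
  have e1 : 0 <= 1 - e ^+ 2 by nra.
  have := bdD (bhh _ x) (bdZ e1 (@bd_id _ _)) c.
  by rewrite [X in X * _](_ : _ = 1) // -/e; ring.
have pyy := pos_comp_self sy by1.
have pzz := pos_comp_self sz bz.
have fy c : f (y c) = - z (f c).
  have fh d : f (h ** d) = x ** f d by exact: fMM.
  by rewrite /y /z (lfB fL) (lfZ fL) !fh opprB.
(* [f] carries [y^2] to [z^2], hence the root of the first to the root of the second, which is [z]
   as [z] is positive. So [f (T c) = z (f c) = - f (y c)]. *)
pose T := op_sqrt (y \o y).
have T_eq c : T c = - y c.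
  apply/eqP; rewrite -subr_eq0; apply/eqP/f_inj.
  rewrite (lfB fL) (lfN fL) fy opprK /T.
  rewrite (op_sqrt_intertwine (C := 1) pyy pzz fL).
  - by rewrite (op_sqrt_sq sz bz pzz pz) subrr.
  - by move=> d; rewrite mul1r star_morphism_le.
  by move=> d; rewrite /= !fy (lfN zL) opprK.
have pT : pos T by exact: op_sqrt_pos.
pose q := op_sqrt T.
have sq_ : sa q by exact: op_sqrt_sa.
have hq c : h ** q c = q (h ** c).
  apply: (op_sqrt_intertwine (C := nrm h)) => //.
  - exact: cmul_linearr.
  - exact: bd_mul.
  move=> d; rewrite !T_eq cmulNr /y cmulBr cmulZr //.
have hqq c : h ** (h ** c) + q (q c) = (e ^+ 2)%:C *: c.
  by rewrite [q (q c)](op_sqrtK pT) T_eq /y; abel.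
have := unitary_bound (star_morphism_id B) (sa_mul hS) sq_ hq e0 hqq h.
rewrite -{1}hS nrm_cstar h1; nra.
Qed.

End StarMorphisms.

(** * Positivity of a^* a *)

Section Positivity.
Variables (R : realType) (A : cstarAlgType R).

Lemma nrm_op_sqrt_sq (T : A -> A) : sa T -> bd 1 T ->
  forall a, nrm (op_sqrt (T \o T) a) = nrm (T a).
Proof.
move=> sT bT a; have p := pos_comp_self sT bT; apply/eqP.
rewrite -(eqrXn2 (n := 2)) ?nrm_ge0 // -!nrm_cstar (op_sqrt_sa p) (op_sqrtK p).
by rewrite sT.
Qed.

(** Subtracting from the identity leaves the mean of five maps [1 - x^2], each a contraction. The
    shape [2 x^2 + 2 y^2 + z^2] is that of [c c^*] in the next proof. *)
Lemma sum5_pos (x y z : A -> A) : sa x -> bd 1 x -> sa y -> bd 1 y ->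
  sa z -> bd 1 z ->
  bd 1 (fun a => a - (5^-1)%:C *:
    (x (x a) + x (x a) + (y (y a) + y (y a)) + z (z a))).
Proof.
move=> sx bx sy by_ sz bz a.
have [_ hx] := bd_one_sub_sq sx bx.
have [_ hy] := bd_one_sub_sq sy by_.
have [_ hz] := bd_one_sub_sq sz bz.
have -> : a - (5^-1)%:C *:
    (x (x a) + x (x a) + (y (y a) + y (y a)) + z (z a)) =
  (5^-1)%:C *: ((a - x (x a)) + (a - x (x a)) +
    ((a - y (y a)) + (a - y (y a))) + (a - z (z a))).
  have {1}-> : a = (5^-1)%:C *: (a + a + (a + a) + a).
    have -> : a + a + (a + a) + a = 5%:R *: a.
      by rewrite (_ : 5%:R = 1 + 1 + (1 + 1) + 1 :> R[i]) ?scalerDl ?scale1r //;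
        ring.
    by rewrite scalerA rmorphV ?unitfE ?pnatr_eq0 //= rmorph_nat mulVf ?scale1r
       // pnatr_eq0.
  by rewrite -scalerBr; congr (_ *: _); abel.
rewrite nrmZr ?invr_ge0 //.
have := bdD (bdD (bdD hx hx) (bdD hy hy)) hz a; lra.
Qed.

(* The theorem of Fukamiya and Kaplansky: [0 <= a^* a].  With [m] the negative
   part of [h = a^* a] and [c = a m], [c^* c = - m^3] is negative while [c c^*]
   is positive; as [|c c^*| c = c |c^* c|], this forces [c = 0]. *)
Lemma starM_pos (a : A) : nrm a <= 1 -> pos (cmul (star a ** a)).
Proof.
move=> a1; pose h := star a ** a.
have hS : star h = h by rewrite starM starK.
have h1 : nrm h <= 1 by rewrite nrm_cstar expr_le1 // nrm_ge0.
pose T := cmul h; have sT : sa T by exact: sa_mul.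
have TL : linear T by exact: sa_linear.
have bT : bd 1 T by apply: (bdW h1); exact: bd_mul.
have pTT := pos_comp_self sT bT.
(* [P] is the absolute value of [h]. It is kept abstract, with its square, its norm and its
   commutation with whatever commutes with [T]. *)
have [P [pP PP nP PC]] : exists P : A -> A, [/\ pos P,
    forall b, P (P b) = T (T b), forall b, nrm (P b) = nrm (T b) &
    forall F C, linear F -> bd C F -> (forall b, F (T b) = T (F b)) ->
      forall b, F (P b) = P (F b)].
  exists (op_sqrt (T \o T)); split; first exact: op_sqrt_pos.
  - exact: op_sqrtK.
  - exact: nrm_op_sqrt_sq.
  move=> F C FL bF FT; apply: (op_sqrt_intertwine (C := C)) => //.
  by move=> b; rewrite /= !FT.
have sP := pP.1; have PL := sa_linear sP.
have bP : bd 1 P by move=> b; rewrite nP.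
have TP b : T (P b) = P (T b) by apply: (PC T 1).
pose m b := (2^-1)%:C *: (P b - T b).
have sm : sa m by apply: saZ; exact: saB.
have mL := sa_linear sm.
have bm : bd 1 m.
  move=> b; rewrite nrmZr ?invr_ge0 //; have := bdB bP bT b; lra.
have Tm b : T (m b) = m (T b) by rewrite /m (lfZ TL) (lfB TL) TP.
have Pm b : P (m b) = m (P b) by rewrite /m (lfZ PL) (lfB PL) TP.
(* [(T + P) m] is half of [P^2 - T^2 = 0]. *)
have Tm_P b : T (m b) = - P (m b).
  rewrite -[LHS](addrK (P (m b))) -[RHS]add0r; congr (_ - _).
  rewrite [T _]Tm [P _]Pm -(lfD mL) /m (lfD PL) (lfD TL) TP PP.
  rewrite (_ : _ - _ = 0) ?scaler0 //; abel.
have [q [sq_ qq qC]] : exists q : A -> A, [/\ sa q, forall b, q (q b) = P b &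
    forall F C, linear F -> bd C F -> (forall b, F (P b) = P (F b)) ->
      forall b, F (q b) = q (F b)].
  exists (op_sqrt P); split; [exact: op_sqrt_sa | exact: op_sqrtK |].
  by move=> F C FL bF FP; apply: (op_sqrt_intertwine (C := C)).
have qL := sa_linear sq_.
have mq b : m (q b) = q (m b) by apply: (qC m 1).
pose w := q \o m.
have sw : sa w by apply: sa_comp => // b; rewrite mq.
have wL := sa_linear sw.
have ww b : w (w b) = m (P (m b)) by rewrite /w /= -mq qq.
have bw : bd 1 w.
  move=> b; rewrite mul1r -(@ler_pXn2r _ 2) ?nnegrE ?nrm_ge0 //.
  rewrite -nrm_cstar sw ww expr2; apply: le_trans (nrmM _ _) _.
  rewrite nrm_star ler_wpM2l ?nrm_ge0 // -[leRHS]mul1r.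
  exact: (bd1_comp bm (bd1_comp bP bm)).
(* The product [a m] of an element and a left multiplier, obtained through adjoints since [m] is
   self-adjoint. *)
pose c := star (m (star a)).
have cE d : c ** d = a ** m d by rewrite sm starK.
have cSE d : star c ** d = m (star a ** d) by rewrite starK (saM _ _ sm).
have cc d : star c ** (c ** d) = - w (w d).
  by rewrite cE cSE cmulA -/h -/(T _) Tm_P (lfN mL) ww.
have c1 : nrm c <= 1.
  by rewrite nrm_star (le_trans (bm _)) // nrm_star mul1r.
(* Real and imaginary parts of [c]: [2 x^2 + 2 y^2 = c c^* + c^* c]. As [c^* c = - w^2], this makes
   [c c^*] the sum of five squares. *)
pose x := (2^-1)%:C *: (c + star c).
pose y := (- 'i%C * (2^-1)%:C) *: (c - star c).
have xS : star x = x by rewrite starZr starD starK addrC.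
have yS : star y = y.
  rewrite /y -!scalerA !scaleNr starN star_i starZr starB starK.
  by rewrite opprK -scalerN -scalerN opprB.
have x1 : bd 1 (cmul x).
  apply: (bdW _ (@bd_mul _ _ x)); rewrite nrmZr ?invr_ge0 //.
  have := nrmD c (star c); rewrite nrm_star; lra.
have y1 : bd 1 (cmul y).
  apply: (bdW _ (@bd_mul _ _ y)); rewrite /y -scalerA nrmZ nrmZr ?invr_ge0 //.
  rewrite (_ : complex.Re _ = 1).
    have := nrmB c (star c); rewrite nrm_star; lra.
  by rewrite normrN /= expr0n /= expr1n add0r sqrtr1.
have sx : sa (cmul x) by exact: sa_mul.
have sy : sa (cmul y) by exact: sa_mul.
have xxyy d : x ** (x ** d) + x ** (x ** d) + (y ** (y ** d) + y ** (y ** d))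
     = c ** (star c ** d) + star c ** (c ** d).
  have e1 : 'i%C * 'i%C = -1 :> R[i] by rewrite -expr2 sqr_i.
  rewrite /x /y !cmulZl !cmulZr !scalerA mulrACA mulrNN e1.
  rewrite mulN1r scaleNr -!opprD -!scalerDr -scalerBr.
  apply: (@eq_trans _ _ (((2^-1)%:C * (2^-1)%:C) *: 
    ((c ** (star c ** d) + star c ** (c ** d)) *+ 4))).
    congr (_ *: _); rewrite !(cmulDl, cmulNl, cmulDr, cmulNr).
    rewrite -[4%N]/(1 + 1 + 1 + 1)%N !mulrnDr !mulr1n; abel.
  rewrite -[_ *+ 4]scaler_nat scalerA (_ : _ * _ = 1) ?scale1r //.
  rewrite -rmorphM /= -(rmorph_nat (real_complex R)) -rmorphM /=.
  by rewrite (_ : _ * _ = 1) //; field.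
pose t := ((5^-1 : R)%:C : R[i]).
pose K d := t *: (c ** (star c ** d)).
pose K' d := t *: w (w d).
have sK : sa K.
  by apply: saZ => b d; rewrite !starM starK -!cmulA.
have KE d : K d = t *: (x ** (x ** d) + x ** (x ** d) +
    (y ** (y ** d) + y ** (y ** d)) + w (w d)).
  by rewrite xxyy cc -addrA addNr addr0.
have b15 : 0 <= 5^-1 :> R by rewrite invr_ge0.
have bK : bd 1 K.
  move=> d; rewrite nrmZr //.
  have cS1 : nrm (star c) <= 1 by rewrite nrm_star.
  have := bd1_comp (bdW c1 (@bd_mul _ _ c)) (bdW cS1 (@bd_mul _ _ (star c))) d.
  by rewrite /=; have := nrm_ge0 d; lra.
have pK : pos K.
  split=> // d; rewrite KE; exact: (sum5_pos sx x1 sy y1 sw bw).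
have sK' : sa K' by apply: saZ; exact: sa_sq.
have bK' : bd 1 K'.
  move=> d; rewrite nrmZr //; have := bd_sq bw d; rewrite /=.
  have := nrm_ge0 d; lra.
have pK' : pos K'.
  split=> // d; have [_ hw] := bd_one_sub_sq sw bw.
  have -> : d - K' d = (1 - 5^-1)%:C *: d + t *: (d - w (w d)).
    have -> : (1 - 5^-1)%:C = 1 - t by rewrite rmorphB.
    rewrite scalerBl scale1r scalerBr /K'; abel.
  have b45 : 0 <= 1 - 5^-1 :> R by lra.
  have := bdD (bdZ b45 (@bd_id _ _)) (bdZ b15 hw) d.
  by rewrite (_ : (1 - 5^-1) * 1 + 5^-1 * 1 = 1) //; ring.
have KK := op_sqrt_sq sK bK (pos_comp_self sK bK) pK.
have KK' := op_sqrt_sq sK' bK' (pos_comp_self sK' bK') pK'.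
(* [c] intertwines [K'] and [K] up to sign, hence their squares exactly, hence the roots of these
   squares, which are [K'] and [K] by positivity. The two signs together give [c K' = 0]. *)
have cK b : c ** K' b = - K (c ** b).
  by rewrite /K' /K cmulZr -scalerN -cmulNr cc opprK.
have cKK d : c ** K' d = K (c ** d).
  rewrite -KK -KK'.
  apply: (op_sqrt_intertwine (C := nrm c) (pos_comp_self sK' bK')
    (pos_comp_self sK bK)).
  - exact: cmul_linearr.
  - exact: bd_mul.
  by move=> b; rewrite /= !cK (lfN (sa_linear sK)) opprK.
have cK0 d : c ** K' d = 0.
  have : c ** K' d + c ** K' d = 0 by rewrite {2}cK cKK subrr.
  rewrite -mulr2n -scaler_nat => /eqP; rewrite scaler_eq0 pnatr_eq0 /=.
  by move/eqP.
have cww d : c ** w (w d) = 0.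
  have := cK0 d; rewrite /K' cmulZr => /eqP; rewrite scaler_eq0 => /orP[|/eqP//].
  by rewrite fmorph_eq0 invr_eq0 pnatr_eq0.
(* From here everything collapses: [w^4 = - c^* c w^2 = 0], then [w^2], [c], [T m], [P m] and [m^2]
   vanish, so [m = 0] and [T] equals the positive [P]. *)
have ww0 d : w (w d) = 0.
  apply: nrm_eq0; apply/eqP; rewrite -sqrf_eq0 -nrm_cstar !sw.
  have -> : w (w (w (w d))) = - (star c ** (c ** w (w d))) by rewrite cc opprK.
  by rewrite cww cmul0r oppr0 cmul0r nrm0.
have c0 d : c ** d = 0.
  apply: nrm_eq0; apply/eqP; rewrite -sqrf_eq0 -nrm_cstar starM -cmulA cc ww0.
  by rewrite oppr0 cmul0r nrm0.
have Tm0 d : T (m d) = 0 by rewrite /T /h -cmulA -cE c0 cmul0r.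
have Pm0 d : P (m d) = 0 by apply/eqP; rewrite -oppr_eq0 -Tm_P Tm0.
have mm0 d : m (m d) = 0 by rewrite {1}/m Pm0 Tm0 subr0 scaler0.
have m0 d : m d = 0.
  apply: nrm_eq0; apply/eqP; rewrite -sqrf_eq0 -nrm_cstar sm mm0.
  by rewrite cmul0r nrm0.
have PT d : P d = T d.
  have /eqP := m0 d; rewrite scaler_eq0 fmorph_eq0 invr_eq0 pnatr_eq0 /=.
  by rewrite subr_eq0 => /eqP.
split=> // d; rewrite -[star a ** a ** d]/(T d) -PT; exact: pP.2.
Qed.

(** The Hilbert module axioms ask for a root in [S], not merely a multiplier. With [X = 1 - h] the
    approximants are a scalar [gam n] plus an element [e n] of [S]; as [gam n] tends to [1], the
    elements [- e n] converge to the root of [h]. *)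
Lemma starM_sqrt (S : set A) (a : A) : cstar_subalgebra S ->
  S (star a ** a) -> exists2 s, S s & star a ** a = star s ** s.
Proof.
move=> [Scl S0 SL SM SS].
have SZ z b : S b -> S (z *: b) by move=> Sb; rewrite -[_ *: _]addr0; exact: SL.
have SD b d : S b -> S d -> S (b + d).
  by move=> Sb Sd; rewrite -[b]scale1r; exact: SL.
have [->|a0] := eqVneq a 0; first by exists 0; rewrite ?cmul0r.
wlog a1 : a a0 / nrm a = 1.
  move=> W Saa; pose r := nrm a; have r0 : 0 < r by exact: nrm_gt0.
  have [| |s Ss ss] := W (r^-1%:C *: a) _ (nrm_unit a0).
  - rewrite scaler_eq0 negb_or a0 andbT fmorph_eq0 invr_eq0 gt_eqF //.
  - by rewrite starZr cmulZl cmulZr; exact/SZ/SZ.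
  exists (r%:C *: s); first exact: SZ.
  rewrite starZr cmulZl cmulZr -ss starZr cmulZl cmulZr !scalerA.
  rewrite -!rmorphM /= (_ : _ * _ = 1 :> R) ?scale1r //.
  by field; rewrite gt_eqF.
move=> Sh; set h := star a ** a in Sh *.
have p : pos (cmul h) by apply: starM_pos; rewrite a1.
pose X d := d - h ** d.
have sX : sa X by apply: sa_one_sub; case: p.
have bX : bd 1 X by case: p.
(* The n-th approximant of the square root of [1 - X] is
   [1 - gam n - e n]. *)
pose e := fix e n := if n is m.+1 then
  (2^-1)%:C *: ((2 * gam R m)%:C *: e m + e m ** e m - h) else 0.
have Se n : S (e n).
  elim: n => [//|n IH] /=; apply: (SZ); apply: (SD).
    by apply: (SD); [exact: SZ | exact: SM].
  by rewrite -scaleN1r; exact: SZ.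
have eE n d : sqrt_approx X n d = (gam R n)%:C *: d + e n ** d.
  elim: n d => [|n IH] d /=; first by rewrite scale0r cmul0l addr0.
  rewrite !IH /X !cmulZl; set g := gam R n.
  have -> : ((1 + g ^+ 2) / 2)%:C = (2^-1)%:C * (1 + g%:C * g%:C) :> R[i].
    by rewrite mulrC !rmorphM rmorphD rmorph1 /= expr2 rmorphM.
  rewrite -scalerA -scalerDr; congr (_ *: _).
  rewrite scalerDl scale1r !(cmulDl, cmulNl, cmulDr) cmulZl cmulZr scalerDr.
  rewrite cmulA scalerA (_ : (2 * g)%:C = g%:C + g%:C) ?scalerDl; first by abel.
  by rewrite -rmorphD /= mulrDl mul1r.
(* One error [1 - gam n] comes from replacing the scalar by [1], the other from the
   approximation. *)
have ue n d : nrm (e n ** d - (one_sub_sqrt X d - d)) <=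
    2 * (1 - gam R n) * nrm d.
  have -> : e n ** d - (one_sub_sqrt X d - d) =
      (1 - gam R n)%:C *: d - (one_sub_sqrt X d - sqrt_approx X n d).
    have -> : (1 - gam R n)%:C = 1 - (gam R n)%:C by rewrite rmorphB.
    by rewrite eE scalerBl scale1r; abel.
  apply: le_trans (nrmB _ _) _.
  have := one_sub_sqrt_approx sX bX n d.
  by rewrite nrmZr ?subr_ge0 ?gam_le1 //; lra.
have [|l el] := @nrm_complete _ _ e.
  move=> r r0; have r4 : 0 < r / 4 by rewrite divr_gt0.
  have [N gN] := gam_cvg r4; exists N => m n Nm Nn.
  apply: (@le_lt_trans _ _ (2 * (1 - gam R m) + 2 * (1 - gam R n))).
    apply: nrm_le_cmul => [|d].
      have := gam_le1 R m; have := gam_le1 R n; lra.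
    rewrite cmulBl -(subrK (one_sub_sqrt X d - d) (e m ** d)) -addrA.
    apply: le_trans (nrmD _ _) _; rewrite mulrDl lerD //.
    by rewrite nrm_dist.
  have := gam_le R Nm; have := gam_le R Nn; lra.
have lE d : l ** d = one_sub_sqrt X d - d.
  apply/eqP; rewrite -subr_eq0; apply/eqP/nrm_eq0/eqP.
  rewrite eq_le nrm_ge0 andbT; apply: (@eq0_le_eps _ _ (3 * nrm d)) => r r0.
  have [N gN] := gam_cvg r0; have [N' eN'] := el _ r0.
  pose n := maxn N N'.
  rewrite -(subrK (e n ** d) (l ** d)) -addrA -cmulBl.
  apply: le_trans (nrmD _ _) _; apply: le_trans (lerD (nrmM _ _) (ue _ _)) _.
  have := eN' n (leq_maxr _ _); rewrite nrm_dist => /ltW h1.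
  have := gam_le R (leq_maxl N N' : (N <= n)%N) => h2.
  have := ler_wpM2r (nrm_ge0 d) h1.
  have : (1 - gam R n) * nrm d <= r * nrm d.
    by rewrite ler_wpM2r ?nrm_ge0 //; lra.
  lra.
exists (- l).
  rewrite -scaleN1r; apply: (SZ); apply: (closedP Scl) => r r0.
  have [N eN] := el _ r0; exists (e N) => //.
  by rewrite nrm_dist; exact: eN.
have sE d : - l ** d = op_sqrt (cmul h) d by rewrite cmulNl lE opprB.
apply/eqP; rewrite eq_sym -subr_eq0; apply/eqP/cmul_inj0r => d.
rewrite cmulBl -cmulA sE [op_sqrt _ d in X in X - _](_ : _ = - l ** d) ?sE //.
apply/eqP; rewrite subr_eq0; apply/eqP.
apply/eqP; rewrite -subr_eq0; apply/eqP/cmul_inj0 => b.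
rewrite cmulBr cmulA -starM sE (op_sqrt_sa p) op_sqrtK //.
by rewrite subrr.
Qed.

End Positivity.

(** * Continuous functionals *)

Section HahnBanach.
Variables (R : realType) (A : cstarAlgType R).
Implicit Types (a b x : A) (q : A -> R).

Record sublinear q : Prop := Sublinear {
  sublinearD : forall a b, q (a + b) <= q a + q b;
  sublinearZ : forall (t : R) a, 0 < t -> q (t%:C *: a) <= t * q a;
  sublinear_le : forall a, q a <= nrm a }.

Lemma sublinear0 q : sublinear q -> q 0 = 0.
Proof.
move=> [qD _ qle]; have := qle 0; rewrite nrm0 => q0; apply/eqP; rewrite eq_le q0 /=.
by have := qD 0 0; rewrite addr0; lra.
Qed.

Lemma sublinear_ge q a : sublinear q -> - q (- a) <= q a.
Proof.
by move=> sq; have := sublinearD sq a (- a); rewrite subrr sublinear0 //; lra.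
Qed.

Lemma sublinear_homo q (t : R) a : sublinear q -> 0 <= t ->
  q (t%:C *: a) = t * q a.
Proof.
move=> sq; rewrite le_eqVlt => /orP[/eqP <-|t0].
  by rewrite scale0r mul0r sublinear0.
apply/eqP; rewrite eq_le sublinearZ //=.
have ti : 0 < t^-1 by rewrite invr_gt0.
have := sublinearZ sq (t%:C *: a) ti.
rewrite scalerA -rmorphM /= mulVf ?gt_eqF // scale1r.
by rewrite mulrC ler_pdivlMr // mulrC.
Qed.

Lemma sublinear_ge_nrm q a : sublinear q -> - nrm a <= q a.
Proof.
move=> sq; have := sublinear_ge a sq; have := sublinear_le sq (- a).
by rewrite nrmN; lra.
Qed.

Lemma sublinear_nrm : sublinear (@nrm R A).
Proof. by split=> [a b|t a t0|//]; [exact: nrmD | rewrite nrmZr // ltW]. Qed.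

(** Choosing [t = 1], [a = - x] shows that the tilt takes at [- x] a value at most [- q x]. If a
    tilt along [b] changes nothing, [t = 1] gives [q a + q b <= q (a + b)]. *)
Definition tilt q x a : R :=
  inf [set r | exists2 t : R, 0 <= t & r = q (a + t%:C *: x) - t * q x].

Lemma tilt_le q x a (t : R) : sublinear q -> 0 <= t ->
  tilt q x a <= q (a + t%:C *: x) - t * q x.
Proof.
move=> sq t0; apply: ge_inf; last by exists t.
exists (- nrm a) => _ [s s0 ->].
have := sublinearD sq (a + s%:C *: x) (- a).
rewrite addrAC subrr add0r sublinear_homo //.
have := sublinear_le sq (- a); rewrite nrmN; lra.
Qed.

Lemma tilt_ge q x a (r : R) :
  (forall t : R, 0 <= t -> r <= q (a + t%:C *: x) - t * q x) -> r <= tilt q x a.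
Proof.
move=> H; apply: lb_le_inf; first by exists (q (a + 0%:C *: x) - 0 * q x), 0.
by move=> _ [t t0 ->]; exact: H.
Qed.

Lemma tilt_sublinear q x : sublinear q -> sublinear (tilt q x).
Proof.
move=> sq; split=> [a b|t a t0|a].
- rewrite -lerBlDr; apply: tilt_ge => t t0.
  rewrite lerBlDr -lerBlDl; apply: tilt_ge => s s0.
  rewrite lerBlDl.
  have := tilt_le x (a + b) sq (addr_ge0 t0 s0).
  have -> : a + b + (t + s)%:C *: x = (a + t%:C *: x) + (b + s%:C *: x).
    by rewrite rmorphD /= scalerDl addrACA.
  have := sublinearD sq (a + t%:C *: x) (b + s%:C *: x); lra.
- rewrite -ler_pdivrMl //; apply: tilt_ge => s s0.
  rewrite ler_pdivrMl //.
  have := tilt_le x (t%:C *: a) sq (mulr_ge0 (ltW t0) s0).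
  by rewrite rmorphM /= -scalerA -scalerDr (sublinear_homo _ sq (ltW t0)); lra.
have := tilt_le x a sq (lexx 0); rewrite scale0r addr0 mul0r subr0.
by move=> /le_trans; apply; exact: sublinear_le.
Qed.

(* A minimal sublinear functional [q] is additive since its tilt along [x] is
   again sublinear and below [q]. *)
Lemma hahn_banach_real x : exists f : A -> R,
  [/\ forall a b, f (a + b) = f a + f b,
      forall (t : R) a, f (t%:C *: a) = t * f a,
      forall a, `|f a| <= nrm a & f x = nrm x].
Proof.
(* The bound at [- x] survives minimisation and forces the value [nrm x] at [x]. *)
pose P q := sublinear q /\ q (- x) <= - nrm x.
pose q0 := tilt (@nrm R A) x.
have Pq0 : P q0.
  split; first exact/tilt_sublinear/sublinear_nrm.
  have := tilt_le x (- x) sublinear_nrm ler01.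
  by rewrite scale1r addNr nrm0 mul1r sub0r.
pose T := {q : A -> R | P q}.
(* The order is reversed, so that a maximal element is a minimal functional. *)
pose le (q r : T) : bool := `[< forall a, sval r a <= sval q a >].
have [//|||F Ftot|[q [sq qx]] qmin] := @Zorn T le.
- by move=> q; apply/asboolP.
- move=> q r s /asboolP qr /asboolP rs; apply/asboolP => a.
  exact: le_trans (rs a) (qr a).
- move=> [q Pq] [r Pr] /asboolP qr /asboolP rq; apply: eq_exist.
  by apply/funext => a; apply/eqP; rewrite eq_le rq qr.
(* A nonempty chain is bounded by its pointwise infimum, which is subadditive by totality of the
   chain; the empty one is bounded by [q0]. *)
- have [[s0 Fs0]|F0] := pselect (F !=set0); last first.
    exists (exist _ q0 Pq0) => s Fs; exfalso; apply: F0; by exists s.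
  pose g a := inf [set sval s a | s in F].
  have gle s a : F s -> g a <= sval s a.
    move=> Fs; apply: ge_inf; last by exists s.
    exists (- nrm a) => _ [r _ <-]; apply: sublinear_ge_nrm.
    by case: r => r [].
  have gge a r : (forall s, F s -> r <= sval s a) -> r <= g a.
    move=> H; apply: lb_le_inf; first by exists (sval s0 a), s0.
    by move=> _ [s Fs <-]; exact: H.
  have Pg : P g.
    split; last first.
      by apply: le_trans (gle _ _ Fs0) _; case: (s0) => r [].
    split=> [a b|t a t0|a].
    + rewrite -lerBlDr; apply: (gge) => s Fs; rewrite lerBlDr -lerBlDl.
      apply: (gge) => r Fr; rewrite lerBlDl.
      have key u v : F u -> le v u -> g (a + b) <= sval v a + sval u b.
        move=> Fu /asboolP vu; apply: le_trans (gle _ (a + b) Fu) _.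
        have su : sublinear (sval u) by case: (u) => ? [].
        by apply: le_trans (sublinearD su _ _) _; rewrite lerD2r.
      have key' u v : F v -> le u v -> g (a + b) <= sval v a + sval u b.
        move=> Fv /asboolP uv; apply: le_trans (gle _ (a + b) Fv) _.
        have sv : sublinear (sval v) by case: (v) => ? [].
        by apply: le_trans (sublinearD sv _ _) _; rewrite lerD2l.
      by case: (Ftot _ _ Fs Fr) => ?; [apply: key | apply: key'].
    + rewrite -ler_pdivrMl //; apply: (gge) => s Fs; rewrite ler_pdivrMl //.
      apply: le_trans (gle _ _ Fs) _.
      by apply: sublinearZ => //; case: (s) => ? [].
    + apply: le_trans (gle _ a Fs0) _.
      by apply: sublinear_le; case: (s0) => ? [].
  by exists (exist _ g Pg) => s Fs; apply/asboolP => a; exact: gle.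
have tle b a : tilt q b a <= q a.
  by have := tilt_le b a sq (lexx 0); rewrite scale0r addr0 mul0r subr0.
have tq b : tilt q b = q.
  have Pt : P (tilt q b).
    split; first exact: tilt_sublinear.
    exact: le_trans (tle _ _) qx.
  have /(_ _)/(congr1 sval) := qmin (exist _ _ Pt); apply.
  by apply/asboolP => a; exact: tle.
have qD a b : q (a + b) = q a + q b.
  apply/eqP; rewrite eq_le sublinearD //=.
  have := tilt_le b a sq ler01; rewrite tq scale1r mul1r; lra.
have qN a : q (- a) = - q a.
  by apply: (addrI (q a)); rewrite -qD !subrr sublinear0.
have qle a : q a <= nrm a by exact: sublinear_le.
exists q; split=> // [t a|a|].
- case: (lerP 0 t) => t0; first exact: sublinear_homo.
  have : q ((- t)%:C *: a) = - t * q a by rewrite sublinear_homo // oppr_ge0 ltW.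
  by rewrite rmorphN /= scaleNr qN mulNr => /oppr_inj.
- by rewrite ler_norml qle andbT; have := qle (- a); rewrite nrmN qN; lra.
by apply/eqP; rewrite eq_le qle /=; move: (qx); rewrite qN lerN2.
Qed.

(** Complexification [f a - i f (i a)] of the real functional; the factor 2 bounds real and
    imaginary parts separately. *)
Lemma hahn_banach_separation x : x != 0 -> exists2 phi : A -> R[i],
  linear (phi : A -> R[i]^o) & (forall a, `|phi a| <= (2 * nrm a)%:C) /\ phi x != 0.
Proof.
move=> x0; have [f [fD fZ fle fx]] := hahn_banach_real x.
pose phi a : R[i] := f a +i* (- f ('i%C *: a)).
have fN a : f (- a) = - f a.
  apply: (addrI (f a)); rewrite -fD !subrr; apply: (addrI (f 0)).
  by rewrite -fD !addr0.
exists phi; last split.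
- move=> z a b; rewrite /phi.
  have zE c : z *: c = (complex.Re z)%:C *: c + (complex.Im z)%:C *: ('i%C *: c).
    by rewrite scalerA -scalerDl mulrC -complexE.
  have iE : 'i%C *: (z *: a + b) = (complex.Re z)%:C *: ('i%C *: a) -
      (complex.Im z)%:C *: a + 'i%C *: b.
    have -> : 'i%C *: (z *: a + b) = z *: ('i%C *: a) + 'i%C *: b.
      by rewrite scalerDr !scalerA mulrC.
    rewrite zE; congr (_ + _ + _).
    by rewrite -scalerN; congr (_ *: _); rewrite scalerA -expr2 sqr_i scaleN1r.
  rewrite iE zE !fD fN !fZ; case: z {zE iE} => r s.
  by apply/eqP; rewrite eq_complex /=; apply/andP; split; apply/eqP; ring.
- move=> a; rewrite [phi a]complexE; apply: le_trans (ler_normD _ _) _.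
  rewrite normrM !normc_def /= expr0n /= expr1n add0r !addr0 sqrtr1 mul1r.
  rewrite -rmorphD lecR !sqrtr_sqr normrN.
  have := fle a; have := fle ('i%C *: a); rewrite nrmZ.
  by rewrite normc_def /= expr0n /= expr1n add0r sqrtr1 mul1r; lra.
by apply/eqP => -[fx0 _]; have := nrm_gt0 x0; rewrite -fx fx0 ltxx.
Qed.

Lemma bounded_continuous (phi : A -> R[i]) (C : R) :
  linear (phi : A -> R[i]^o) -> (forall a, `|phi a| <= (C * nrm a)%:C) ->
  continuous (phi : A -> R[i]^o).
Proof.
move=> phiL phiC a; apply/cvgrPdist_lt => /= e e0.
have eE : (complex.Re e)%:C = e by rewrite RRe_real // gtr0_real.
have {}e0 : 0 < complex.Re e by rewrite -ltcR eE.
have C0 : 0 < `|C| + 1 by rewrite ltr_wpDl.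
near=> b.
have -> : phi a - phi b = phi (a - b) by rewrite (lfB phiL).
apply: le_lt_trans (phiC _) _; rewrite -eE ltcR.
apply: (@le_lt_trans _ _ ((`|C| + 1) * nrm (a - b))).
  by rewrite ler_wpM2r ?nrm_ge0 // ler_wpDr // ler_norm.
rewrite -ltr_pdivlMl // -ltcR -nrmE.
near: b; have /cvgrPdist_lt := @cvg_id _ (nbhs a); apply.
by rewrite ltcR mulr_gt0 // invr_gt0.
Unshelve. all: by end_near. Qed.

Lemma scalar_separation x y :
  (forall phi : A -> R[i], linear (phi : A -> R[i]^o) ->
     (exists2 C : R, 0 <= C & forall a, `|phi a| <= (C * nrm a)%:C) ->
     phi x = phi y) ->
  x = y.
Proof.
move=> H; apply/eqP; rewrite -subr_eq0; apply/negPn/negP => xy.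
have [phi phiL [phiC /eqP]] := hahn_banach_separation xy; apply.
by rewrite (lfB phiL) (H phi phiL) ?subrr //; exists 2.
Qed.

End HahnBanach.

(** * Translation invariance *)

Section InvariantIntegral.
Variables (d : measure_display) (T : measurableType d) (R : realType).
Variable mu : {measure set T -> \bar R}.

Import HBNNSimple.
Local Open Scope ereal_scope.

Let nnintegral (f : T -> \bar R) := ereal_sup [set sintegral mu h |
  h in [set h : {nnsfun T >-> R} | forall x, (h x)%:E <= f x]].

Let nnintegral_comp_ge (g : T -> T) (f : T -> \bar R) :
  measurable_fun [set: T] g ->
  (forall E, measurable E -> mu (g @^-1` E) = mu E) ->
  nnintegral f <= nnintegral (f \o g).
Proof.
move=> mg gmu; apply: ge_ereal_sup => _ [h /= hf <-].
have mhg : measurable_fun [set: T] (h \o g) by exact: measurableT_comp.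
have fhg : finite_set (range (h \o g)).
  apply: (@sub_finite_set _ _ (range h)); last exact: fimfunP.
  by move=> _ [x _ <-]; exists (g x).
have phg x : (0 <= (h \o g) x)%R by exact: fun_ge0.
pose hg : {nnsfun T >-> R} := HB.pack (h \o g)
  (isMeasurableFun.Build _ _ _ _ (h \o g) mhg)
  (FiniteImage.Build _ _ (h \o g) fhg) (isNonNegFun.Build _ _ (h \o g) phg).
apply: ereal_sup_ubound; exists hg => /=; first by move=> x; exact: hf.
rewrite !sintegralET; apply: eq_fsbigr => x _; congr (_ * _).
by rewrite -[RHS]gmu.
Qed.

(* The integral of an arbitrary function is built from suprema over simple
   functions, which [g] and [g'] carry into one another. *)
Lemma integral_comp_invariant (g g' : T -> T) (f : T -> \bar R) :
  cancel g' g -> measurable_fun [set: T] g -> measurable_fun [set: T] g' ->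
  (forall E, measurable E -> mu (g @^-1` E) = mu E) ->
  (forall E, measurable E -> mu (g' @^-1` E) = mu E) ->
  \int[mu]_x f (g x) = \int[mu]_x f x.
Proof.
move=> g'K mg mg' gmu g'mu.
have E (h : T -> \bar R) : nnintegral (h \o g) = nnintegral h.
  apply/eqP; rewrite eq_le nnintegral_comp_ge // andbT.
  rewrite [in leRHS](_ : h = (h \o g) \o g').
    exact: nnintegral_comp_ge.
  by apply/funext => x /=; rewrite g'K.
rewrite /integral !patch_setT -!/(nnintegral _).
congr (_ - _); rewrite -[RHS]E; congr (nnintegral _).
  by apply/funext => x; rewrite /= !funeposE.
by apply/funext => x; rewrite /= !funenegE.
Qed.

End InvariantIntegral.

Section GroupIntegral.
Variables (R : realType) (L : topologicalGroupType).
Variable mu : {measure set (borel L) -> \bar R}.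

Lemma continuous_borel_measurable (g : L -> L) : continuous g ->
  measurable_fun [set: borel L] (g : borel L -> borel L).
Proof.
move=> gc; apply: measurability => //=.
move=> _ [U oU <-]; rewrite setTI; apply: sub_sigma_algebra.
by move/continuousP : gc; exact.
Qed.

Lemma cintegral_comp_invariant (g g' : L -> L) (f : L -> R[i]) :
  cancel g g' -> cancel g' g -> continuous g -> continuous g' ->
  (forall E : set (borel L), (@open L).-sigma.-measurable E -> mu (g @` E) = mu E) ->
  (forall E : set (borel L), (@open L).-sigma.-measurable E -> mu (g' @` E) = mu E) ->
  cintegral mu [set: L] (f \o g) = cintegral mu [set: L] f.
Proof.
move=> gK g'K gc g'c gmu g'mu.
have im h h' (E : set L) : cancel h h' -> cancel h' h -> h @^-1` E = h' @` E.
  move=> hK h'K; apply/seteqP; split=> [x Ex|_ [x Ex <-]].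
    by exists (h x).
  by rewrite /preimage /= h'K.
rewrite /cintegral /Rintegral; congr (_ +i* _); congr fine.
  apply: (@integral_comp_invariant _ (borel L) R mu g g' (fun x => (complex.Re (f x))%:E)).
  - exact: g'K.
  - exact: continuous_borel_measurable.
  - exact: continuous_borel_measurable.
  - by move=> E mE; rewrite (im _ g g') // g'mu.
  - by move=> E mE; rewrite (im _ g' g) // gmu.
apply: (@integral_comp_invariant _ (borel L) R mu g g' (fun x => (complex.Im (f x))%:E)).
- exact: g'K.
- exact: continuous_borel_measurable.
- exact: continuous_borel_measurable.
- by move=> E mE; rewrite (im _ g g') // g'mu.
- by move=> E mE; rewrite (im _ g' g) // gmu.
Qed.

(** Invariance is known on all of [L], while integrands over [M] are compared at points of [M] only;
    extension by zero serves both. *)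
Lemma cintegral_setT (D : set L) (f : L -> R[i]) :
  cintegral mu D f =
  cintegral mu [set: L] (fun x => if x \in D then f x else 0).
Proof.
rewrite /cintegral; congr (_ +i* _); rewrite Rintegral_mkcond;
  congr (Rintegral _ _ _); apply/funext => x; rewrite /patch; case: ifP => //.
Qed.

Lemma cintegral_cst (D : set L) (c : R[i]) (f : L -> R[i]) :
  open D -> mu D = 1%E -> (forall x, D x -> f x = c) -> cintegral mu D f = c.
Proof.
move=> oD D1 fc.
have mD : (@open L).-sigma.-measurable D by exact: sub_sigma_algebra.
have E (h : L -> R) (r : R) : (forall x, D x -> h x = r) -> Rintegral mu D h = r.
  move=> hr; rewrite /Rintegral (eq_integral (cst r%:E)).
    by rewrite integral_cst //= D1 mule1.
  by move=> x /set_mem Dx /=; rewrite hr.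
rewrite /cintegral (E _ (complex.Re c)) ?(E _ (complex.Im c)); last 2 first.
- by move=> x /fc ->.
- by move=> x /fc ->.
by case: c {fc}.
Qed.

End GroupIntegral.

(** * Translation and involution on [Cc]; the modular function on [M] *)

Section CompactSupport.
Variables (R : realType) (L : topologicalGroupType).
Implicit Types (f g : L -> R[i]) (k x y : L).

Lemma mulg_continuousr k : continuous (fun x : L => (x * k)%g).
Proof.
move=> x; apply: (@continuous_comp _ _ _ (fun x : L => (x, k))
  (fun xy : L * L => (xy.1 * xy.2)%g)); last exact: mulg_continuous.
by apply: cvg_pair; [exact: cvg_id | exact: cvg_cst].
Qed.

Lemma mulg_continuousl k : continuous (fun x : L => (k * x)%g).
Proof.
move=> x; apply: (@continuous_comp _ _ _ (fun x : L => (k, x))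
  (fun xy : L * L => (xy.1 * xy.2)%g)); last exact: mulg_continuous.
by apply: cvg_pair; [exact: cvg_cst | exact: cvg_id].
Qed.

Lemma compact_support_comp (h h' : L -> L) (S U : set L) :
  cancel h h' -> cancel h' h -> continuous h -> continuous h' ->
  compact (closure S) -> U `<=` h @^-1` S -> compact (closure U).
Proof.
move=> hK h'K hc h'c cS US.
have E : h @^-1` (closure S) = h' @` (closure S).
  by apply/seteqP; split=> [x ?|_ [x ? <-]]; [exists (h x)|rewrite /preimage /= h'K].
apply: (@subclosed_compact _ _ (h @^-1` (closure S))).
- exact: closed_closure.
- rewrite E; apply: continuous_compact => //.
  exact: continuous_subspaceT.
- have cl : closed (h @^-1` (closure S)).
    by apply: (closed_comp _ (@closed_closure _ S)) => x _; exact: hc.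
  rewrite closure_id in cl; rewrite cl; apply: closure_subset.
  by move=> x /US Sx; exact: subset_closure.
Qed.

Lemma Cc_translate f k : Cc R L f -> Cc R L (fun x => f (k^-1 * x)%g).
Proof.
move=> [fc fs]; split.
  move=> x; apply: (@continuous_comp _ _ _ (fun x : L => (k^-1 * x)%g)
    (f : L -> R[i]^o)); [exact: mulg_continuousl | exact: fc].
apply: (compact_support_comp (h := fun x => (k^-1 * x)%g)
  (h' := fun x => (k * x)%g) _ _ _ _ fs).
- by move=> x; rewrite mulVKg.
- by move=> x; rewrite mulKg.
- exact: mulg_continuousl.
- exact: mulg_continuousl.
- by [].
Qed.

Variables (mu : {measure set (borel L) -> \bar R}) (Delta : L -> R).
Variables (M : set L).
Hypotheses (hM : is_subgroup M) (hMo : open M) (hmuM : mu M = 1%E).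
Hypothesis hDelta : is_modular_function mu Delta.

Let mM : (@open L).-sigma.-measurable M.
Proof. exact: sub_sigma_algebra. Qed.

(** [M k = M], so [M k x] and [M x] have the same measure. Since [M] is open, [Delta] is thereby
    locally constant, and it is trivial on [M]. *)
Lemma modular_invl k x : M k -> Delta (k * x)%g = Delta x.
Proof.
move=> Mk; have [_ H] := hDelta.
have := H (k * x)%g _ mM; have := H x _ mM; rewrite hmuM !mule1.
have -> : [set (y * (k * x))%g | y in M] = [set (y * x)%g | y in M].
  apply/seteqP; split=> _ [y My <-].
    by exists (y * k)%g; [exact: (subgroupM hM) | rewrite mulgA].
  exists (y * k^-1)%g; last by rewrite mulgA mulgVK.
  by apply: (subgroupM hM) => //; exact: (subgroupV hM).
by move=> -> [].
Qed.

Lemma modular1 k : M k -> Delta k = 1.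
Proof.
move=> Mk; rewrite -[k]mulg1 modular_invl //.
have [_ /(_ 1%g _ mM)] := hDelta; rewrite hmuM mule1.
rewrite (_ : [set _ | _ in M] = M) ?hmuM; first by move=> [].
by apply/seteqP; split=> [_ [y My <-]|y My]; [rewrite mulg1 | exists y; rewrite ?mulg1].
Qed.

Lemma Cc_star_Cc f : Cc R L f -> Cc R L (Cc_star Delta f).
Proof.
move=> [fc fs]; have [D0 _] := hDelta; split; last first.
  apply: (compact_support_comp (h := fun x => x^-1%g) (h' := fun x => x^-1%g)
    _ _ _ _ fs); [exact: invgK|exact: invgK|exact: invg_continuous
    |exact: invg_continuous|].
  move=> x; rewrite /Cc_star /preimage /=; apply: contraNneq => ->.
  by rewrite rmorph0 mulr0.
move=> x0; pose c := (Delta x0^-1%g)%:C : R[i].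
have conjc : continuous (fun z : R[i]^o => z^* : R[i]^o).
  move=> z U /nbhs_ballP[e /= e0 zU]; apply/nbhs_ballP; exists e => //= w zw.
  by apply: zU; move: zw; rewrite -!ball_normE /= -rmorphB norm_conjC.
have H : continuous (fun x => c *: ((f x^-1%g)^* : R[i]^o) : R[i]^o).
  move=> x; apply: cvgZr.
  apply: (@continuous_comp _ _ _ (fun x => f x^-1%g : R[i]^o));
    last exact: conjc.
  apply: (@continuous_comp _ _ _ (fun x : L => x^-1%g) (f : L -> R[i]^o)).
    exact: invg_continuous.
  exact: fc.
apply: (cvg_trans _ (H x0)); apply: near_eq_cvg.
(* On this neighbourhood of [x0] the factor [Delta x^-1] is the constant [c]. *)
have nM : nbhs x0 [set x | M (x^-1 * x0)%g].
  apply: open_nbhs_nbhs; split; last by rewrite /= mulVg; exact: (subgroup1 hM).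
  have ic : continuous (fun x : L => (x^-1 * x0)%g).
    move=> x; apply: (@continuous_comp _ _ _ (fun x : L => x^-1%g)
      (fun x : L => (x * x0)%g)); first exact: invg_continuous.
    exact: mulg_continuousr.
  by move/continuousP : ic; exact.
apply: filterS nM => x /= Mx; rewrite /Cc_star /c.
by rewrite -(modular_invl x0^-1%g Mx) mulgK.
Qed.

(** Substitution of [y * k] in the integral; [Delta] being [1] on [M], right translation by [k]
    preserves [mu]. *)
Lemma convolution_translate f g k : M k ->
  convolution mu (Cc_star Delta (fun x => f (k^-1 * x)%g))
    (fun x => g (k^-1 * x)%g) = convolution mu (Cc_star Delta f) g.
Proof.
move=> Mk; apply/funext => x; rewrite /convolution.
have MkV : M k^-1%g by exact: (subgroupV hM).
have E h : M h -> forall E : set (borel L), (@open L).-sigma.-measurable E ->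
    mu [set (y * h)%g | y in E] = mu E.
  by move=> Mh E mE; have [_ ->] := hDelta; rewrite // modular1 // mul1e.
rewrite -[RHS](@cintegral_comp_invariant _ _ mu (fun y => (y * k)%g)
   (fun y => (y * k^-1)%g)).
- congr (cintegral _ _ _); apply/funext => y /=.
  by rewrite /Cc_star invgM modular_invl // mulgA.
- by move=> y; rewrite mulgK.
- by move=> y; rewrite mulgVK.
- exact: mulg_continuousr.
- exact: mulg_continuousr.
- exact: E.
- exact: E.
Qed.

End CompactSupport.

(** * Multipliers, density, and the unitaries [lambda k] *)

Section Multipliers.
Variables (R : realType) (A : cstarAlgType R) (m : multiplier A).

Lemma mult_l_linear : linear (mult_l m).
Proof.
move=> z a b; apply/eqP; rewrite -subr_eq0; apply/eqP/cmul_inj0 => c.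
by rewrite cmulBr cmulDr cmulZr !mult_compat cmulDr cmulZr subrr.
Qed.

Lemma mult_lM a b : mult_l m (a ** b) = mult_l m a ** b.
Proof.
apply/eqP; rewrite -subr_eq0; apply/eqP/cmul_inj0 => c.
by rewrite cmulBr cmulA !mult_compat cmulA subrr.
Qed.

End Multipliers.

Section Density.
Variables (R : realType) (A : cstarAlgType R) (D : set A).
Hypothesis D_dense : closure D = [set: A].

Lemma dense_approx a (e : R) : 0 < e -> exists2 b, D b & nrm (a - b) < e.
Proof. by apply: (closureP D a).1; rewrite D_dense. Qed.

Lemma dense_eq (F G : A -> A) C : linear F -> linear G ->
  (forall a, nrm (F a) <= C * nrm a) -> (forall a, nrm (G a) <= C * nrm a) ->
  (forall a, D a -> F a = G a) -> forall a, F a = G a.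
Proof.
move=> FL GL FC GC FG a.
apply/eqP; rewrite -subr_eq0; apply/eqP/nrm_eq0/eqP.
rewrite eq_le nrm_ge0 andbT; apply: (@eq0_le_eps _ _ (`|C| + `|C|)) => e e0.
have [b Db ab] := dense_approx a e0.
have -> : F a - G a = F (a - b) - G (a - b).
  by rewrite (lfB FL) (lfB GL) (FG b Db); abel.
apply: le_trans (nrmB _ _) _; rewrite mulrDr lerD //.
  apply: le_trans (FC _) _; rewrite mulrC.
  rewrite (le_trans (ler_wpM2l (nrm_ge0 _) (ler_norm C))) //.
  by rewrite ler_wpM2r // ltW.
apply: le_trans (GC _) _; rewrite mulrC.
rewrite (le_trans (ler_wpM2l (nrm_ge0 _) (ler_norm C))) //.
by rewrite ler_wpM2r // ltW.
Qed.

Lemma dense_inj0 a : (forall b, D b -> a ** b = 0) -> a = 0.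
Proof.
move=> aD; apply: cmul_inj0r => b.
apply: (@dense_eq (cmul a) (fun=> 0) (nrm a)).
- exact: cmul_linearr.
- by move=> z c d; rewrite scaler0 addr0.
- exact: nrmM.
- by move=> c; rewrite nrm0 mulr_ge0 ?nrm_ge0.
- exact: aD.
Qed.

End Density.

Section GroupUnitaries.
Variables (R : realType) (L : topologicalGroupType) (M : set L).
Variables (mu : {measure set (borel L) -> \bar R}) (Delta : L -> R).
Hypotheses (hM : is_subgroup M) (hMo : open M) (hmuM : mu M = 1%E).
Hypothesis hDelta : is_modular_function mu Delta.
Variables (B : cstarAlgType R) (j : (L -> R[i]) -> B).
Hypothesis hB : is_group_cstar mu Delta j.
Variable lambda : L -> multiplier B.
Hypothesis hlambda : is_lambda j lambda.

(** On the image of [Cc] this is invariance of the convolution. Boundedness of [mult_l (lambda k)]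
    is only a consequence, so density is not applied to it directly: [mult_compat] and the
    involution leave an equality of two elements, tested by right multiplication with a dense
    set. *)
Lemma lambda_unitary k a b : M k ->
  star (mult_l (lambda k) a) ** mult_l (lambda k) b = star a ** b.
Proof.
move=> Mk; have dense := gcs_dense hB.
have onD f g : Cc R L f -> Cc R L g ->
    star (mult_l (lambda k) (j f)) ** mult_l (lambda k) (j g) =
    star (j f) ** j g.
  move=> Cf Cg; have Ckf := Cc_translate k Cf; have Ckg := Cc_translate k Cg.
  have CsC := Cc_star_Cc hM hMo hmuM hDelta.
  rewrite !hlambda // -!(gcs_star hB) // -!(gcs_mul hB) //; [|exact: CsC..].
  by rewrite (convolution_translate hM hMo hmuM hDelta).
have half f c : Cc R L f ->
    star (mult_l (lambda k) (j f)) ** mult_l (lambda k) c = star (j f) ** c.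
  move=> Cf; rewrite mult_compat; congr (_ ** _).
  apply/eqP; rewrite -subr_eq0; apply/eqP/(dense_inj0 dense) => _ [g Cg <-].
  by rewrite cmulBl -mult_compat onD // subrr.
rewrite mult_compat; congr (_ ** _).
apply/eqP; rewrite -subr_eq0; apply/eqP/(dense_inj0 dense) => _ [g Cg <-].
rewrite cmulBl -mult_compat -[X in X - _]starK starM starK half //.
by rewrite starM starK subrr.
Qed.

Lemma nrm_lambda k a : M k -> nrm (mult_l (lambda k) a) = nrm a.
Proof.
move=> Mk; apply/eqP; rewrite -(eqrXn2 (n := 2)) ?nrm_ge0 //.
by rewrite -!nrm_cstar lambda_unitary.
Qed.

Lemma lambdaM h k a : M h -> M k ->
  mult_l (lambda h) (mult_l (lambda k) a) = mult_l (lambda (h * k)%g) a.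
Proof.
move=> Mh Mk; have Mhk := subgroupM hM Mh Mk.
apply: (@dense_eq _ _ _ (gcs_dense hB)
  (mult_l (lambda h) \o mult_l (lambda k)) (mult_l (lambda (h * k)%g)) 1).
- by move=> z b c; rewrite /= !mult_l_linear.
- exact: mult_l_linear.
- by move=> b; rewrite /= !nrm_lambda // mul1r.
- by move=> b; rewrite /= !nrm_lambda // mul1r.
move=> _ [f Cf <-] /=; rewrite !hlambda //; last exact: Cc_translate.
by congr j; apply/funext => x; rewrite invgM mulgA.
Qed.

End GroupUnitaries.

(** * Matrix units and Burnside's theorem *)

Section DotProduct.
Local Open Scope ring_scope.
Variables (C : numClosedFieldType) (V : vectType C).
Variable dot : {dot V for Num.conj}.
Implicit Types (u v w : V).

Lemma dotC u v : dot u v = (dot v u)^*.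
Proof. by rewrite hermC expr0 mul1r. Qed.

Lemma dot_gt0 u : u != 0 -> 0 < dot u u.
Proof. exact: neq0_dnorm_gt0. Qed.

Lemma dotDl u v w : dot (u + v) w = dot u w + dot v w.
Proof. exact: linearDl. Qed.

Lemma dotZl a u v : dot (a *: u) v = a * dot u v.
Proof. exact: linearZl_LR. Qed.

Lemma dotZr a u v : dot u (a *: v) = a^* * dot u v.
Proof. by rewrite dotC dotZl rmorphM [dot u v]dotC. Qed.

Lemma dotDr u v w : dot u (v + w) = dot u v + dot u w.
Proof. by rewrite dotC dotDl rmorphD [dot u v]dotC [dot u w]dotC. Qed.

Lemma dot_linear w : linear (dot ^~ w : V -> C^o).
Proof. by move=> z u v; rewrite dotDl dotZl. Qed.

Lemma dot_suml w I (r : seq I) (P : pred I) (F : I -> V) :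
  dot (\sum_(i <- r | P i) F i) w = \sum_(i <- r | P i) dot (F i) w.
Proof. exact: (lf_sum (@dot_linear w)). Qed.

Lemma dot_eq v w : (forall u, dot u v = dot u w) -> v = w.
Proof.
move=> E; apply/eqP; rewrite -subr_eq0; apply/negPn/negP => /dot_gt0.
have dB u : dot u (v - w) = 0.
  by rewrite -scaleN1r dotDr dotZr E rmorphN1 mulN1r subrr.
by rewrite dB ltxx.
Qed.

(** An orthonormal list of maximal length: a nonzero residual [w], normalised, would extend it. *)
Lemma orthonormal_basis : exists (n : nat) (e : 'I_n -> V),
  (forall i k, dot (e i) (e k) = (i == k)%:R) /\
  forall v, v = \sum_i dot v (e i) *: e i.
Proof.
pose ON (s : seq V) := forall i k, (i < size s)%N -> (k < size s)%N ->
  dot s`_i s`_k = (i == k)%:R.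
have ON_free (s : seq V) : ON s -> free (in_tuple s).
  move=> sON; apply/freeP => c cs i.
  have := congr1 (dot ^~ s`_i) cs; rewrite /= dot_suml.
  rewrite (lf0 (@dot_linear _)) (bigD1 i) //= big1 => [|k ki].
    by rewrite addr0 dotZl sON // eqxx mulr1.
  by rewrite dotZl sON // (inj_eq val_inj) (negPf ki) mulr0.
pose P k := `[< exists s, size s = k /\ ON s >].
have P0 : exists k, P k by exists 0%N; apply/asboolP; exists [::].
have Pdim k : P k -> (k <= \dim {:V})%N.
  move=> /asboolP[s [<- /ON_free]]; rewrite /free /= => /eqP <-.
  exact: dimvS (subvf _).
case: (ex_maxnP P0 Pdim) => n /asboolP[s [sn sON]] nmax.
exists n, (fun i : 'I_n => s`_i); split=> [i k|v].
  by rewrite sON ?sn // (inj_eq val_inj).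
pose w := v - \sum_(i < n) dot v s`_i *: s`_i.
apply/eqP; rewrite -subr_eq0 -/w; apply/negPn/negP => w0.
have ws i : (i < n)%N -> dot w s`_i = 0.
  move=> i_n; rewrite /w -scaleN1r dotDl dotZl dot_suml.
  rewrite (bigD1 (Ordinal i_n)) //= big1 => [|k ki].
    by rewrite addr0 dotZl sON ?sn // eqxx mulr1 mulN1r subrr.
  rewrite dotZl sON ?sn // -[val _ == _]/(val k == val (Ordinal i_n)).
  by rewrite (inj_eq val_inj) (negPf ki) mulr0.
have sw i : (i < n)%N -> dot s`_i w = 0 by move=> ?; rewrite dotC ws ?rmorph0.
pose c := sqrtC (dot w w); have ww := dot_gt0 w0.
have c0 : 0 < c by rewrite sqrtC_gt0.
pose u := c^-1 *: w.
have uu : dot u u = 1.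
  rewrite dotZl dotZr geC0_conj ?invr_ge0 ?ltW //.
  rewrite mulrA -invfM -expr2 sqrtCK mulVf // gt_eqF //.
suff : (n.+1 <= n)%N by rewrite ltnn.
apply: nmax; apply/asboolP; exists (rcons s u); rewrite size_rcons sn; split=> //.
move=> i k; rewrite size_rcons !nth_rcons sn !ltnS.
rewrite leq_eqVlt => /orP[/eqP->|i_n]; rewrite leq_eqVlt => /orP[/eqP->|k_n].
- by rewrite ltnn eqxx uu.
- by rewrite ltnn eqxx k_n dotZl ws // mulr0 gtn_eqF.
- by rewrite ltnn eqxx i_n dotZr sw // mulr0 ltn_eqF.
- by rewrite i_n k_n sON ?sn.
Qed.

Definition rank1_fun v w u : V := dot u w *: v.

Fact rank1_linear v w : linear (rank1_fun v w).
Proof. by move=> z a b; rewrite /rank1_fun dotDl dotZl scalerDl scalerA. Qed.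

HB.instance Definition _ v w :=
  GRing.isLinear.Build C V V _ (rank1_fun v w) (@rank1_linear v w).

Definition rank1 v w : 'End(V) := linfun (rank1_fun v w).

Lemma rank1E v w u : rank1 v w u = dot u w *: v.
Proof. by rewrite lfunE. Qed.

Lemma rank1_comp u v w x : (rank1 u v \o rank1 w x)%VF = dot w v *: rank1 u x.
Proof.
by apply/lfunP => y; rewrite scale_lfunE comp_lfunE !rank1E dotZl scalerA mulrC.
Qed.

Lemma comp_rank1 (T : 'End(V)) u v : (T \o rank1 u v)%VF = rank1 (T u) v.
Proof. by apply/lfunP => y; rewrite comp_lfunE !rank1E linearZ. Qed.

End DotProduct.

Section Burnside.
Local Open Scope ring_scope.
Variables (C : numClosedFieldType) (V : vectType C).
Implicit Types (T S : 'End(V)) (U W : {vspace V}) (u v w : V).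

(** A subspace of maximal dimension inside [P] must contain every vector of [P]. *)
Lemma vspace_of_pred (P : V -> Prop) : P 0 ->
  (forall z u v, P u -> P v -> P (z *: u + v)) ->
  exists U : {vspace V}, forall v, (v \in U) <-> P v.
Proof.
move=> P0 PL.
pose Q k := `[< exists U : {vspace V}, \dim U = k /\ forall v, v \in U -> P v >].
have Q0 : exists k, Q k.
  exists 0%N; apply/asboolP; exists 0%VS; rewrite dimv0; split=> // v.
  by rewrite memv0 => /eqP ->.
have Qd k : Q k -> (k <= \dim {:V})%N.
  by move=> /asboolP[U [<- _]]; exact: dimvS (subvf _).
case: (ex_maxnP Q0 Qd) => n /asboolP[U [Un UP]] nmax.
exists U => v; split=> [/UP //|Pv].
have : (U <= U + <[v]>)%VS by exact: addvSl.
have /nmax le : Q (\dim (U + <[v]>)).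
  apply/asboolP; exists (U + <[v]>)%VS; split=> // _ /memv_addP[u Uu [_ /vlineP[z ->] ->]].
  by rewrite addrC; apply: PL => //; exact: UP.
move=> sub; have /eqP -> : U == (U + <[v]>)%VS by rewrite eqEdim sub Un.
exact: (subvP (addvSr _ _)) (memv_line v).
Qed.

Lemma eigenvector_in (f : 'End(V)) U : U != 0%VS -> (f @: U <= U)%VS ->
  exists a u, [/\ u \in U, u != 0 & f u = a *: u].
Proof.
move=> U0 fU; set n := \dim U; have n0 : (0 < n)%N by rewrite lt0n dimv_eq0.
pose X := vbasis U; have XU i : (i < n)%N -> X`_i \in U.
  by move=> i_n; apply: vbasis_mem; apply: mem_nth; rewrite size_tuple.
pose Mx : 'M[C]_n := \matrix_(i, j) coord X j (f X`_i).
have [a /eigenvalueP[x xM x0]] := eigenvalue_closed Mx n0.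
exists a, (\sum_i x 0 i *: X`_i); split.
- by apply: memv_suml => i _; apply: memvZ; apply: XU.
- apply: contra_neq x0 => x0; apply/rowP => i; rewrite mxE.
  have /freeP fr := basis_free (vbasisP U).
  exact: (fr (fun i => x 0 i) x0).
rewrite linear_sum scaler_sumr /=.
transitivity (\sum_i \sum_j (x 0 i * Mx i j) *: X`_j).
  apply: eq_bigr => i _; rewrite linearZ /= [f _](coord_vbasis (U := U)).
    by rewrite scaler_sumr; apply: eq_bigr => j _; rewrite scalerA mxE.
  by apply: (subvP fU); apply: memv_img; apply: XU.
rewrite exchange_big; apply: eq_bigr => j _; rewrite -scaler_suml scalerA.
by congr (_ *: _); move/rowP : xM => /(_ j); rewrite !mxE.
Qed.

Variables (I : Type) (D : I -> Prop) (sigma : I -> 'End(V)).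

Inductive in_span : 'End(V) -> Prop :=
| in_span0 : in_span 0
| in_spanD z k T : D k -> in_span T -> in_span (z *: sigma k + T).

Lemma in_span_add S T : in_span S -> in_span T -> in_span (S + T).
Proof.
move=> + inT; elim=> [|z k {}S Dk _ IH]; first by rewrite add0r.
by rewrite -addrA; exact: in_spanD.
Qed.

Lemma in_span_scale z T : in_span T -> in_span (z *: T).
Proof.
elim=> [|y k {}T Dk _ IH]; first by rewrite scaler0; exact: in_span0.
by rewrite scalerDr scalerA; exact: in_spanD.
Qed.

Lemma in_span_mem k : D k -> in_span (sigma k).
Proof.
move=> Dk; rewrite -[sigma k]addr0 -[sigma k]scale1r.
by apply: in_spanD => //; exact: in_span0.
Qed.

Hypothesis sigmaM : forall h k, D h -> D k ->
  exists2 l, D l & (sigma h \o sigma k)%VF = sigma l.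

Lemma in_span_comp S T : in_span S -> in_span T -> in_span (S \o T)%VF.
Proof.
move=> inS inT; elim: inS => [|z h {}S Dh _ IH].
  by rewrite comp_lfun0l; exact: in_span0.
rewrite comp_lfunDl -comp_lfunZl; apply: in_span_add => //.
apply: in_span_scale; elim: inT {IH} => [|y k {}T Dk _ IHT].
  by rewrite comp_lfun0r; exact: in_span0.
rewrite comp_lfunDr -comp_lfunZr; apply: in_span_add => //.
by apply: in_span_scale; have [l Dl ->] := sigmaM Dh Dk; exact: in_span_mem.
Qed.

Variable dot : {dot V for Num.conj}.
Hypothesis sigmaV : forall k, D k -> exists2 l, D l &
  forall v w, dot (sigma k v) w = dot v (sigma l w).

Lemma in_span_adjoint T : in_span T -> exists2 T', in_span T' &
  forall v w, dot (T v) w = dot v (T' w).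
Proof.
elim=> [|z k {}T Dk _ [T' inT' adjT]].
  exists 0 => [|v w]; first exact: in_span0.
  by rewrite !lfunE /= (lf0 (dot_linear dot w)) dotC (lf0 (dot_linear dot v)) rmorph0.
have [l Dl adj] := sigmaV Dk.
exists (Num.conj z *: sigma l + T'); first exact: in_spanD.
by move=> v w; rewrite !lfunE /= !lfunE /= dotDl dotZl adj adjT dotDr dotZr conjCK.
Qed.

Hypothesis irr : forall W,
  (forall k, D k -> (sigma k @: W <= W)%VS) -> W = 0%VS \/ W = {:V}%VS.
Variable one : I.
Hypotheses (D1 : D one) (sigma1 : sigma one = \1%VF).

Lemma in_span_transitive v w : v != 0 -> exists2 T, in_span T & T v = w.
Proof.
move=> v0; pose P u := exists2 T, in_span T & T v = u.
have [||U UP] := @vspace_of_pred P.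
- by exists 0; [exact: in_span0 | rewrite lfunE].
- move=> z _ _ [S inS <-] [T inT <-]; exists (z *: S + T).
    by apply: in_span_add => //; exact: in_span_scale.
  by rewrite !lfunE /= lfunE.
have [|U0|UT] := irr (W := U).
- move=> k Dk; apply/subvP => _ /memv_imgP[u /UP[T inT <-] ->].
  apply/UP; exists (sigma k \o T)%VF; last by rewrite comp_lfunE.
  by apply: in_span_comp => //; exact: in_span_mem.
- have : v \in U by apply/UP; exists \1%VF; rewrite ?id_lfunE // -sigma1; exact: in_span_mem.
  by rewrite U0 memv0 (negPf v0).
by apply/UP; rewrite UT memvf.
Qed.

(* Burnside's theorem, for a self-adjoint family: an element of minimal rank is
   of rank one, by transitivity and the existence of eigenvectors. *)
Theorem burnside T : in_span T.
Proof.
have [n [e [eON eE]]] := orthonormal_basis dot.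
suff key u v : in_span (rank1 dot u v).
  have -> : T = \sum_i rank1 dot (T (e i)) (e i).
    apply/lfunP => v; rewrite sum_lfunE {1}(eE v) linear_sum.
    by apply: eq_bigr => i _; rewrite linearZ rank1E.
  by elim/big_ind: _ => [|? ?|? _]; [exact: in_span0 | exact: in_span_add |].
have [->|v0] := eqVneq v 0.
  rewrite (_ : rank1 dot u 0 = 0); first exact: in_span0.
  apply/lfunP => w; rewrite rank1E dotC (lf0 (dot_linear dot w)) rmorph0.
  by rewrite scale0r lfunE.
have id0 : (\1%VF : 'End(V)) != 0.
  by apply: contra_neq v0 => /lfunP/(_ v); rewrite id_lfunE lfunE.
pose Q k := `[< exists T, [/\ in_span T, T != 0 & \dim (limg T) = k] >].
have Q0 : exists k, Q k.
  exists (\dim (limg (\1%VF : 'End(V)))); apply/asboolP; exists \1%VF; split=> //.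
  by rewrite -sigma1; exact: in_span_mem.
case: (ex_minnP Q0) => r /asboolP[S [inS S0 Sr]] rmin.
have [x Sx0] : exists x, S x != 0.
  apply: contrapT => H; move/eqP : S0; apply; apply/lfunP => w.
  by rewrite lfunE; apply/eqP/negPn/negP => Sw; apply: H; exists w.
have Sline w : exists z, S w = z *: S x.
  (* If [w] violates the claim, choose [B] in the span with [B (S x) = w]. Then [F = S B] preserves
     the image of [S] and has an eigenvector there, so [(F - a) S] has smaller rank; it is nonzero
     because [S w] is not [a *: S x]. *)
  apply: contrapT => H.
  have [B inB BSx] := in_span_transitive w Sx0.
  pose F := (S \o B)%VF.
  have FU : (F @: limg S <= limg S)%VS.
    by rewrite limg_comp; apply: limgS; exact: subvf.
  have U0 : limg S != 0%VS.
    apply: contra_neq Sx0 => U0; apply/eqP; rewrite -memv0 -U0.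
    exact: memv_img (memvf x).
  have [a [y [yU y0 Fy]]] := eigenvector_in U0 FU.
  pose G := (F - a *: \1)%VF; pose S' := (G \o S)%VF.
  have inS' : in_span S'.
    apply: in_span_comp => //; apply: in_span_add; first exact: in_span_comp.
    rewrite -scaleN1r; do 2! apply: in_span_scale.
    by rewrite -sigma1; exact: in_span_mem.
  have S'0 : S' != 0.
    apply/eqP => /lfunP/(_ x); rewrite !lfunE /= !lfunE /= !lfunE /= !lfunE /=.
    rewrite lfunE /= BSx => /eqP; rewrite subr_eq0 => /eqP E.
    by apply: H; exists a.
  have := rmin (\dim (limg S')) _; rewrite leqNgt => /(_ _)/negP; apply.
    by apply/asboolP; exists S'.
  rewrite limg_comp -Sr -(limg_ker_dim G (limg S)) -[X in (X < _)%N]add0n.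
  rewrite ltn_add2r lt0n dimv_eq0; apply: contra_neq y0 => E.
  apply/eqP; rewrite -memv0 -E memv_cap yU memv_ker.
  by rewrite !lfunE /= !lfunE /= !lfunE /= lfunE /= -[S (B y)]comp_lfunE Fy subrr.
(* [S] is now of rank one, [rank1 y Z] up to a scalar. Transitivity moves [y] anywhere, the adjoint
   exchanges the two vectors, and a product through [Z] gives all [rank1 u v]. *)
have [S' inS' adjS] := in_span_adjoint inS.
pose y := S x; pose Z := S' y; have yy := dot_gt0 dot Sx0.
have SE w : S w = ((dot y y)^-1 * dot w Z) *: y.
  have [z Sw] := Sline w; rewrite /Z -adjS Sw dotZl mulrCA mulVf ?mulr1 //.
  by rewrite gt_eqF.
have Z0 : Z != 0.
  apply: contra_neq Sx0 => Z0; rewrite SE Z0 [dot x 0]dotC (lf0 (dot_linear dot x)).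
  by rewrite rmorph0 mulr0 scale0r.
have inZ w : in_span (rank1 dot w Z).
  have [B inB Byw] := in_span_transitive w Sx0.
  have -> : rank1 dot w Z = (B \o (dot y y *: S))%VF.
    apply/lfunP => a; rewrite comp_lfunE scale_lfunE rank1E SE scalerA mulrA.
    by rewrite mulfV ?mul1r ?linearZ /= ?Byw // gt_eqF.
  by apply: in_span_comp => //; exact: in_span_scale.
have inZ' w : in_span (rank1 dot Z w).
  have [T' inT' adjT] := in_span_adjoint (inZ w).
  have -> // : rank1 dot Z w = T'.
  apply/lfunP => b; apply: (dot_eq (dot := dot)) => a.
  by rewrite -adjT !rank1E dotZl dotZr -dotC mulrC.
have -> : rank1 dot u v =
    (((dot Z Z)^-1 *: rank1 dot u Z) \o rank1 dot Z v)%VF.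
  rewrite -comp_lfunZl rank1_comp scalerA mulVf ?scale1r // gt_eqF //.
  exact: dot_gt0.
by apply: in_span_comp => //; exact: in_span_scale.
Qed.

End Burnside.

Section Trace.
Variables (R : realType) (V : vectType R[i]).
Implicit Types S T : 'End(V).

Lemma lfun_trace_linear : linear (@lfun_trace R V : 'End(V) -> R[i]^o).
Proof. by move=> z S T; rewrite /lfun_trace passmx.mxof_linear linearP. Qed.

Lemma lfun_traceC S T : lfun_trace (S \o T)%VF = lfun_trace (T \o S)%VF.
Proof.
by rewrite /lfun_trace !(passmx.mxof_comp _ _ (vbasisP _)) mxtrace_mulC.
Qed.

Lemma lfun_trace_id : lfun_trace (\1%VF : 'End(V)) = (\dim {:V})%:R.
Proof.
by rewrite /lfun_trace passmx.mxof1 ?mxtrace1 //; exact: basis_free (vbasisP _).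
Qed.

Variable dot : {dot V for Num.conj}.
Variables (n : nat) (e : 'I_n -> V).
Hypotheses (eON : forall i k, dot (e i) (e k) = (i == k)%:R)
  (eE : forall v, v = \sum_i dot v (e i) *: e i).

Definition munit i k := rank1 dot (e i) (e k).

Lemma munit_comp i k h l :
  (munit i k \o munit h l)%VF = (k == h)%:R *: munit i l.
Proof. by rewrite rank1_comp eON eq_sym. Qed.

Lemma munit_sum T : T = \sum_i \sum_k dot (T (e k)) (e i) *: munit i k.
Proof.
rewrite exchange_big; apply/lfunP => v; rewrite sum_lfunE {1}(eE v) linear_sum.
apply: eq_bigr => k _; rewrite sum_lfunE linearZ /= [in LHS](eE (T (e k))) scaler_sumr.
by apply: eq_bigr => i _; rewrite scale_lfunE rank1E !scalerA mulrC.
Qed.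

Lemma sum_munit : \1%VF = \sum_i munit i i :> 'End(V).
Proof.
apply/lfunP => v; rewrite id_lfunE sum_lfunE {1}(eE v).
by apply: eq_bigr => i _; rewrite rank1E.
Qed.

Lemma munit_adjoint i k v w : dot (munit i k v) w = dot v (munit k i w).
Proof. by rewrite !rank1E dotZl dotZr -dotC mulrC. Qed.

(** The trace is computed in [vbasis], not in [e], so its values on matrix units are found from
    [Tr (S T) = Tr (T S)]. A common nonzero value on the diagonal suffices, since [psi] matters up
    to a scalar. *)
Lemma lfun_trace_munit : (0 < \dim {:V})%N ->
  exists2 c : R[i], c != 0 & forall i k, lfun_trace (munit i k) = c *+ (i == k).
Proof.
move=> V0; have tL := lfun_trace_linear.
have [i0] : exists i0 : 'I_n, True.
  apply: contrapT => H; have : lfun_trace (\1%VF : 'End(V)) = 0.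
    rewrite sum_munit big1 ?(lf0 tL) // => i; by case: H; exists i.
  by rewrite lfun_trace_id => /eqP; rewrite pnatr_eq0 -leqn0 leqNgt V0.
have t_diag i h : lfun_trace (munit i i) = lfun_trace (munit h h).
  have -> : munit i i = (munit i h \o munit h i)%VF.
    by rewrite munit_comp eqxx scale1r.
  by rewrite lfun_traceC munit_comp eqxx scale1r.
have t_off i k : i != k -> lfun_trace (munit i k) = 0.
  move=> ik; have -> : munit i k = (munit i i \o munit i k)%VF.
    by rewrite munit_comp eqxx scale1r.
  by rewrite lfun_traceC munit_comp eq_sym (negPf ik) scale0r (lf0 tL).
exists (lfun_trace (munit i0 i0)) => [|i k]; last first.
  by have [<-|ik] := eqVneq i k; [exact: t_diag | exact: t_off].
apply/eqP => c0; have : lfun_trace (\1%VF : 'End(V)) = 0.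
  by rewrite sum_munit (lf_sum tL) big1 // => i _; rewrite (t_diag i i0).
by rewrite lfun_trace_id => /eqP; rewrite pnatr_eq0 -leqn0 leqNgt V0.
Qed.

End Trace.

(** * Matrix coordinates in the tensor product *)

Section TensorCoordinates.
Variables (R : realType) (B : cstarAlgType R) (V : vectType R[i]).
Variables (dot : {dot V for Num.conj}) (A : cstarAlgType R).
Variables (t : B -> 'End(V) -> A) (hA : is_cstar_tensor dot t).
Variables (n : nat) (e : 'I_n -> V).
Hypotheses (eON : forall i k, dot (e i) (e k) = (i == k)%:R)
  (eE : forall v, v = \sum_i dot v (e i) *: e i).
Implicit Types (a : A) (b c : B) (i k : 'I_n).

Local Notation E := (munit dot e).

Let tl S : linear (t ^~ S) := tensor_linearl hA S.
Let tr b : linear (t b) := tensor_linearr hA b.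

Lemma tensor_munitM b c i k h l :
  t b (E i k) ** t c (E h l) = if k == h then t (b ** c) (E i l) else 0.
Proof.
rewrite (tensorM hA) (munit_comp eON); case: eqP => _; first by rewrite scale1r.
by rewrite scale0r (lf0 (tr _)).
Qed.

Lemma tensor_munit_star b i k : star (t b (E i k)) = t (star b) (E k i).
Proof. by apply: (tensor_star hA) => v w; exact: munit_adjoint. Qed.

Lemma munit_neq0 i k : E i k != 0.
Proof.
apply/eqP => E0; have := congr1 (fun S : 'End(V) => dot (S (e k)) (e i)) E0.
rewrite rank1E dotZl !eON !eqxx mulr1 lfunE (lf0 (dot_linear dot _)).
by move/eqP; rewrite oner_eq0.
Qed.

Lemma tensor_munit_inj i k b : t b (E i k) = 0 -> b = 0.
Proof.
move=> b0; have fE : free [tuple E i k] by rewrite seq1_free munit_neq0.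
apply: (tensor_inj hA (b := fun=> b) fE _ ord0).
by rewrite big_ord1.
Qed.

(** On the diagonal, [b (x) E_kk] is an injective *-morphism in [b], hence isometric; the
    C*-identity reduces the other entries to this case. *)
Lemma nrm_tensor_munit b i k : nrm (t b (E i k)) = nrm b.
Proof.
have diag c : nrm (t c (E k k)) = nrm c.
  apply: (@star_morphism_isometry _ _ _ (t ^~ (E k k))); last first.
    by move=> d; exact: tensor_munit_inj.
  split; first exact: tl.
  - by move=> x y; rewrite tensor_munitM eqxx.
  - by move=> x; rewrite tensor_munit_star.
apply/eqP; rewrite -(eqrXn2 (n := 2)) ?nrm_ge0 // -!nrm_cstar.
by rewrite tensor_munit_star tensor_munitM eqxx diag.
Qed.

Definition assemble (b : 'I_n -> 'I_n -> B) : A :=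
  \sum_i \sum_k t (b i k) (E i k).

Lemma assemble_sandwich (b : 'I_n -> 'I_n -> B) c c' i k :
  t c (E i i) ** assemble b ** t c' (E k k) = t (c ** b i k ** c') (E i k).
Proof.
rewrite cmul_sumr (bigD1 i) //= [X in _ + X]big1 ?addr0 => [|h hi]; last first.
  rewrite cmul_sumr big1 // => l _.
  by rewrite tensor_munitM eq_sym (negPf hi).
rewrite cmul_sumr cmul_suml (bigD1 k) //= [X in _ + X]big1 ?addr0.
  by rewrite !tensor_munitM !eqxx tensor_munitM eqxx.
move=> l lk; rewrite tensor_munitM eqxx tensor_munitM.
by rewrite (negPf lk).
Qed.

(** An entry [c] cannot be cut out by [1 (x) E_ii], so it is sandwiched between [c^*] and [c^* c]:
    this yields [|c|^4] on one side and [|c|^3] times the norm on the other. *)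
Lemma nrm_le_assemble (b : 'I_n -> 'I_n -> B) i k : nrm (b i k) <= nrm (assemble b).
Proof.
set c := b i k; have [->|c0] := eqVneq c 0; first by rewrite nrm0 nrm_ge0.
have c_gt0 := nrm_gt0 c0.
pose h := star c ** c.
have hh : nrm (star c ** c ** h) = nrm c ^+ 4.
  by rewrite -[star c ** c]/h -{1}[h]starK [star h]starM starK nrm_cstar
    nrm_cstar -exprM.
have := assemble_sandwich b (star c) h i k.
move/(congr1 (@nrm _ _)); rewrite nrm_tensor_munit -/c hh => E4.
have : nrm c ^+ 4 <= nrm c * nrm (assemble b) * nrm c ^+ 2.
  rewrite -E4; apply: le_trans (nrmM _ _) _.
  rewrite nrm_tensor_munit nrm_cstar ler_wpM2r ?sqr_ge0 //.
  by apply: le_trans (nrmM _ _) _; rewrite nrm_tensor_munit nrm_star.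
rewrite (_ : nrm c ^+ 4 = nrm c * nrm c * nrm c ^+ 2); last by ring.
by rewrite !ler_pM2r ?exprn_gt0 // ler_pM2l.
Qed.

Lemma nrm_assemble_le (b : 'I_n -> 'I_n -> B) :
  nrm (assemble b) <= \sum_i \sum_k nrm (b i k).
Proof.
apply: le_trans (nrm_sum _ _ _) _; apply: ler_sum => i _.
apply: le_trans (nrm_sum _ _ _) _; apply: ler_sum => k _.
by rewrite nrm_tensor_munit.
Qed.

Lemma assembleB (b c : 'I_n -> 'I_n -> B) :
  assemble b - assemble c = assemble (fun i k => b i k - c i k).
Proof.
rewrite /assemble -sumrB; apply: eq_bigr => i _; rewrite -sumrB.
by apply: eq_bigr => k _; rewrite (lfB (tl _)).
Qed.

Lemma tensor_assemble b S :
  t b S = assemble (fun i k => dot (S (e k)) (e i) *: b).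
Proof.
rewrite {1}(munit_sum eE S) (lf_sum (tr b)); apply: eq_bigr => i _.
rewrite (lf_sum (tr b)); apply: eq_bigr => k _.
by rewrite (lfZ (tr b)) (lfZ (tl _)).
Qed.

(** Matrices are dense by definition of the tensor product, and their norm is equivalent to that of
    the entries, so entries of approximating matrices form Cauchy sequences in [B]. *)
Lemma assemble_surj a : exists F, a = assemble F.
Proof.
have dense (r : R) : 0 < r -> exists F, nrm (a - assemble F) < r.
  move=> r0; have : closed_span [set x | exists b T, x = t b T] a.
    by rewrite (tensor_dense hA).
  move/closureP => /(_ _ r0)[_ [m [z [s [sT ->]]]] lt_r].
  have [b bE] : exists F, \sum_(l < m) z l *: s l = assemble F; last first.
    by exists b; rewrite -bE.
  elim/big_ind: _ => [|_ _ [b ->] [c ->]|l _].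
  - exists (fun _ _ => 0); rewrite /assemble big1 // => i _.
    by rewrite big1 // => k _; rewrite (lf0 (tl _)).
  - exists (fun i k => b i k + c i k); rewrite /assemble -big_split.
    apply: eq_bigr => i _; rewrite -big_split; apply: eq_bigr => k _.
    by rewrite (lfD (tl _)).
  - have [b [T ->]] := sT l; exists (fun i k => dot (T (e k)) (e i) *: (z l *: b)).
    by rewrite -tensor_assemble (lfZ (tl _)).
have [ep [ep0 ep_lt ep_le]] : exists ep : nat -> R, [/\ forall m, 0 < ep m,
    forall r : R, 0 < r -> exists m, ep m < r &
    forall m l, (m <= l)%N -> ep l <= ep m].
  exists (fun m => m.+1%:R^-1); split=> [m|r r0|m l ml].
  - by rewrite invr_gt0 ltr0n.
  - exists (Num.truncn r^-1).
    by rewrite -[ltRHS]invrK ltf_pV2 ?posrE ?invr_gt0 ?ltr0n // truncnS_gt.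
  - by rewrite lef_pV2 ?posrE ?ltr0n // ler_nat ltnS.
have [u uE] := choice (fun m => dense _ (ep0 m)).
have uu m l i k : nrm (u m i k - u l i k) <= ep m + ep l.
  apply: le_trans (nrm_le_assemble (fun i k => u m i k - u l i k) i k) _.
  rewrite -assembleB -(subrK a (assemble (u m))) -addrA.
  apply: le_trans (nrmD _ _) _; apply: lerD; last exact: ltW.
  by rewrite nrm_dist ltW.
have cv i k : exists l, forall r : R, 0 < r -> exists N : nat, forall m : nat,
    (N <= m)%N -> nrm (u m i k - l) < r.
  apply: nrm_complete => r r0; have r2 : 0 < r / 2 by rewrite divr_gt0.
  have [N rN] := ep_lt _ r2.
  exists N => m l Nm Nl; apply: le_lt_trans (uu _ _ _ _) _.
  have := ep_le _ _ Nm; have := ep_le _ _ Nl; lra.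
have [b bE] := choice (fun ik : 'I_n * 'I_n => cv ik.1 ik.2).
have ub m i k : nrm (u m i k - b (i, k)) <= ep m.
  rewrite -subr_le0; apply: (@eq0_le_eps _ _ 2) => r r0.
  have [N NE] := bE (i, k) _ r0; have [N' rN'] := ep_lt _ r0.
  pose l := maxn N N'.
  have := NE l (leq_maxl _ _) => /= /ltW h1; have h2 := uu m l i k.
  have h3 := ep_le _ _ (leq_maxr N N' : (N' <= l)%N).
  have := nrmD (u m i k - u l i k) (u l i k - b (i, k)); rewrite addrA subrK.
  lra.
exists (fun i k => b (i, k)).
apply/eqP; rewrite -subr_eq0; apply/eqP/nrm_eq0/eqP; rewrite eq_le nrm_ge0 andbT.
apply: (@eq0_le_eps _ _ (1 + \sum_(i < n) \sum_(k < n) 1)) => r r0.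
have [m rm] := ep_lt _ r0.
rewrite -(subrK (assemble (u m)) a) -addrA assembleB.
apply: le_trans (nrmD _ _) _; rewrite mulrDr mulr1 lerD //.
  by apply: ltW; apply: lt_trans (uE m) rm.
apply: le_trans (nrm_assemble_le _) _; rewrite mulr_sumr; apply: ler_sum => i _.
rewrite mulr_sumr; apply: ler_sum => k _; rewrite mulr1.
by apply: le_trans (ub _ _ _) _; exact: ltW.
Qed.

Definition coord_fun a : 'I_n -> 'I_n -> B := sval (cid (assemble_surj a)).

Definition tcoord i k a : B := coord_fun a i k.

Lemma tcoordE a : a = \sum_i \sum_k t (tcoord i k a) (E i k).
Proof. exact: svalP (cid (assemble_surj a)). Qed.

Lemma tcoord_uniq (b : 'I_n -> 'I_n -> B) a :
  a = assemble b -> forall i k, tcoord i k a = b i k.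
Proof.
move=> ab i k; apply/eqP; rewrite -subr_eq0; apply/eqP/nrm_eq0/eqP.
rewrite eq_le nrm_ge0 andbT.
apply: le_trans (nrm_le_assemble (fun i k => tcoord i k a - b i k) i k) _.
by rewrite -assembleB -[X in X - _]tcoordE -ab subrr nrm0.
Qed.

Lemma tcoord_linear i k : linear (tcoord i k).
Proof.
move=> z x y; apply: (tcoord_uniq (b := fun i k => z *: tcoord i k x + tcoord i k y)).
rewrite {1}(tcoordE x) {1}(tcoordE y) scaler_sumr -big_split.
apply: eq_bigr => h _; rewrite scaler_sumr -big_split; apply: eq_bigr => l _.
by rewrite /= tl.
Qed.

Lemma nrm_tcoord i k a : nrm (tcoord i k a) <= nrm a.
Proof. by rewrite [in leRHS](tcoordE a); exact: (nrm_le_assemble (fun i k => _)). Qed.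

Lemma tcoord_tensor i k b S : tcoord i k (t b S) = dot (S (e k)) (e i) *: b.
Proof.
by apply: (tcoord_uniq (b := fun i k => dot (S (e k)) (e i) *: b));
  exact: tensor_assemble.
Qed.

Lemma tcoord_munit i k h l b :
  tcoord i k (t b (E h l)) = if (i == h) && (k == l) then b else 0.
Proof.
rewrite tcoord_tensor rank1E dotZl !eON -natrM mulnb andbC eq_sym.
by case: andP => _; rewrite ?scale1r ?scale0r.
Qed.

Lemma tensor_ind (P : A -> Prop) : P 0 -> (forall x y, P x -> P y -> P (x + y)) ->
  (forall b i k, P (t b (E i k))) -> forall a, P a.
Proof.
move=> P0 PD PE a; rewrite (tcoordE a).
by elim/big_ind: _ => // i _; elim/big_ind: _.
Qed.

Lemma tcoordM i k x y : tcoord i k (x ** y) = \sum_l tcoord i l x ** tcoord l k y.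
Proof.
have cD h l := lfD (tcoord_linear h l).
move: x; apply: tensor_ind => [|x1 x2 h1 h2|b h l].
- rewrite cmul0l (lf0 (tcoord_linear _ _)) big1 // => l _.
  by rewrite (lf0 (tcoord_linear _ _)) cmul0l.
- rewrite cmulDl cD h1 h2 -big_split; apply: eq_bigr => l _.
  by rewrite cD cmulDl.
move: y; apply: tensor_ind => [|y1 y2 h1 h2|c h' l'].
- rewrite cmul0r (lf0 (tcoord_linear _ _)) big1 // => m _.
  by rewrite (lf0 (tcoord_linear _ _)) cmul0r.
- rewrite cmulDr cD h1 h2 -big_split; apply: eq_bigr => m _.
  by rewrite cD cmulDr.
rewrite tensor_munitM (bigD1 l) //= [X in _ + X]big1 ?addr0 => [|m ml]; last first.
  by rewrite tcoord_munit (negPf ml) andbF cmul0l.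
rewrite !tcoord_munit eqxx andbT; case: (l == h') => /=; last first.
  by rewrite cmul0r (lf0 (tcoord_linear _ _)).
rewrite tcoord_munit; case: (i == h) => /=; last by rewrite cmul0l.
by case: (k == l') => //; rewrite cmul0r.
Qed.

Lemma tcoord_star i k a : tcoord i k (star a) = star (tcoord k i a).
Proof.
move: a; apply: tensor_ind => [|x y hx hy|b h l].
- by rewrite star0 !(lf0 (tcoord_linear _ _)) star0.
- by rewrite starD !(lfD (tcoord_linear _ _)) starD hx hy.
rewrite tensor_munit_star !tcoord_munit andbC.
by case: andP => // _; rewrite star0.
Qed.

End TensorCoordinates.

(** * Linear spans and their closures *)

Section LinearSpan.
Variables (R : realType) (W : lmodType R[i]) (S : set W).

Lemma lspan_mem x : S x -> lspan S x.
Proof.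
move=> Sx; exists 1%N, (fun=> 1), (fun=> x); split=> //.
by rewrite big_ord1 scale1r.
Qed.

Lemma lspan_linear z x y : lspan S x -> lspan S y -> lspan S (z *: x + y).
Proof.
move=> [n [c [s [Ss ->]]]] [m [d [r [Sr ->]]]].
exists (n + m)%N,
  (fun i => match fintype.split i with inl l => z * c l | inr l => d l end),
  (fun i => match fintype.split i with inl l => s l | inr l => r l end).
split=> [i|]; first by case: (fintype.split i) => l.
rewrite big_split_ord scaler_sumr; congr (_ + _); apply: eq_bigr => i _ /=.
  by rewrite (unsplitK (inl i)) scalerA.
by rewrite (unsplitK (inr i)).
Qed.

Lemma lspan0 : lspan S 0.
Proof.
exists 0%N, (fun=> 0), (fun=> 0); split; first by case.
by rewrite big_ord0.
Qed.

Lemma lspanD x y : lspan S x -> lspan S y -> lspan S (x + y).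
Proof. by move=> Sx Sy; rewrite -[x]scale1r; exact: lspan_linear. Qed.

Lemma lspanZ z x : lspan S x -> lspan S (z *: x).
Proof. by move=> Sx; rewrite -[_ *: _]addr0; apply: lspan_linear => //; exact: lspan0. Qed.

Lemma lspan_sum I (r : seq I) (P : pred I) (F : I -> W) :
  (forall i, P i -> lspan S (F i)) -> lspan S (\sum_(i <- r | P i) F i).
Proof. by apply: big_ind; [exact: lspan0 | exact: lspanD]. Qed.

Lemma lspan_sub (T : set W) : T 0 -> (forall z x y, T x -> T y -> T (z *: x + y)) ->
  S `<=` T -> lspan S `<=` T.
Proof.
move=> T0 TL ST _ [n [z [s [Ss ->]]]].
elim/big_ind: _ => // [x y Tx Ty|i _].
  by rewrite -[x]scale1r; exact: TL.
by rewrite -[_ *: _]addr0; apply: TL => //; exact: ST.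
Qed.

End LinearSpan.

Section ClosedSpan.
Variables (R : realType) (A A' : cstarAlgType R).

Lemma closure_image (f : A -> A') C (S : set A) (T : set A') : linear f ->
  (forall x, nrm (f x) <= C * nrm x) -> (forall x, S x -> closure T (f x)) ->
  forall x, closure S x -> closure T (f x).
Proof.
move=> fL fC ST x /closureP Sx; apply/closureP => r r0.
have C1 : 0 < `|C| + 1 by rewrite ltr_wpDl.
have r2 : 0 < r / 2 / (`|C| + 1) by rewrite !divr_gt0.
have [s Ss xs] := Sx _ r2; have /closureP := ST _ Ss.
move=> /(_ (r / 2))[|y Ty sy]; first by rewrite divr_gt0.
exists y => //; rewrite -(subrK (f s) (f x)) -addrA -(lfB fL).
apply: le_lt_trans (nrmD _ _) _; rewrite [ltRHS](splitr r).
apply: ler_ltD => //; apply: le_trans (fC _) _.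
apply: (@le_trans _ _ ((`|C| + 1) * nrm (x - s))).
  by rewrite ler_wpM2r ?nrm_ge0 // ler_wpDr // ler_norm.
by rewrite mulrC -ler_pdivlMr // ltW.
Qed.

Lemma closure_linear (S : set A) :
  (forall z x y, S x -> S y -> S (z *: x + y)) ->
  forall z x y, closure S x -> closure S y -> closure S (z *: x + y).
Proof.
move=> SL z x y /closureP Sx /closureP Sy; apply/closureP => r r0.
pose c := complex.Re `|z|; have c0 : 0 <= c.
  by rewrite -ler0c RRe_real ?normr_real.
have c1 : 0 < c + 1 by rewrite ltr_wpDl.
have [s Ss xs] := Sx _ (divr_gt0 (divr_gt0 r0 (ltr0Sn _ 1)) c1).
have [s' Ss' ys'] := Sy _ (divr_gt0 r0 (ltr0Sn _ 1)).
exists (z *: s + s'); first exact: SL.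
have -> : z *: x + y - (z *: s + s') = z *: (x - s) + (y - s').
  by rewrite scalerBr; abel.
apply: le_lt_trans (nrmD _ _) _; rewrite [ltRHS](splitr r) nrmZ -/c.
apply: ler_ltD => //; apply: (@le_trans _ _ ((c + 1) * nrm (x - s))).
  by rewrite ler_wpM2r ?nrm_ge0 // lerDl.
by rewrite mulrC -ler_pdivlMr // ltW.
Qed.

Lemma closed_span_closed (S : set A) : closed (closed_span S).
Proof. exact: closed_closure. Qed.

Lemma closed_span_linear (S : set A) z x y :
  closed_span S x -> closed_span S y -> closed_span S (z *: x + y).
Proof. by apply: closure_linear => *; exact: lspan_linear. Qed.

Lemma closed_span0 (S : set A) : closed_span S 0.
Proof. by apply: subset_closure; exact: lspan0. Qed.

Lemma lspan_closed_span (S : set A) : lspan S `<=` closed_span S.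
Proof. exact: subset_closure. Qed.

Lemma closed_span_sub (S T : set A) : closed T -> T 0 ->
  (forall z x y, T x -> T y -> T (z *: x + y)) -> S `<=` T -> closed_span S `<=` T.
Proof.
move=> Tc T0 TL ST; have := closure_subset (lspan_sub T0 TL ST).
by move/subset_trans; apply; exact: Tc.
Qed.

Lemma closed_span_image (f : A -> A') C (S : set A) (T : set A') : linear f ->
  (forall x, nrm (f x) <= C * nrm x) -> (forall x, S x -> lspan T (f x)) ->
  forall x, closed_span S x -> closed_span T (f x).
Proof.
move=> fL fC ST; apply: (closure_image fL fC) => x Sx.
apply: subset_closure; move: x Sx.
apply: (lspan_sub (T := [set x | lspan T (f x)])) => //=.
- by rewrite (lf0 fL); exact: lspan0.
- by move=> z x y; rewrite fL; exact: lspan_linear.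
Qed.

End ClosedSpan.

(** * The projection p and the ideal of psi *)

Section HeckeProjection.
Variables (R : realType) (L : topologicalGroupType) (M : set L).
Hypotheses (hM : is_subgroup M) (hMo : open M).
Variable mu : {measure set (borel L) -> \bar R}.
Hypotheses (hmu : is_left_haar mu) (hmuM : mu M = 1%E).
Variable Delta : L -> R.
Hypothesis hDelta : is_modular_function mu Delta.
Variables (V : vectType R[i]) (dot : {dot V for Num.conj}) (sigma : L -> 'End(V)).
Hypotheses (hsigma : unitary_rep M dot (fun k => sigma k : V -> V))
  (hirr : irreducible_rep M sigma).
Variables (B : cstarAlgType R) (j : (L -> R[i]) -> B).
Hypothesis hB : is_group_cstar mu Delta j.
Variable lambda : L -> multiplier B.
Hypothesis hlambda : is_lambda j lambda.
Variables (A : cstarAlgType R) (t : B -> 'End(V) -> A).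
Hypothesis hA : is_cstar_tensor dot t.
Variable lambda_sigma : L -> multiplier A.
Hypothesis hls : forall k, M k ->
  is_multiplier_tensor t (lambda k) (sigma k) (lambda_sigma k).
Variable p : A.
Hypothesis hp : is_strict_integral mu M lambda_sigma (mult_of p).
Variable psi : multiplier B.
Hypothesis hpsi : is_strict_integral mu M
  (fun k => mult_scale (psi_fun sigma k) (lambda k)) psi.
Variables (n : nat) (e : 'I_n -> V).
Hypotheses (eON : forall i k, dot (e i) (e k) = (i == k)%:R)
  (eE : forall v, v = \sum_i dot v (e i) *: e i).

Local Notation E := (munit dot e).
Local Notation coord := (tcoord hA eON eE).
Local Notation lam k := (mult_l (lambda k)).
Local Notation u k := (mult_l (lambda_sigma k)).

Let MM h k : M h -> M k -> M (h * k)%g. Proof. exact: (subgroupM hM). Qed.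
Let MV k : M k -> M k^-1%g. Proof. exact: (subgroupV hM). Qed.
Let M1 : M 1%g. Proof. exact: (subgroup1 hM). Qed.

Lemma sigmaM h k : M h -> M k -> sigma (h * k)%g = (sigma h \o sigma k)%VF.
Proof.
by move=> Mh Mk; apply/lfunP => v; rewrite (repM hsigma) // comp_lfunE.
Qed.

Lemma sigma1 : sigma 1%g = \1%VF.
Proof. by apply/lfunP => v; rewrite (rep1 hsigma) id_lfunE. Qed.

Lemma sigmaV k v w : M k -> dot (sigma k v) w = dot v (sigma k^-1%g w).
Proof.
move=> Mk; rewrite -(rep_dot hsigma v (sigma k^-1%g w) Mk).
by rewrite -(repM hsigma) ?mulgV ?(rep1 hsigma) //; exact: MV.
Qed.

Lemma lambda_sigmaE k b S : M k ->
  u k (t b S) = t (lam k b) (sigma k \o S)%VF.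
Proof. by move=> Mk; exact: hls. Qed.

Let lu k (b c : B) : M k -> star (lam k b) ** lam k c = star b ** c.
Proof. exact: (lambda_unitary hM hMo hmuM hDelta hB hlambda). Qed.

Lemma lambda_sigma_unitary k x y : M k -> star (u k x) ** u k y = star x ** y.
Proof.
move=> Mk; move: x; apply: (tensor_ind hA eON eE) => [|x1 x2 h1 h2|b i h].
- by rewrite (lf0 (mult_l_linear _)) star0 !cmul0l.
- by rewrite (lfD (mult_l_linear _)) !starD !cmulDl h1 h2.
move: y; apply: (tensor_ind hA eON eE) => [|y1 y2 h1 h2|c l m].
- by rewrite (lf0 (mult_l_linear _)) !cmul0r.
- by rewrite (lfD (mult_l_linear _)) !cmulDr h1 h2.
rewrite !lambda_sigmaE // (tensor_munit_star hA).
have -> : star (t (lam k b) (sigma k \o E i h)%VF) =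
    t (star (lam k b)) (E h i \o sigma k^-1%g)%VF.
  apply: (tensor_star hA) => v w.
  by rewrite !comp_lfunE sigmaV // munit_adjoint.
rewrite !(tensorM hA) lu //; congr (t _ _).
rewrite comp_lfunA -(comp_lfunA (E h i)) -sigmaM ?mulVg ?sigma1 ?comp_lfun1r //.
exact: MV.
Qed.

Lemma nrm_lambda_sigma k x : M k -> nrm (u k x) = nrm x.
Proof.
move=> Mk; apply/eqP; rewrite -(eqrXn2 (n := 2)) ?nrm_ge0 //.
by rewrite -!nrm_cstar lambda_sigma_unitary.
Qed.

Lemma lambda_sigmaM h k x : M h -> M k -> u h (u k x) = u (h * k)%g x.
Proof.
move=> Mh Mk; move: x; apply: (tensor_ind hA eON eE) => [|x y hx hy|b i l].
- by rewrite !(lf0 (mult_l_linear _)).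
- by rewrite !(lfD (mult_l_linear _)) hx hy.
rewrite !lambda_sigmaE //; last exact: MM.
rewrite (lambdaM hM hMo hmuM hDelta hB hlambda) // sigmaM //.
by rewrite comp_lfunA.
Qed.

Lemma lambda1 b : lam 1%g b = b.
Proof.
apply: (@dense_eq _ _ _ (gcs_dense hB) (lam 1%g) id 1).
- exact: mult_l_linear.
- by [].
- by move=> c; rewrite (nrm_lambda hM hMo hmuM hDelta hB hlambda) // mul1r.
- by move=> c; rewrite mul1r.
move=> _ [f Cf <-]; rewrite hlambda //; congr j.
by apply/funext => x; rewrite invg1 mul1g.
Qed.

Lemma lambda_sigma1 x : u 1%g x = x.
Proof.
move: x; apply: (tensor_ind hA eON eE) => [|x y hx hy|b i l].
- by rewrite (lf0 (mult_l_linear _)).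
- by rewrite (lfD (mult_l_linear _)) hx hy.
by rewrite lambda_sigmaE // lambda1 sigma1 comp_lfun1l.
Qed.

Lemma strict_integral (A' : cstarAlgType R) (F : L -> multiplier A')
    (P : multiplier A') (phi : A' -> R[i]) a C :
  is_strict_integral mu M F P -> linear (phi : A' -> R[i]^o) ->
  (forall x, `|phi x| <= (C * nrm x)%:C) ->
  phi (mult_l P a) = cintegral mu M (fun k => phi (mult_l (F k) a)).
Proof.
move=> hP phiL phiC.
pose Phi : {scalar A'} := HB.pack phi
  (GRing.isLinear.Build R[i] A' R[i]^o *%R phi phiL).
exact: (hP a Phi (bounded_continuous phiL phiC)).
Qed.

Lemma cintegral_translate (f : L -> R[i]) h : M h ->
  cintegral mu M (fun k => f (h * k)%g) = cintegral mu M f.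
Proof.
move=> Mh; rewrite cintegral_setT [RHS]cintegral_setT.
rewrite -[RHS](@cintegral_comp_invariant _ _ mu (fun y => (h * y)%g)
   (fun y => (h^-1 * y)%g)).
- congr (cintegral _ _ _); apply/funext => k /=.
  rewrite (_ : (h * k)%g \in M = (k \in M)) //.
  apply/idP/idP => /set_mem Mk; apply/mem_set; last exact: MM.
  by rewrite -(mulKg h k); apply: MM => //; exact: MV.
- exact: mulKg.
- exact: mulVKg.
- exact: mulg_continuousl.
- exact: mulg_continuousl.
- by move=> D mD; exact: (haar_left_inv hmu).
- by move=> D mD; exact: (haar_left_inv hmu).
Qed.

Lemma lambda_sigma_projection h : M h -> u h p = p.
Proof.
move=> Mh; apply/eqP; rewrite -subr_eq0; apply/eqP/cmul_inj0r => x.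
rewrite cmulBl -mult_lM; apply/eqP; rewrite subr_eq0; apply/eqP.
apply: scalar_separation => phi phiL [C C0 phiC].
have int_p := strict_integral x hp phiL phiC; rewrite /= in int_p.
rewrite int_p -(cintegral_translate _ Mh).
have -> : phi (u h (p ** x)) = cintegral mu M (fun k => phi (u h (u k x))).
  apply: (strict_integral (phi := phi \o u h) (C := C) x hp).
    by move=> z y w; rewrite /= mult_l_linear phiL.
  by move=> y; rewrite /= -(nrm_lambda_sigma y Mh).
rewrite cintegral_setT [RHS]cintegral_setT; congr (cintegral _ _ _).
apply/funext => k; case: ifP => // /set_mem Mk.
by rewrite lambda_sigmaM.
Qed.

(** The product of [star (p ** y)] and [p ** x] is the integral of [star (p ** y) ** u k x].
    Unitarity moves [u k] to the left factor as [u k^-1], which fixes [p]; the integrand is thus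
    constant over [M], of measure 1. *)
Lemma hecke_projection_star_mul : star p ** p = star p.
Proof.
apply/eqP; rewrite -subr_eq0; apply/eqP/cmul_inj0r => x.
apply: cmul_inj0 => y; rewrite cmulBl cmulBr; apply/eqP; rewrite subr_eq0.
apply/eqP; rewrite -cmulA !cmulA -[star y ** star p]starM -!cmulA.
apply: scalar_separation => phi phiL [C C0 phiC].
have bd c : `|phi (star (p ** y) ** c)| <= (C * nrm (p ** y) * nrm c)%:C.
  apply: le_trans (phiC _) _; rewrite lecR -mulrA ler_wpM2l //.
  by rewrite -[nrm (p ** y)]nrm_star; exact: nrmM.
have -> : phi (star (p ** y) ** (p ** x)) =
    cintegral mu M (fun k => phi (star (p ** y) ** u k x)).
  apply: (strict_integral (phi := phi \o cmul (star (p ** y))) x hp _ bd).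
  by move=> z c d; rewrite /= cmul_linearr phiL.
apply: (cintegral_cst hMo hmuM) => k Mk.
rewrite -(lambda_sigma_unitary (p ** y) _ (MV Mk)) lambda_sigmaM //; last exact: MV.
rewrite mulVg mult_lM lambda_sigma_projection; last exact: MV.
by rewrite lambda_sigma1.
Qed.

Lemma hecke_projection_star : star p = p.
Proof. by rewrite -[RHS]starK -hecke_projection_star_mul starM starK hecke_projection_star_mul. Qed.

Lemma hecke_projection_idem : p ** p = p.
Proof. by rewrite -{1}hecke_projection_star hecke_projection_star_mul hecke_projection_star. Qed.

Lemma coord_p_star i k : star (coord i k p) = coord k i p.
Proof. by rewrite -tcoord_star hecke_projection_star. Qed.

Definition trace_p : B := \sum_i coord i i p.

Lemma psiE : exists2 c : R[i], c != 0 & forall b, mult_l psi b = c *: (trace_p ** b).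
Proof.
have [dV _] := hirr.
have [c c0 trE] := lfun_trace_munit eON eE dV.
pose d : R[i] := (\dim {:V})%:R.
exists (d * c); first by rewrite mulf_neq0 // pnatr_eq0 -lt0n.
move=> b; apply: scalar_separation => phi phiL [C C0 phiC].
rewrite (strict_integral b hpsi phiL phiC).
(* [Phi] is [phi] after [id (x) d Tr]. On [lambda(k) b (x) sigma(k)] it gives the integrand of
   [psi]; on [p ** t b \1%VF] the traces of matrix units keep the diagonal of [p] only. *)
pose Phi a := phi (d *: \sum_i \sum_k lfun_trace (E i k) *: coord i k a).
have cL i k := tcoord_linear hA eON eE i k.
have PhiL : linear (Phi : A -> R[i]^o).
  move=> z x y; rewrite /Phi -phiL; congr phi.
  rewrite scalerA mulrC -scalerA -scalerDr; congr (_ *: _).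
  rewrite scaler_sumr -big_split; apply: eq_bigr => i _ /=.
  rewrite scaler_sumr -big_split; apply: eq_bigr => k _ /=.
  by rewrite cL scalerDr !scalerA mulrC.
have [C' PhiC] : exists C', forall x, `|Phi x| <= (C' * nrm x)%:C.
  exists (C * (complex.Re `|d| * \sum_i \sum_k complex.Re `|lfun_trace (E i k)|)).
  have Re0 (z : R[i]) : 0 <= complex.Re `|z|.
    by rewrite -ler0c RRe_real ?normr_real.
  move=> x; apply: le_trans (phiC _) _; rewrite lecR -mulrA ler_wpM2l //.
  rewrite nrmZ -mulrA ler_wpM2l // mulr_suml.
  apply: le_trans (nrm_sum _ _ _) _; apply: ler_sum => i _; rewrite mulr_suml.
  apply: le_trans (nrm_sum _ _ _) _; apply: ler_sum => k _.
  by rewrite nrmZ ler_wpM2l // nrm_tcoord.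
have := strict_integral (t b \1%VF) hp PhiL PhiC.
rewrite [mult_l (mult_of p) _]/=.
have Phi_t b' S : Phi (t b' S) = phi ((d * lfun_trace S) *: b').
  rewrite /Phi -scalerA; congr (phi (_ *: _)).
  rewrite [in RHS](munit_sum eE S) (lf_sum (@lfun_trace_linear _ _)) scaler_suml.
  apply: eq_bigr => i _; rewrite (lf_sum (@lfun_trace_linear _ _)) scaler_suml.
  apply: eq_bigr => k _; rewrite tcoord_tensor scalerA.
  by rewrite (lfZ (@lfun_trace_linear _ _)) mulrC.
have -> : cintegral mu M (fun k => Phi (u k (t b \1%VF))) =
    cintegral mu M (fun k => phi (mult_l (mult_scale (psi_fun sigma k) (lambda k)) b)).
  rewrite cintegral_setT [RHS]cintegral_setT; congr (cintegral _ _ _).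
  apply/funext => k; case: ifP => // /set_mem Mk.
  by rewrite lambda_sigmaE // comp_lfun1r Phi_t.
move=> <-.
rewrite /Phi -scalerA /trace_p cmul_suml; congr (phi (_ *: _)).
rewrite scaler_sumr; apply: eq_bigr => i _.
rewrite (bigD1 i) //= [X in _ + X]big1 ?addr0 => [|k ki].
  rewrite trE eqxx mulr1n tcoordM (bigD1 i) //= [X in _ + X]big1 ?addr0 => [|l li].
    by rewrite tcoord_tensor id_lfunE eON eqxx scale1r.
  by rewrite tcoord_tensor id_lfunE eON eq_sym (negPf li) scale0r cmul0r.
by rewrite trE eq_sym (negPf ki) mulr0n scale0r.
Qed.

(** One entry of [u k^-1 p = p], multiplied by [lambda k]: on the entries of [p], [lambda k] acts
    through scalars. *)
Lemma lambda_coord_p k i h : M k ->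
  lam k (coord i h p) = \sum_l dot (sigma k^-1%g (e l)) (e i) *: coord l h p.
Proof.
move=> Mk; rewrite -{1}(lambda_sigma_projection (MV Mk)).
have -> : coord i h (u k^-1%g p) =
    \sum_l dot (sigma k^-1%g (e l)) (e i) *: lam k^-1%g (coord l h p).
  have cL := tcoord_linear hA eON eE i h.
  rewrite [in LHS](tcoordE hA eON eE p) (lf_sum (mult_l_linear _)) (lf_sum cL).
  apply: eq_bigr => l _.
  rewrite (lf_sum (mult_l_linear _)) (lf_sum cL) (bigD1 h) //=.
  rewrite [X in _ + X]big1 ?addr0 => [|m mh].
    rewrite lambda_sigmaE ?tcoord_tensor; last exact: MV.
    by rewrite comp_rank1 rank1E dotZl eON eqxx mul1r.
  rewrite lambda_sigmaE ?tcoord_tensor; last exact: MV.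
  by rewrite comp_rank1 rank1E dotZl eON eq_sym (negPf mh) mul0r scale0r.
rewrite (lf_sum (mult_l_linear _)); apply: eq_bigr => l _.
rewrite (lfZ (mult_l_linear _)).
rewrite (lambdaM hM hMo hmuM hDelta hB hlambda) //; last exact: MV.
by rewrite mulgV lambda1.
Qed.

(* [slice_p T] is the partial trace of [(1 (x) T) p]. *)
Definition slice_p (T : 'End(V)) : B :=
  \sum_i \sum_k dot (T (e k)) (e i) *: coord k i p.

Lemma slice_p_linear : linear slice_p.
Proof.
move=> z S T; rewrite /slice_p scaler_sumr -big_split; apply: eq_bigr => i _ /=.
rewrite scaler_sumr -big_split; apply: eq_bigr => k _ /=.
by rewrite lfunE /= lfunE dotDl dotZl scalerDl scalerA.
Qed.

Lemma slice_p_munit i k : slice_p (E i k) = coord k i p.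
Proof.
rewrite /slice_p (bigD1 i) //= [X in _ + X]big1 ?addr0 => [|h hi].
  rewrite (bigD1 k) //= [X in _ + X]big1 ?addr0 => [|h hk].
    by rewrite rank1E dotZl !eON !eqxx mulr1 scale1r.
  by rewrite rank1E dotZl !eON (negPf hk) mul0r scale0r.
rewrite big1 // => l _.
by rewrite rank1E dotZl !eON [i == h]eq_sym (negPf hi) mulr0 scale0r.
Qed.

Lemma slice_p_sigma k : M k -> slice_p (sigma k^-1%g) = lam k trace_p.
Proof.
move=> Mk; rewrite /trace_p (lf_sum (mult_l_linear _)); apply: eq_bigr => i _.
by rewrite lambda_coord_p.
Qed.

Local Notation J0 := [set x | exists a b : B, x = a ** mult_l psi b].

(** By Burnside it suffices to treat [T = sigma k], where the slice is [lambda k^-1] applied to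
    [trace_p]. The right part of the multiplier absorbs [lambda k^-1] into [a], leaving a product of
    the form [a ** mult_l psi b]. *)
Lemma slice_p_in_span (S : 'End(V)) a b : lspan J0 (a ** slice_p S ** b).
Proof.
have [_ irr] := hirr.
have [c c0 cE] := psiE.
have sMM h k : M h -> M k -> exists2 l, M l & (sigma h \o sigma k)%VF = sigma l.
  by move=> Mh Mk; exists (h * k)%g; [exact: MM | rewrite sigmaM].
have sMV k : M k -> exists2 l, M l &
    forall v w, dot (sigma k v) w = dot v (sigma l w).
  by move=> Mk; exists k^-1%g => [|v w]; [exact: MV | exact: sigmaV].
elim: (burnside sMM sMV irr M1 sigma1 S) => [|z k T Mk _ IH].
  by rewrite (lf0 slice_p_linear) cmul0r cmul0l; exact: lspan0.
rewrite slice_p_linear cmulDr cmulDl cmulZr cmulZl; apply: lspan_linear => //.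
apply: lspan_mem; exists (c^-1 *: mult_r (lambda k^-1%g) a), b.
have -> : slice_p (sigma k) = lam k^-1%g trace_p.
  by rewrite -slice_p_sigma ?invgK //; exact: MV.
by rewrite mult_compat cE cmulZl cmulZr scalerA mulVf // scale1r cmulA.
Qed.

Lemma coord_p_in_span i k a b : lspan J0 (a ** coord i k p ** b).
Proof. by rewrite -slice_p_munit; exact: slice_p_in_span. Qed.

Lemma psi_coord : exists c, forall a b,
  a ** mult_l psi b = \sum_i c *: (a ** coord i i p ** b).
Proof.
have [c _ cE] := psiE; exists c => a b; rewrite cE cmulZr /trace_p.
rewrite -scaler_sumr cmul_suml cmul_sumr; congr (_ *: _).
by apply: eq_bigr => i _; rewrite cmulA.
Qed.

Local Notation J := (closed_span J0).

Lemma idealMl x y : J y -> J (x ** y).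
Proof.
apply: (closed_span_image (C := nrm x)); first exact: cmul_linearr.
  exact: nrmM.
by move=> _ [a [b ->]]; apply: lspan_mem; exists (x ** a), b; rewrite cmulA.
Qed.

(** Through the entries of [p]: adjoints exchange [a] and [b] and fix the diagonal entries, so
    self-adjointness of [psi] as a multiplier does not enter. *)
Lemma ideal_star x : J x -> J (star x).
Proof.
have [c cE] := psi_coord.
have SL (T : set B) : (forall z x y, T x -> T y -> T (z *: x + y)) ->
    forall z x y, T (star x) -> T (star y) -> T (star (z *: x + y)).
  by move=> TL z y w Ty Tw; rewrite starD starZ; exact: TL.
apply: (closed_span_sub (T := [set x | J (star x)])) => /=.
- move=> y /closureP cl; apply: (closedP (@closed_span_closed _ _ J0)) => r r0.
  have [s Js ys] := cl _ r0; exists (star s) => //.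
  by rewrite -starB nrm_star.
- by rewrite star0; exact: closed_span0.
- by apply: SL; exact: closed_span_linear.
move=> _ [a [b ->]]; rewrite /= cE star_sum; apply: lspan_closed_span.
apply: lspan_sum => i _; rewrite starZ; apply: lspanZ.
by rewrite !starM coord_p_star cmulA; exact: coord_p_in_span.
Qed.

Lemma ideal_subalgebra : cstar_subalgebra J.
Proof.
split.
- exact: closed_span_closed.
- exact: closed_span0.
- exact: closed_span_linear.
- by move=> x y _; exact: idealMl.
- exact: ideal_star.
Qed.

End HeckeProjection.

(** * Corners, subspaces, and completeness for an inner product *)

Section Corner.
Variables (R : realType) (A : cstarAlgType R) (p : A).
Hypotheses (pS : star p = p) (pp : p ** p = p).

Lemma cornerP a : corner p a <-> p ** a = a /\ a ** p = a.
Proof.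
split=> [[x _ <-]|[pa ap]]; last by exists a => //; rewrite pa.
by rewrite -!cmulA pp !cmulA pp.
Qed.

Lemma corner_subalgebra : cstar_subalgebra (corner p).
Proof.
split.
- move=> a /closureP cl; apply/cornerP; split; apply/eqP; rewrite -subr_eq0;
    apply/eqP/nrm_eq0/eqP; rewrite eq_le nrm_ge0 andbT;
    apply: (@eq0_le_eps _ _ (nrm p + 1)) => r r0;
    have [s /cornerP[ps sp] as_] := cl _ r0.
  + have -> : p ** a - a = p ** (a - s) - (a - s) by rewrite cmulBr ps; abel.
    apply: le_trans (nrmB _ _) _; rewrite mulrDr mulr1.
    apply: lerD; last exact: ltW.
    by rewrite (le_trans (nrmM _ _)) // mulrC ler_wpM2r ?nrm_ge0 // ltW.
  + have -> : a ** p - a = (a - s) ** p - (a - s) by rewrite cmulBl sp; abel.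
    apply: le_trans (nrmB _ _) _; rewrite mulrDr mulr1.
    apply: lerD; last exact: ltW.
    by rewrite (le_trans (nrmM _ _)) // ler_wpM2r ?nrm_ge0 // ltW.
- by apply/cornerP; rewrite cmul0l cmul0r.
- move=> z a b /cornerP[pa ap] /cornerP[pb bp]; apply/cornerP.
  by rewrite cmulDl cmulDr cmulZl cmulZr pa ap pb bp.
- move=> a b /cornerP[pa ap] /cornerP[pb bp]; apply/cornerP.
  by rewrite cmulA pa -cmulA bp.
- move=> a /cornerP[pa ap]; apply/cornerP.
  by rewrite -{1 2}pS -!starM ap pa.
Qed.

End Corner.

Section Submodule.
Variables (K : pzRingType) (W : lmodType K) (P : W -> Prop).

(** The closure properties are parameters of the type so that the module structure can be attached
    to it canonically. *)
Definition submod (P0 : P 0)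
  (PL : forall z a b, P a -> P b -> P (z *: a + b)) : Type := {x : W | `[< P x >]}.

Variables (P0 : P 0) (PL : forall z a b, P a -> P b -> P (z *: a + b)).
Local Notation X := (submod P0 PL).

HB.instance Definition _ := Choice.on X.

Definition submod_mk (x : W) (Px : P x) : X := exist _ x (asboolT Px).

Lemma submod_P (x : X) : P (sval x).
Proof. exact/asboolP/(svalP x). Qed.

Lemma submod_inj (x y : X) : sval x = sval y -> x = y.
Proof. by move=> xy; apply: val_inj. Qed.

Let PD a b : P a -> P b -> P (a + b).
Proof. by move=> Pa Pb; rewrite -[a]scale1r; exact: PL. Qed.
Let PZ z a : P a -> P (z *: a).
Proof. by move=> Pa; rewrite -[_ *: _]addr0; exact: PL. Qed.

Let PN a : P a -> P (- a).
Proof. by rewrite -scaleN1r; exact: PZ. Qed.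

Definition submod_zero : X := submod_mk P0.
Definition submod_add (x y : X) : X := submod_mk (PD (submod_P x) (submod_P y)).
Definition submod_opp (x : X) : X := submod_mk (PN (submod_P x)).
Definition submod_scale z (x : X) : X := submod_mk (PZ z (submod_P x)).

Fact submod_addA : associative submod_add.
Proof. by move=> x y z; apply: submod_inj; exact: addrA. Qed.
Fact submod_addC : commutative submod_add.
Proof. by move=> x y; apply: submod_inj; exact: addrC. Qed.
Fact submod_add0 : left_id submod_zero submod_add.
Proof. by move=> x; apply: submod_inj; exact: add0r. Qed.
Fact submod_addN : left_inverse submod_zero submod_opp submod_add.
Proof. by move=> x; apply: submod_inj; exact: addNr. Qed.

HB.instance Definition _ := GRing.isZmodule.Build X
  submod_addA submod_addC submod_add0 submod_addN.

Fact submod_scaleA a b x :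
  submod_scale a (submod_scale b x) = submod_scale (a * b) x.
Proof. by apply: submod_inj; exact: scalerA. Qed.
Fact submod_scale1 : left_id 1 submod_scale.
Proof. by move=> x; apply: submod_inj; exact: scale1r. Qed.
Fact submod_scaleDr : right_distributive submod_scale +%R.
Proof. by move=> a x y; apply: submod_inj; exact: scalerDr. Qed.
Fact submod_scaleDl x : {morph submod_scale^~ x : a b / a + b}.
Proof. by move=> a b; apply: submod_inj; exact: scalerDl. Qed.

HB.instance Definition _ := GRing.Zmodule_isLmodule.Build K X
  submod_scaleA submod_scale1 submod_scaleDr submod_scaleDl.

End Submodule.

(** Both inner products satisfy [|<x, x>| = |x|^2] for the norm of [A], so completeness for either
    is closedness of the space of columns. *)
Lemma ip_completeP (R : realType) (A A' : cstarAlgType R) (X : lmodType R[i])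
    (ip : X -> X -> A') (f : X -> A) (S : set A) :
  (forall x y, f (x - y) = f x - f y) ->
  (forall x, nrm (ip x x) = nrm (f x) ^+ 2) ->
  closed S -> (forall x, S (f x)) -> (forall a, S a -> exists x, f x = a) ->
  ip_complete ip.
Proof.
move=> fB fip Scl Sf Ssurj u Cu.
have ltE (x : X) (r : R) : 0 < r ->
    (`|ip x x| < (r ^+ 2)%:C) = (nrm (f x) < r).
  by move=> r0; rewrite nrmE ltcR fip ltr_pXn2r ?nnegrE ?nrm_ge0 ?(ltW r0).
have [|l ul] := @nrm_complete _ _ (f \o u).
  move=> r r0; have r2 : (0 : R[i]) < (r ^+ 2)%:C by rewrite ltcR exprn_gt0.
  have [N HN] := Cu _ r2; exists N => m n Nm Nn.
  by rewrite /= -fB -ltE //; exact: HN.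
have [|x xl] := Ssurj l.
  apply: (closedP Scl) => r r0; have [N HN] := ul _ r0.
  by exists (f (u N)) => //; rewrite nrm_dist; exact: HN.
exists x => r r0; have rE : (complex.Re r)%:C = r by rewrite RRe_real // gtr0_real.
have {}r0 : 0 < complex.Re r by rewrite -ltcR rE.
have s0 : 0 < Num.sqrt (complex.Re r) by rewrite sqrtr_gt0.
have [N HN] := ul _ s0; exists N => m Nm.
by rewrite -rE -(sqr_sqrtr (ltW r0)) ltE // fB xl; exact: HN.
Qed.

(** * The imprimitivity bimodule *)

Section Bimodule.
Variables (R : realType) (B : cstarAlgType R) (V : vectType R[i]).
Variables (dot : {dot V for Num.conj}) (A : cstarAlgType R).
Variables (t : B -> 'End(V) -> A) (hA : is_cstar_tensor dot t).
Variables (n : nat) (e : 'I_n -> V).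
Hypotheses (eON : forall i k, dot (e i) (e k) = (i == k)%:R)
  (eE : forall v, v = \sum_i dot v (e i) *: e i).
Local Notation E := (munit dot e).
Local Notation coord := (tcoord hA eON eE).
Variables (p : A) (pS : star p = p) (pp : p ** p = p).
Variable J0 : set B.
Local Notation J := (closed_span J0).
Hypothesis J_sub : cstar_subalgebra J.
Hypothesis p_in_J : forall i k a b, lspan J0 (a ** coord i k p ** b).
Hypothesis J_gen : forall x, J0 x ->
  exists c a b, x = \sum_i c *: (a ** coord i i p ** b).
Variable o : 'I_n.

Let cL i k : linear (coord i k) := tcoord_linear hA eON eE i k.
Let tl S : linear (t ^~ S) := tensor_linearl hA S.

(* The imprimitivity bimodule is the space [p A (1 (x) E_oo)]. *)
Definition column (x : A) : Prop :=
  p ** x = x /\ forall i k, k != o -> coord i k x = 0.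

Lemma column0 : column 0.
Proof. by split=> [|i k _]; [rewrite cmul0r | rewrite (lf0 (cL i k))]. Qed.

Lemma column_linear z x y : column x -> column y -> column (z *: x + y).
Proof.
move=> [px cx] [py cy]; split=> [|i k ko]; first by rewrite cmulDr cmulZr px py.
by rewrite cL cx // cy // scaler0 add0r.
Qed.

Local Notation X := (submod column0 column_linear).

Lemma columnP (x : X) : column (sval x).
Proof. exact: (@submod_P _ _ _ column0 column_linear x). Qed.

Lemma column_closed : closed column.
Proof.
move=> x /closureP cl; split=> [|i k ko]; apply/eqP; rewrite -subr_eq0;
    apply/eqP/nrm_eq0/eqP; rewrite eq_le nrm_ge0 andbT.
  apply: (@eq0_le_eps _ _ (nrm p + 1)) => r r0.
  have [s [ps _] as_] := cl _ r0.
  have -> : p ** x - x = p ** (x - s) - (x - s) by rewrite cmulBr ps; abel.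
  apply: le_trans (nrmB _ _) _; rewrite mulrDr mulr1.
  apply: lerD; last exact: ltW.
  by rewrite (le_trans (nrmM _ _)) // mulrC ler_wpM2r ?nrm_ge0 // ltW.
apply: (@eq0_le_eps _ _ 1) => r r0; have [s [_ cs] as_] := cl _ r0.
rewrite mulr1 -(cs i k ko) -(lfB (cL i k)).
by apply: le_trans (nrm_tcoord _ _ _ _ _ _) _; exact: ltW.
Qed.

Lemma column_mulr a x : column x -> column (p ** a ** x).
Proof.
move=> [px cx]; split=> [|i k ko]; first by rewrite !cmulA pp.
by rewrite tcoordM big1 // => l _; rewrite cx // cmul0r.
Qed.

Lemma column_mull x b : column x -> column (x ** t b (E o o)).
Proof.
move=> [px cx]; split=> [|i k ko]; first by rewrite cmulA px.
by rewrite tcoordM big1 // => l _; rewrite tcoord_munit (negPf ko) andbF cmul0r.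
Qed.

Lemma column_munit b i : column (p ** t b (E i o)).
Proof.
split=> [|h k ko]; first by rewrite cmulA pp.
by rewrite tcoordM big1 // => l _; rewrite tcoord_munit (negPf ko) andbF cmul0r.
Qed.

(** The inner factor [p] makes the action total on [A]; on the corner it is plain multiplication. *)
Definition lact (a : A) (x : X) : X := submod_mk _ _ (column_mulr a (columnP x)).
Definition ract (x : X) (b : B) : X := submod_mk _ _ (column_mull b (columnP x)).
Definition lip (x y : X) : A := sval x ** star (sval y).
Definition rip (x y : X) : B := coord o o (star (sval x) ** sval y).

Lemma ripE x y : star (sval x) ** sval y = t (rip x y) (E o o).
Proof.
have [_ cx] := columnP x; have [_ cy] := columnP y.
rewrite {1}(tcoordE hA eON eE (star _ ** _)) (bigD1 o) //=.
rewrite [X in _ + X]big1 ?addr0 => [|i io]; last first.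
  rewrite big1 // => k _; rewrite tcoordM big1 ?(lf0 (tl _)) // => l _.
  by rewrite tcoord_star cx // star0 cmul0l.
rewrite (bigD1 o) //= big1 ?addr0 // => k ko.
by rewrite tcoordM big1 ?(lf0 (tl _)) // => l _; rewrite cy // cmul0r.
Qed.

Lemma nrm_rip x : nrm (rip x x) = nrm (sval x) ^+ 2.
Proof. by rewrite -(nrm_tensor_munit hA eON _ o o) -ripE nrm_cstar. Qed.

Lemma nrm_lip x : nrm (lip x x) = nrm (sval x) ^+ 2.
Proof. by rewrite /lip -{1}[sval x]starK nrm_cstar nrm_star. Qed.

Lemma rip_coord x y : rip x y =
  \sum_i \sum_k star (coord i o (sval x)) ** coord i k p ** coord k o (sval y).
Proof.
have [py _] := columnP y.
rewrite /rip -{1}py tcoordM; apply: eq_bigr => i _; rewrite tcoord_star tcoordM.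
by rewrite cmul_sumr; apply: eq_bigr => k _; rewrite cmulA.
Qed.

Lemma lip_corner x y : corner p (lip x y).
Proof.
have [px _] := columnP x; have [py _] := columnP y.
apply/(cornerP pp); rewrite /lip; split; first by rewrite cmulA px.
by rewrite -cmulA -{1}pS -starM py.
Qed.

Lemma lip_left : full_left_hilbert_module (corner p) lact lip.
Proof.
have pC := @cornerP _ _ _ pp.
split.
- move=> a _ z x y; apply: submod_inj; rewrite /= cmulDr cmulZr //.
- move=> z a b x _ _; apply: submod_inj.
  by rewrite /= cmulDr cmulZr cmulDl cmulZl.
- move=> a b x Ca /pC[pb _]; apply: submod_inj.
  by rewrite /= [p ** b]pb !cmulA.
- exact: lip_corner.
- by move=> y z x x'; rewrite /lip /= cmulDl cmulZl.
- by move=> a x y /pC[pa _]; rewrite /lip /= pa cmulA.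
- by move=> x y; rewrite /lip starM starK.
- move=> x; have xE : lip x x = star (star (sval x)) ** star (sval x).
    by rewrite starK.
  have := lip_corner x x; rewrite xE.
  exact: starM_sqrt (corner_subalgebra pS pp).
- move=> x x0; apply: submod_inj; apply/nrm_eq0/eqP.
  by rewrite -sqrf_eq0 -nrm_lip x0 nrm0.
- apply: (ip_completeP (f := fun x : X => sval x) (S := column)) => //.
  + exact: nrm_lip.
  + exact: column_closed.
  + exact: columnP.
  + by move=> a Ca; exists (submod_mk _ _ Ca).
have [Ccl C0 CL _ _] := corner_subalgebra pS pp.
apply/seteqP; split=> [|_ [a _ <-]].
  by apply: closed_span_sub => // _ [x [y ->]]; exact: lip_corner.
apply: lspan_closed_span.
pose x i k : X := submod_mk _ _ (column_munit (coord i k p) i).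
pose y k l : X := submod_mk _ _ (column_munit (star (coord k l a)) l).
(* Writing [p a p] as [p (p a) p] makes each entry of the middle factor a sum of products
   [p_ik a_kl], and each product splits as a column times an adjoint column. *)
have -> : p ** a ** p = \sum_i \sum_l \sum_k lip (x i k) (y k l).
  rewrite -{1}pp -[p ** p ** a]cmulA [X in p ** X ** _](tcoordE hA eON eE).
  rewrite cmul_sumr cmul_suml; apply: eq_bigr => i _.
  rewrite cmul_sumr cmul_suml; apply: eq_bigr => l _.
  rewrite tcoordM (lf_sum (tl _)) cmul_sumr cmul_suml; apply: eq_bigr => k _.
  rewrite /lip /= starM (tensor_munit_star hA) starK pS !cmulA; congr (_ ** _).
  by rewrite -[RHS]cmulA (tensor_munitM hA eON) eqxx.
apply: lspan_sum => i _; apply: lspan_sum => l _; apply: lspan_sum => k _.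
by apply: lspan_mem; exists (x i k), (y k l).
Qed.

Lemma rip_right : full_right_hilbert_module J ract rip.
Proof.
have [Jcl J00 JL JM JS] := J_sub.
have ripJ x y : lspan J0 (rip x y).
  rewrite rip_coord; apply: lspan_sum => i _; apply: lspan_sum => k _.
  exact: p_in_J.
split.
- by move=> b _ z x y; apply: submod_inj; rewrite /= cmulDl cmulZl.
- by move=> z a b x _ _; apply: submod_inj; rewrite /= tl cmulDr cmulZr.
- move=> a b x _ _; apply: submod_inj.
  by rewrite /= -cmulA (tensor_munitM hA eON) eqxx.
- by move=> x y; exact/lspan_closed_span/ripJ.
- by move=> x z y y'; rewrite /rip /= cmulDr cmulZr cL.
- move=> b x y _; rewrite {1}/rip /= cmulA ripE.
  by rewrite (tensor_munitM hA eON) eqxx tcoord_munit !eqxx.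
- by move=> x y; rewrite /rip -tcoord_star starM starK.
(* [x^* x] is of the form [a^* a] in [A], not visibly in [B]; the root is found in this copy of [J]
   inside [A] and pulled back. *)
- move=> x; pose S := [set t b (E o o) | b in J].
  have SS : cstar_subalgebra S.
    split.
    + move=> a /closureP cl; exists (coord o o a).
        apply: (closedP Jcl) => r r0; have [_ [b Jb <-] ab] := cl _ r0.
        exists b => //; apply: le_lt_trans ab.
        have {1}-> : b = coord o o (t b (E o o)) by rewrite tcoord_munit !eqxx.
        by rewrite -(lfB (cL o o)) nrm_tcoord.
      apply/eqP; rewrite -subr_eq0; apply/eqP/nrm_eq0/eqP.
      rewrite eq_le nrm_ge0 andbT; apply: (@eq0_le_eps _ _ 2) => r r0.
      have [_ [b Jb <-] ab] := cl _ r0.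
      rewrite -(subrK (t b (E o o)) (t (coord o o a) _)) -addrA -(lfB (tl _)).
      apply: le_trans (nrmD _ _) _; rewrite mulr_natr mulr2n.
      apply: lerD; last by rewrite nrm_dist ltW.
      rewrite (nrm_tensor_munit hA eON); apply: le_trans (ltW ab).
      have {1}-> : b = coord o o (t b (E o o)) by rewrite tcoord_munit !eqxx.
      by rewrite -(lfB (cL o o)) nrm_tcoord.
    + by exists 0 => //; rewrite (lf0 (tl _)).
    + move=> z _ _ [a Ja <-] [b Jb <-]; exists (z *: a + b); first exact: JL.
      by rewrite tl.
    + move=> _ _ [a Ja <-] [b Jb <-]; exists (a ** b); first exact: JM.
      by rewrite (tensor_munitM hA eON) eqxx.
    + move=> _ [a Ja <-]; exists (star a); first exact: JS.
      by rewrite (tensor_munit_star hA).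
  have [|s [b Jb <-]] := starM_sqrt SS (a := sval x).
    by exists (rip x x); [exact/lspan_closed_span/ripJ | rewrite ripE].
  rewrite ripE (tensor_munit_star hA) (tensor_munitM hA eON) eqxx => E1.
  exists b => //; apply/eqP; rewrite -subr_eq0; apply/eqP.
  by apply: (tensor_munit_inj hA eON (i := o) (k := o)); rewrite (lfB (tl _)) E1 subrr.
- move=> x x0; apply: submod_inj; apply/nrm_eq0/eqP.
  by rewrite -sqrf_eq0 -nrm_rip x0 nrm0.
- apply: (ip_completeP (f := fun x : X => sval x) (S := column)) => //.
  + exact: nrm_rip.
  + exact: column_closed.
  + exact: columnP.
  + by move=> a Ca; exists (submod_mk _ _ Ca).
apply/seteqP; split.
  apply: closed_span_sub => // _ [x [y ->]].
  exact/lspan_closed_span/ripJ.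
apply: closed_span_sub => [|||_ /J_gen[c [a [b ->]]]].
- exact: closed_span_closed.
- exact: closed_span0.
- exact: closed_span_linear.
apply: lspan_closed_span; apply: lspan_sum => i _; apply: lspanZ.
(* These columns have inner product [a p_ii b], as [star p ** p = p]. *)
apply: lspan_mem; exists (submod_mk _ _ (column_munit (star a) i)).
exists (submod_mk _ _ (column_munit b i)); rewrite /rip /=.
have -> : star (p ** t (star a) (E i o)) ** (p ** t b (E i o)) =
    t a (E o i) ** p ** t b (E i o).
  by rewrite starM (tensor_munit_star hA) starK pS cmulA -(cmulA _ p p) pp.
rewrite tcoordM (bigD1 i) //= [X in _ + X]big1 ?addr0 => [|l li]; last first.
  by rewrite tcoord_munit (negPf li) cmul0r.
rewrite tcoord_munit !eqxx /= tcoordM (bigD1 i) //= [X in _ + X]big1 ?addr0.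
  by rewrite tcoord_munit !eqxx.
by move=> l li; rewrite tcoord_munit (negPf li) andbF cmul0l.
Qed.

Lemma bimodule_imprimitivity : imprimitivity_bimodule (corner p) J lact ract lip rip.
Proof.
have pC := @cornerP _ _ _ pp.
split.
- exact: lip_left.
- exact: rip_right.
- by move=> a x b _ _; apply: submod_inj; rewrite /= !cmulA.
- move=> a x y /pC[pa ap]; rewrite /rip /= pa.
  have -> : p ** star a = star a by rewrite -{1}pS -starM ap.
  by rewrite starM cmulA.
- move=> b x y _; rewrite /lip /= starM (tensor_munit_star hA) starK.
  by rewrite cmulA.
- move=> x y z; apply: submod_inj; rewrite /= -ripE /lip.
  have [px _] := columnP x.
  by rewrite cmulA px !cmulA.
Qed.

End Bimodule.

Theorem theorem5p1 (R : realType)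
  (L : topologicalGroupType) (hL : locally_compact_group L)
  (M : set L) (hM : is_subgroup M) (hMc : compact M) (hMo : open M)
  (mu : {measure set (borel L) -> \bar R}) (hmu : is_left_haar mu)
  (hmuM : mu M = 1%E)
  (Delta : L -> R) (hDelta : is_modular_function mu Delta)
  (V : vectType R[i]) (dot : {dot V for Num.conj}) (sigma : L -> 'End(V))
  (hsigma : unitary_rep M dot (fun k => sigma k : V -> V))
  (hirr : irreducible_rep M sigma)
  (B : cstarAlgType R) (j : (L -> R[i]) -> B)
  (hB : is_group_cstar mu Delta j)
  (lambda : L -> multiplier B) (hlambda : is_lambda j lambda)
  (A : cstarAlgType R) (t : B -> 'End(V) -> A) (hA : is_cstar_tensor dot t)
  (lambda_sigma : L -> multiplier A)
  (hls : forall k, M k ->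
     is_multiplier_tensor t (lambda k) (sigma k) (lambda_sigma k))
  (p : A) (hp : is_strict_integral mu M lambda_sigma (mult_of p))
  (psi : multiplier B)
  (hpsi : is_strict_integral mu M
            (fun k => mult_scale (psi_fun sigma k) (lambda k)) psi) :
  morita_rieffel (corner p)
    (closed_span [set x | exists a b : B, x = a ** mult_l psi b]).
Proof.
have [n [e [eON eE]]] := orthonormal_basis dot.
have [i0 _] : exists i0 : 'I_n, True.
  apply: contrapT => H; have [+ _] := hirr; rewrite lt0n dimv_eq0.
  move/negP; apply; apply/eqP/vspaceP => v; rewrite memvf memv0 (eE v).
  by rewrite big1 ?eqxx // => i; case: H; exists i.
have pS := hecke_projection_star hM hMo hmu hmuM hDelta hsigma hB hlambda hA hls hp eON eE.
have pp := hecke_projection_idem hM hMo hmu hmuM hDelta hsigma hB hlambda hA hls hp eON eE.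
have J_sub := ideal_subalgebra hM hMo hmu hmuM hDelta hsigma hirr hB hlambda hA
  hls hp hpsi eON eE.
split; [exact: corner_subalgebra | exact: J_sub |].
have p_in_J := coord_p_in_span hM hMo hmu hmuM hDelta hsigma hirr hB hlambda hA
  hls hp hpsi eON eE.
have [c cE] := psi_coord hirr hA hls hp hpsi eON eE.
have J_gen x : (exists a b, x = a ** mult_l psi b) ->
    exists c a b, x = \sum_i c *: (a ** tcoord hA eON eE i i p ** b).
  by move=> [a [b ->]]; exists c, a, b.
do 5! eexists; exact: (bimodule_imprimitivity pS pp J_sub p_in_J J_gen i0).
Qed.
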